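(* Let $(G,w)$ be a node-weighted series-parallel graph with $w:V(G)\to\{0,1,2,\dots\}$. Then $|P_2^0(G,w)|$ can be calculated in time polynomial in $(|G|,w(G))$, where $w(G)$ is the total weight (the input to the polynomial being the value of $w(G)$, not its binary length).
   Context: A two-terminal graph has a distinguished source and sink. Series-parallel graphs are the smallest class of two-terminal graphs containing $K_2$ and closed under series composition (identify the sink of the first with the source of the second) and parallel composition (identify the two sources and the two sinks). For $A\subseteq V(G)$, $w(A)=\sum_{a\in A}w(a)$. $P_2^0(G,w)$ is the set of balanced connected $2$-partitions: partitions of $V(G)$ into two nonempty blocks $A,B$ each inducing a connected subgraph, with $w(A)=w(B)$. *)

(* Defs.v *)
From mathcomp Require Import all_boot.
Set Implicit Arguments.
Unset Strict Implicit.
Unset Printing Implicit Defensive.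

(* Two-terminal graphs: finite multigraphs given by a list of edges.  A list  *)
(* entry (x, y) is an undirected edge xy; its orientation and its position in *)
(* the list carry no meaning, its multiplicity does.                          *)

Record ttgraph := TTGraph {
  nv : nat;
  edges : seq ('I_nv * 'I_nv);
  source : 'I_nv;
  sink : 'I_nv
}.

Definition gsize (G : ttgraph) : nat := nv G + size (edges G).

Definition endpoints (T : finType) (e : T * T) : {set T} := [set e.1; e.2].

Definition adj (G : ttgraph) : rel 'I_(nv G) :=
  [rel x y | ((x, y) \in edges G) || ((y, x) \in edges G)].

Definition is_K2 (G : ttgraph) : Prop :=
  [/\ nv G = 2, source G != sink G &
      [seq endpoints e | e <- edges G] = [:: [set source G; sink G]]].

(* G is, up to isomorphism, the disjoint union of G1 and G2 in which the      *)
(* vertex x of G1 is identified with the vertex y of G2 exactly when R x y;   *)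
(* f1 and f2 are the resulting maps of G1 and G2 into G.                      *)
Definition glued (G1 G2 G : ttgraph) (R : 'I_(nv G1) -> 'I_(nv G2) -> bool)
    (f1 : 'I_(nv G1) -> 'I_(nv G)) (f2 : 'I_(nv G2) -> 'I_(nv G)) : Prop :=
  [/\ injective f1, injective f2,
      forall x y, (f1 x == f2 y) = R x y,
      forall z, (z \in codom f1) || (z \in codom f2) &
      perm_eq [seq endpoints e | e <- edges G]
              ([seq endpoints (f1 e.1, f1 e.2) | e <- edges G1] ++
               [seq endpoints (f2 e.1, f2 e.2) | e <- edges G2])].

Definition is_series (G1 G2 G : ttgraph) : Prop :=
  exists f1 f2,
    [/\ @glued G1 G2 G (fun x y => (x == sink G1) && (y == source G2)) f1 f2,
        source G = f1 (source G1) & sink G = f2 (sink G2)].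

Definition is_parallel (G1 G2 G : ttgraph) : Prop :=
  exists f1 f2,
    [/\ @glued G1 G2 G (fun x y => (x == source G1) && (y == source G2)
                                || (x == sink G1) && (y == sink G2)) f1 f2,
        source G = f1 (source G1) & sink G = f1 (sink G1)].

Inductive series_parallel : ttgraph -> Prop :=
| SP_K2 G : is_K2 G -> series_parallel G
| SP_series G1 G2 G : series_parallel G1 -> series_parallel G2 ->
    is_series G1 G2 G -> series_parallel G
| SP_parallel G1 G2 G : series_parallel G1 -> series_parallel G2 ->
    is_parallel G1 G2 G -> series_parallel G.

Definition connected_in (G : ttgraph) (A : {set 'I_(nv G)}) : bool :=
  [forall x in A, forall y in A,
     connect [rel u v | [&& u \in A, v \in A & adj u v]] x y].

Definition weight (G : ttgraph) (w : 'I_(nv G) -> nat) (A : {set 'I_(nv G)}) :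
  nat := \sum_(a in A) w a.

(* The blocks of a partition are nonempty by definition of partition.         *)
Definition P20 (G : ttgraph) (w : 'I_(nv G) -> nat) :
    {set {set {set 'I_(nv G)}}} :=
  [set P : {set {set 'I_(nv G)}} |
     [&& partition P [set: 'I_(nv G)], #|P| == 2,
         [forall A in P, connected_in A] &
         [forall A in P, forall B in P, weight w A == weight w B]]].

(* Model of computation: a first-order call-by-value Lisp with mutually       *)
(* recursive functions, whose values are immutable binary trees with natural  *)
(* numbers at the leaves, under the logarithmic cost criterion.               *)
(* Representing trees by pointers into a shared heap, every evaluation rule   *)
(* takes a bounded number of pointer operations, plus arithmetic on binary    *)
(* numbers that is polynomial in the bit lengths charged.  A run of cost t    *)
(* on an input of size s thus takes time polynomial in s + t on a Turing      *)
(* machine, and conversely a Turing machine is simulated with polynomial      *)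
(* overhead.                                                                  *)

Inductive val := Atom of nat | Pair of val & val.

Inductive expr :=
| Var of nat                   (* de Bruijn index into the environment *)
| Const of nat
| Add of expr & expr
| Sub of expr & expr           (* truncated; a <= b iff a - b is zero *)
| Mul of expr & expr
| Cons of expr & expr
| Car of expr
| Cdr of expr
| IsPair of expr
| If of expr & expr & expr     (* else-branch iff the condition is Atom 0 *)
| Let of expr & expr
| Call of nat & expr.          (* index of a function of the program *)

(* The list of the bodies of the functions.  Each function has one argument,  *)
(* Var 0 in its body; several arguments are passed as a tree.                 *)
Definition program := seq expr.

Definition bitlen (n : nat) : nat := (trunc_log 2 n).+1.

(* eval p env e v t: in the program p and the environment env, the expression *)
(* e evaluates to v with cost t.  Ill-typed operations have no value.         *)
Inductive eval (p : program) : seq val -> expr -> val -> nat -> Prop :=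
| EvVar env i : i < size env ->
    eval p env (Var i) (nth (Atom 0) env i) 1
| EvConst env n : eval p env (Const n) (Atom n) 1
| EvAdd env a b m n t1 t2 :
    eval p env a (Atom m) t1 -> eval p env b (Atom n) t2 ->
    eval p env (Add a b) (Atom (m + n)) (t1 + t2 + bitlen m + bitlen n).+1
| EvSub env a b m n t1 t2 :
    eval p env a (Atom m) t1 -> eval p env b (Atom n) t2 ->
    eval p env (Sub a b) (Atom (m - n)) (t1 + t2 + bitlen m + bitlen n).+1
| EvMul env a b m n t1 t2 :
    eval p env a (Atom m) t1 -> eval p env b (Atom n) t2 ->
    eval p env (Mul a b) (Atom (m * n)) (t1 + t2 + bitlen m + bitlen n).+1
| EvCons env a b u v t1 t2 :
    eval p env a u t1 -> eval p env b v t2 ->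
    eval p env (Cons a b) (Pair u v) (t1 + t2).+1
| EvCar env a u v t : eval p env a (Pair u v) t ->
    eval p env (Car a) u t.+1
| EvCdr env a u v t : eval p env a (Pair u v) t ->
    eval p env (Cdr a) v t.+1
| EvIsPairTrue env a u v t : eval p env a (Pair u v) t ->
    eval p env (IsPair a) (Atom 1) t.+1
| EvIsPairFalse env a n t : eval p env a (Atom n) t ->
    eval p env (IsPair a) (Atom 0) t.+1
| EvIfTrue env c a b u v t1 t2 : u <> Atom 0 ->
    eval p env c u t1 -> eval p env a v t2 ->
    eval p env (If c a b) v (t1 + t2).+1
| EvIfFalse env c a b v t1 t2 :
    eval p env c (Atom 0) t1 -> eval p env b v t2 ->
    eval p env (If c a b) v (t1 + t2).+1
| EvLet env a b u v t1 t2 :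
    eval p env a u t1 -> eval p (u :: env) b v t2 ->
    eval p env (Let a b) v (t1 + t2).+1
| EvCall env f a u v t1 t2 : f < size p ->
    eval p env a u t1 -> eval p [:: u] (nth (Const 0) p f) v t2 ->
    eval p env (Call f a) v (t1 + t2).+1.

(* The main function is the first one. *)
Definition computes_in (p : program) (input output : val) (t : nat) : Prop :=
  eval p [:: input] (Call 0 (Var 0)) output t.

Fixpoint encode_seq (s : seq val) : val :=
  if s is x :: s' then Pair x (encode_seq s') else Atom 0.

(* The list (n, edges, source, sink, weights), vertices being numbers below n *)
(* and the weights being listed in the order of the vertices.                 *)
Definition encode (G : ttgraph) (w : 'I_(nv G) -> nat) : val :=
  encode_seq
    [:: Atom (nv G);
        encode_seq [seq Pair (Atom (nat_of_ord e.1)) (Atom (nat_of_ord e.2))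
                   | e <- edges G];
        Atom (source G); Atom (sink G);
        encode_seq [seq Atom (w i) | i <- enum 'I_(nv G)]].

(* Main.v *)
Require Import Defs.
From mathcomp Require Import all_boot all_algebra.
From mathcomp Require Import zify.
Set Implicit Arguments.
Unset Strict Implicit.
Unset Printing Implicit Defensive.

(* A series-parallel graph is reduced to a single item by merging parallel
   items and by eliminating, in any order, nonterminal vertices incident to
   exactly two items.  Eliminations commute and never raise the degree of
   another vertex to three, so a width-2 elimination order, which the inductive
   definition of series-parallel graphs provides, survives any such step; and
   as no vertex separates a set of nonterminals from the rest, the degree of
   the next vertex in that order is exactly 2.  Each item carries four
   generating functions, by interior weight, of the traces that a connected
   bipartition can leave on the corresponding two-terminal subgraph; they obey
   polynomial recurrences under series and parallel composition.  The
   polynomials are stored as natural numbers, namely as their values at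
   Z = X^2 with X = 2^(n+1) (Kronecker substitution).  A polynomial then is
   multiplied by one multiplication, and since there are at most 2^n < X
   bipartitions, the number of balanced ones is the digit of index w(G), in
   base X, of the sum of X^(2 w(B)), where B runs over the blocks that avoid a
   fixed terminal. *)

(** * Connectivity of glued vertex sets *)

(** The decomposition is not part of the input, so the program has to find one. The terms built by
    the reduction exist only in the proof: the program keeps, for each item, its two ends and five
    numbers, and the term supplies their meaning. That meaning also controls the size of the
    numbers. Estimated through the recurrences alone, bit lengths could be multiplied at every
    composition; but each number is a sum, over at most 2^n vertex sets, of powers Z^e with e at
    most w(G), hence has O(n (w(G) + 1)) bits whatever the order of the steps. Here the value of
    w(G), not its length, enters the cost. The square in Z = X^2 turns balance into the test 2 w(B)
    = w(G), so that odd totals need no separate case. Two properties of the elimination order are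
    carried along, degrees at most 2 and the absence of separating vertices: a vertex left with a
    single incident item could never be eliminated by a series step. *)

Section Connectivity.
Variable T : finType.
Implicit Types (es : seq (T * T)) (A V : {set T}) (f : T -> bool).

(** Connectivity is tested by two-colourings constant along the edges inside [A], not by paths.
    Colourings restrict to the parts of a glued graph and extend from them, which is all that the
    gluing lemmas need. *)
Definition compat es A f :=
  forall e, e \in es -> e.1 \in A -> e.2 \in A -> f e.1 = f e.2.

(** [U] is one colour class; a quantifier over finite sets keeps the predicate boolean. *)
Definition conn es A : bool :=
  [forall U : {set T},
     all (fun e => [&& e.1 \in A & e.2 \in A] ==> ((e.1 \in U) == (e.2 \in U))) es
     ==> [forall x in A, forall y in A, (x \in U) == (y \in U)]].

Lemma connP es A :
  reflect (forall f, compat es A f -> {in A &, forall x y, f x = f y})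
          (conn es A).
Proof.
apply: (iffP forallP) => [H f cf x y xA yA|H U].
  have /implyP/(_ _)/forall_inP/(_ x xA)/forall_inP/(_ y yA) := H [set u | f u].
  rewrite !inE => E; apply/eqP/E; apply/allP=> e ee; apply/implyP=> /andP[e1 e2].
  by rewrite !inE (cf e).
apply/implyP=> /allP cU; apply/forall_inP=> x xA; apply/forall_inP=> y yA.
apply/eqP; apply: (H (fun u => u \in U)) => // e ee e1 e2.
by apply/eqP; move: (cU e ee); rewrite e1 e2.
Qed.

Lemma conn_eq_mem es es' A : es =i es' -> conn es A = conn es' A.
Proof.
by move=> eq_es; apply/connP/connP => H f cf; apply: H => e ee; apply: cf;
  rewrite ?eq_es // -eq_es.
Qed.

Lemma conn_cons_sym x y es A : conn ((x, y) :: es) A = conn ((y, x) :: es) A.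
Proof.
apply/connP/connP => H f cf; apply: H => e; rewrite inE => /orP[/eqP->|ee] /= *.
- by rewrite (cf (y, x)) ?mem_head.
- by rewrite (cf e) // inE ee orbT.
- by rewrite (cf (x, y)) ?mem_head.
- by rewrite (cf e) // inE ee orbT.
Qed.

Lemma conn_cons es A x y : conn es A -> conn ((x, y) :: es) A.
Proof.
move=> /connP H; apply/connP=> f cf; apply: H => e ee; apply: cf.
by rewrite inE ee orbT.
Qed.

Definition within es V := forall e, e \in es -> (e.1 \in V) && (e.2 \in V).

Section Gluing.
Variables (es1 es2 : seq (T * T)) (V1 V2 A : {set T}).
Hypotheses (in1 : within es1 V1) (in2 : within es2 V2).

Lemma compat_cat f : compat (es1 ++ es2) A f <->
  compat es1 (A :&: V1) f /\ compat es2 (A :&: V2) f.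
Proof.
split=> [H|[H1 H2]].
  by split=> e ee; rewrite !inE => /andP[e1 _] /andP[e2 _]; apply: H => //;
    rewrite mem_cat ee ?orbT.
move=> e; rewrite mem_cat => /orP[] ee e1 e2.
  by case/andP: (in1 ee) => *; apply: H1; rewrite // inE ?e1 ?e2.
by case/andP: (in2 ee) => *; apply: H2; rewrite // inE ?e1 ?e2.
Qed.

Hypothesis sA : A \subset V1 :|: V2.

Let inA u : u \in A -> (u \in A :&: V1) || (u \in A :&: V2).
Proof. by move=> uA; have := subsetP sA u uA; rewrite !inE uA. Qed.

(** A colouring of one part extends to the other by its value at the cut vertex [z]; conversely,
    within its own part every vertex has the colour of [z]. *)
Lemma conn_glue_pt z : z \in A -> z \in V1 -> z \in V2 ->
    (forall u, u \in A -> u \in V1 -> u \in V2 -> u = z) ->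
  conn (es1 ++ es2) A = conn es1 (A :&: V1) && conn es2 (A :&: V2).
Proof.
move=> zA z1 z2 zE; have zA1 : z \in A :&: V1 by rewrite inE zA.
have zA2 : z \in A :&: V2 by rewrite inE zA.
apply/connP/andP => [H|[/connP H1 /connP H2] f /compat_cat[c1 c2]]; last first.
  have to_z u : u \in A -> f u = f z.
    by case/inA/orP=> uA; [apply: H1 | apply: H2].
  by move=> x y xA yA; rewrite !to_z.
split; apply/connP=> f cf x y xA yA.
  have cg : compat (es1 ++ es2) A (fun u => if u \in V1 then f u else f z).
    apply/compat_cat; split=> e ee e1 e2.
      by move: (e1) (e2); rewrite !inE => /andP[_ ->] /andP[_ ->]; apply: cf.
    move: e1 e2; rewrite !inE => /andP[e1 e1'] /andP[e2 e2'].
    by case: ifP => [/zE->//|_]; case: ifP => [/zE->//|_].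
  move: (H _ cg x y); move: xA yA; rewrite !inE => /andP[-> ->] /andP[-> ->].
  exact.
have cg : compat (es1 ++ es2) A (fun u => if u \in V2 then f u else f z).
  apply/compat_cat; split=> e ee e1 e2; last first.
    by move: (e1) (e2); rewrite !inE => /andP[_ ->] /andP[_ ->]; apply: cf.
  move: e1 e2; rewrite !inE => /andP[e1 e1'] /andP[e2 e2'].
  by case: ifP => [/zE->//|_]; case: ifP => [/zE->//|_].
move: (H _ cg x y); move: xA yA; rewrite !inE => /andP[-> ->] /andP[-> ->].
exact.
Qed.

(** Membership in [V1] is itself a compatible colouring when [A] avoids the overlap of the two
    parts. *)
Lemma conn_side u :
    (forall v, v \in A -> v \in V1 -> v \notin V2) ->
  conn (es1 ++ es2) A -> u \in A -> u \in V1 -> A \subset V1.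
Proof.
move=> dis /connP H uA u1; apply/subsetP=> v vA.
rewrite (H (fun t => t \in V1) _ v u) //; apply/compat_cat.
split=> e ee; rewrite !inE => /andP[e1 e1'] /andP[e2 e2'].
  by rewrite e1' e2'.
have N w : w \in A -> w \in V2 -> (w \in V1) = false.
  by move=> wA w2; apply/negP=> /(dis w wA); rewrite w2.
by rewrite !N.
Qed.

(** The connected second part forces [x] and [y] to have the same colour and imposes nothing else on
    the first part, so it acts as an edge [xy]. *)
Lemma conn_glue_two x y :
    x \in A -> x \in V1 -> x \in V2 -> y \in A -> y \in V1 -> y \in V2 ->
    (forall u, u \in A -> u \in V1 -> u \in V2 -> (u == x) || (u == y)) ->
    conn es2 (A :&: V2) ->
  conn (es1 ++ es2) A = conn ((x, y) :: es1) (A :&: V1).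
Proof.
move=> xA x1 x2 yA y1 y2 shared /connP H2; apply/connP/connP => H f.
  move=> cf; set g := fun u => if u \in V1 then f u else f x.
  have fxy : f x = f y.
    by apply: (cf (x, y)); rewrite ?mem_head //= inE ?xA ?yA.
  have cg : compat (es1 ++ es2) A g.
    apply/compat_cat; rewrite /g; split=> e ee e1 e2.
      have ee' : e \in (x, y) :: es1 by rewrite inE ee orbT.
      by move: (cf e ee' e1 e2) (e1) (e2); rewrite !inE => -> /andP[_ ->] /andP[_ ->].
    move: e1 e2; rewrite !inE => /andP[e1 e1'] /andP[e2 e2'].
    have E u : u \in A -> u \in V2 -> (if u \in V1 then f u else f x) = f x.
      by move=> uA u2; case: ifP => // u1; case/orP: (shared u uA u1 u2) => /eqP->.
    by rewrite !E.
  move=> u v; rewrite !inE => /andP[uA u1] /andP[vA v1].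
  by have := H g cg u v uA vA; rewrite /g u1 v1.
case/compat_cat=> c1 c2.
have fxy : f x = f y by apply: H2; rewrite ?inE ?xA ?yA.
have cf : compat ((x, y) :: es1) (A :&: V1) f.
  by move=> e; rewrite inE => /orP[/eqP->//|]; apply: c1.
have to_x u : u \in A -> f u = f x.
  case/inA/orP=> uA; first by apply: (H f cf); rewrite // inE xA.
  by apply: H2; rewrite // inE xA.
by move=> u v uA vA; rewrite !to_x.
Qed.

(** Nothing but the edge [xy] links the two parts of [A]: a colouring of either part extends to the
    other by a constant, the colour that this edge transmits. *)
Lemma conn_glue_bridge x y : x \in A -> x \in V1 -> y \in A -> y \in V2 ->
    (forall u, u \in A -> u \in V1 -> u \notin V2) ->
  conn ((x, y) :: es1 ++ es2) A = conn es1 (A :&: V1) && conn es2 (A :&: V2).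
Proof.
move=> xA x1 yA y2 dis.
have y1 : y \notin V1 by apply/negP=> /(dis _ yA); rewrite y2.
have comp_cons f : compat ((x, y) :: es1 ++ es2) A f <->
    f x = f y /\ compat (es1 ++ es2) A f.
  split=> [c|[fxy c] e].
    split; first by apply: (c (x, y)); rewrite ?mem_head.
    by move=> e ee; apply: c; rewrite inE ee orbT.
  by rewrite inE => /orP[/eqP->//|]; apply: c.
apply/connP/andP => [H|[/connP H1 /connP H2] f]; last first.
  case/comp_cons=> fxy /compat_cat[c1 c2].
  have to_x u : u \in A -> f u = f x.
    case/inA/orP=> uA; first by apply: H1; rewrite // inE xA.
    by rewrite fxy; apply: H2; rewrite // inE yA.
  by move=> u v uA vA; rewrite !to_x.
split; apply/connP=> f cf u v uA vA.
  have cg : compat ((x, y) :: es1 ++ es2) A (fun u => if u \in V1 then f u else f x).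
    apply/comp_cons; split; first by rewrite x1 (negPf y1).
    apply/compat_cat; split=> e ee e1 e2.
      by move: (e1) (e2); rewrite !inE => /andP[_ ->] /andP[_ ->]; apply: cf.
    move: e1 e2; rewrite !inE => /andP[e1 e1'] /andP[e2 e2'].
    case: ifP => [/(dis _ e1)|_]; rewrite ?e1' //.
    by case: ifP => [/(dis _ e2)|_]; rewrite ?e2'.
  move: (H _ cg u v); move: uA vA; rewrite !inE => /andP[-> ->] /andP[-> ->].
  exact.
have cg : compat ((x, y) :: es1 ++ es2) A (fun u => if u \in V2 then f u else f y).
  apply/comp_cons; split; first by rewrite y2 (negPf (dis x xA x1)).
  apply/compat_cat; split=> e ee e1 e2; last first.
    by move: (e1) (e2); rewrite !inE => /andP[_ ->] /andP[_ ->]; apply: cf.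
  move: e1 e2; rewrite !inE => /andP[e1 e1'] /andP[e2 e2'].
  by rewrite !ifN ?dis.
move: (H _ cg u v); move: uA vA; rewrite !inE => /andP[-> ->] /andP[-> ->].
exact.
Qed.

(** Contracting the connected second part to its attachment [m] turns the chord [xy] into an edge
    [xm]. *)
Lemma conn_glue_chord x y m :
    x \in A -> x \in V1 -> y \in A -> y \in V2 ->
    m \in A -> m \in V1 -> m \in V2 ->
    (forall u, u \in A -> u \in V1 -> u \in V2 -> u = m) ->
    conn es2 (A :&: V2) ->
  conn ((x, y) :: es1 ++ es2) A = conn ((x, m) :: es1) (A :&: V1).
Proof.
move=> xA x1 yA y2 mA m1 m2 shared /connP H2; apply/connP/connP => H f cf.
  set g := fun u => if u \in V1 then f u else f m.
  have fxm : f x = f m.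
    by apply: (cf (x, m)); rewrite ?mem_head //= inE ?xA ?mA.
  have gm u : u \in A -> u \in V2 -> g u = f m.
    by rewrite /g => uA u2; case: ifP => // /shared->.
  have c : compat (es1 ++ es2) A g.
    apply/compat_cat; split=> e ee e1 e2.
      have ee' : e \in (x, m) :: es1 by rewrite inE ee orbT.
      move: (cf e ee' e1 e2) (e1) (e2); rewrite /g !inE.
      by move=> -> /andP[_ ->] /andP[_ ->].
    by move: e1 e2; rewrite !inE => /andP[e1 e1'] /andP[e2 e2']; rewrite !gm.
  have cg : compat ((x, y) :: es1 ++ es2) A g.
    move=> e; rewrite inE => /orP[/eqP-> _ _|]; last exact: c.
    by rewrite [RHS]gm //= /g x1.
  move=> u v; rewrite !inE => /andP[uA u1] /andP[vA v1].
  by have := H g cg u v uA vA; rewrite /g u1 v1.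
have fxy : f x = f y by apply: (cf (x, y)); rewrite ?mem_head.
have /compat_cat[c1 c2] : compat (es1 ++ es2) A f.
  by move=> e ee; apply: cf; rewrite inE ee orbT.
have fym : f y = f m by apply: H2; rewrite ?inE ?yA ?mA.
have c : compat ((x, m) :: es1) (A :&: V1) f.
  by move=> e; rewrite inE => /orP[/eqP-> _ _|]; [rewrite /= fxy | apply: c1].
have to_m u : u \in A -> f u = f m.
  case/inA/orP=> uA; first by apply: (H f c); rewrite // inE mA.
  by apply: H2; rewrite // inE mA.
by move=> u v uA vA; rewrite !to_m.
Qed.

End Gluing.

Lemma conn_local es1 es2 V2 A : within es2 V2 -> [disjoint A & V2] ->
  conn (es1 ++ es2) A = conn es1 A.
Proof.
move=> in2 dis; apply/connP/connP => H f cf; apply: H => e.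
  rewrite mem_cat => /orP[|/in2/andP[e1 _] e1']; first exact: cf.
  by rewrite (disjointFr dis e1') in e1.
by move=> ee; apply: cf; rewrite mem_cat ee.
Qed.

Lemma conn_catC es1 es2 A : conn (es1 ++ es2) A = conn (es2 ++ es1) A.
Proof. by apply: conn_eq_mem => e; rewrite !mem_cat orbC. Qed.

End Connectivity.

(** * Bipartitions of series and parallel compositions *)

(** Set identities are checked at a single point by running through the truth values of the
    memberships involved. Disjointness is therefore stated as a sum of indicators bounded by 1,
    which computes in every case. *)
Ltac brute :=
  rewrite ?inE ?eqxx;
  repeat match goal with
  | |- context [?u == ?v] => case: (u == v) => //=
  | |- context [?u \in ?S] => case: (u \in S) => //=
  end.

(** Substituting [m] for [u] first makes facts about the two points coincide when the points do. *)
Ltac brute_at u m := rewrite ?inE; have [->|_] := eqVneq u m; brute.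

Section Counting.
Variable T : finType.
Implicit Types (x y m u : T) (es : seq (T * T)) (B I V : {set T}).

(** [B] is what the block of the sink [y] leaves in the interior; it may be empty. *)
Definition sep x y I es : {set {set T}} :=
  [set B : {set T} | [&& B \subset I, conn es (y |: B) & conn es (x |: (I :\: B))]].

(** Only the block of the terminals is tested with [es'], so that an extra edge [xy] there can stand
    for a connection outside the graph. *)
Definition inn x y I es es' : {set {set T}} :=
  [set B : {set T} |
    [&& B \subset I, B != set0, conn es B & conn es' (x |: (y |: (I :\: B)))]].

Definition closed_inn x y I es := inn x y I es es.
Definition open_inn x y I es := inn x y I es ((x, y) :: es).

Lemma subE B I : B \subset I -> forall u, (u \in B) ==> (u \in I).
Proof. by move/subsetP=> s u; apply/implyP/s. Qed.

Lemma innP x y I es es' B :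
  reflect [/\ B \subset I, exists u, u \in B, conn es B
            & conn es' (x |: (y |: (I :\: B)))]
          (B \in inn x y I es es').
Proof.
rewrite inE; apply: (iffP and4P) => [[? /set0Pn ? ? ?]|[? ? ? ?]] //.
by split=> //; apply/set0Pn.
Qed.

(** * Series composition at a middle vertex *)

Section Series.
Variables (x y m : T) (I1 I2 : {set T}) (es1 es2 : seq (T * T)).
Let V1 := x |: (m |: I1).
Let V2 := m |: (y |: I2).
Let I := m |: (I1 :|: I2).
Let es := es1 ++ es2.
Hypothesis dis : forall u,
  (u == x) + (u == y) + (u == m) + (u \in I1) + (u \in I2) <= 1.
Hypotheses (in1 : within es1 V1) (in2 : within es2 V2).
Hypotheses (c1 : conn es1 V1) (c2 : conn es2 V2).

(** With [m] in the block of [y], the block of [x] cannot pass [m] and stays in the first part; the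
    whole second interior falls to [B], and only the trace on [I1] is free. *)
Lemma ser_sep_in B : m \in B ->
  (B \in sep x y I es) =
  [&& B \subset I, I2 \subset B & B :&: I1 \in sep x m I1 es1].
Proof.
move=> mB; rewrite !inE subsetIr /=; case: (boolP (B \subset I)) => //= /subE sB.
have mN : m \notin x |: (I :\: B).
  by move: mB (dis m); rewrite /I; brute.
have sA : x |: (I :\: B) \subset V1 :|: V2.
  by apply/subsetP=> u; rewrite /V1 /V2 /I; brute.
have sA' : y |: B \subset V1 :|: V2.
  by apply/subsetP=> u; move: (sB u); rewrite /V1 /V2 /I; brute.
case: (boolP (I2 \subset B)) => /= [/subE s2|nsub]; last first.
  apply/negP=> /andP[_ cA]; case/negP: nsub.
  have s1 : x |: (I :\: B) \subset V1.
    apply: (conn_side in1 in2 (u:=x)); rewrite ?inE ?eqxx //.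
    move=> v vA v1; apply/negP=> v2; case/negP: mN; move: (dis v) vA v1 v2.
    by rewrite /V1 /V2 /I !inE; have [->|_] := eqVneq v m; brute.
  apply/subsetP=> u u2; move/subE/(_ u): s1; move: u2 (dis u).
  by rewrite /V1 /I; brute.
rewrite (conn_glue_pt in1 in2 sA' (z:=m)); first last.
- move=> u; rewrite /V1 /V2; have [->//|] := eqVneq u m.
  by move: (dis u); brute.
- by rewrite /V2; brute.
- by rewrite /V1; brute.
- by move: mB; brute.
have -> : (y |: B) :&: V2 = V2.
  by apply/setP=> u; move: (s2 u) mB; rewrite /V2; brute_at u m.
rewrite c2 andbT /es (@conn_local _ es1 es2 V2) //; last first.
  apply/pred0P=> u /=; apply/negP=> /andP[uA u2]; case/negP: mN.
  by move: uA u2 (dis u) (s2 u); rewrite /V2 /I; brute_at u m.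
congr andb; congr conn; apply/setP=> u; rewrite /V1 /I;
  by move: mB (dis u) (sB u) (s2 u); rewrite /I; brute_at u m.
Qed.

(** The mirror case: the block of [y] is confined to the second part, and the block of [x] contains
    the whole first part. *)
Lemma ser_sep_out B : m \notin B ->
  (B \in sep x y I es) = (B \in sep m y I2 es2).
Proof.
move=> mB; rewrite !inE; case: (boolP (B \subset I)) => /= [/subE sB|nsub]; last first.
  apply/esym/negbTE; apply: contra nsub => /and3P[s2 _ _].
  by apply: subset_trans s2 _; apply/subsetP=> u; rewrite /I; brute.
have mN : m \notin y |: B by move: mB (dis m); rewrite /I; brute.
have sA : x |: (I :\: B) \subset V1 :|: V2.
  by apply/subsetP=> u; rewrite /V1 /V2 /I; brute.
case: (boolP (B \subset I2)) => /= [/subE s2|nsub]; last first.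
  apply/negP=> /andP[cA _]; case/negP: nsub.
  have s2 : y |: B \subset V2.
    move: cA; rewrite /es conn_catC => cA.
    apply: (conn_side in2 in1 (u:=y)) => //; rewrite ?inE ?eqxx ?orbT //.
    move=> v vA v2; apply/negP=> v1; case/negP: mN; move: (dis v) vA v1 v2.
    by rewrite /V1 /V2 /I !inE; have [->|_] := eqVneq v m; brute.
  apply/subsetP=> u uB; move/subE/(_ u): s2; move: uB mB (dis u) (sB u).
  by rewrite /V2 /I; brute_at u m.
rewrite /es conn_catC (@conn_local _ es2 es1 V1) //; last first.
  apply/pred0P=> u /=; apply/negP=> /andP[uA u1]; case/negP: mN.
  by move: uA u1 (dis u) (s2 u); rewrite /V1; brute_at u m.
congr andb.
rewrite (conn_glue_pt in1 in2 sA (z:=m)); first last.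
- move=> u; rewrite /V1 /V2; have [->//|] := eqVneq u m.
  by move: (dis u); brute.
- by rewrite /V2; brute.
- by rewrite /V1; brute.
- by move: mB; rewrite /I; brute.
have -> : (x |: (I :\: B)) :&: V1 = V1.
  by apply/setP=> u; move: (dis u) (s2 u) mB; rewrite /V1 /I; brute_at u m.
rewrite c1 /=; congr conn; apply/setP=> u.
by move: mB (dis u) (sB u) (s2 u); rewrite /I /V2; brute_at u m.
Qed.

(** An interior block avoids the terminals, and here also [m], so nothing shared is left to connect
    traces on both parts. *)
Lemma ser_closed_side B es' : m \notin B -> B \in inn x y I es es' ->
  (B \subset I1) || (B \subset I2).
Proof.
move=> mB /innP[/subE sB [v vB] cB _].
have dB : forall u, u \in B -> u \in V1 -> u \notin V2.
  move=> u uB u1; apply/negP=> u2; case/negP: mB; move: (dis u) uB u1 u2.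
  by rewrite /V1 /V2 !inE; have [->|_] := eqVneq u m; brute.
have : (v \in V1) || (v \in V2).
  by move: (sB v); rewrite vB /V1 /V2 /I; brute.
case/orP=> v12; apply/orP; [left|right]; apply/subsetP=> u uB.
  have s1 := conn_side in1 in2 dB cB vB v12.
  move: (subE s1 u) (sB u) (dis u) mB uB; rewrite /V1 /I.
  by brute_at u m.
have {}dB : forall u, u \in B -> u \in V2 -> u \notin V1.
  by move=> w wB; apply: contraL => /(dB w wB).
have {}cB : conn (es2 ++ es1) B by rewrite conn_catC.
have s2 := conn_side in2 in1 dB cB vB v12.
move: (subE s2 u) (sB u) (dis u) mB uB; rewrite /V2 /I.
by brute_at u m.
Qed.

Lemma ser_conn_left B : B \subset I1 -> conn es B = conn es1 B.
Proof.
move=> /subE s1; rewrite /es (@conn_local _ es1 es2 V2) //.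
apply/pred0P=> u /=; move: (dis u) (s1 u); rewrite /V2.
by brute.
Qed.

Lemma ser_conn_right B : B \subset I2 -> conn es B = conn es2 B.
Proof.
move=> /subE s2; rewrite /es conn_catC (@conn_local _ es2 es1 V1) //.
apply/pred0P=> u /=; move: (dis u) (s2 u); rewrite /V1.
by brute.
Qed.

Let subIl B : B \subset I1 -> B \subset I.
Proof. by move/subE=> s1; apply/subsetP=> u; move: (s1 u); rewrite /I; brute. Qed.

Let subIr B : B \subset I2 -> B \subset I.
Proof. by move/subE=> s1; apply/subsetP=> u; move: (s1 u); rewrite /I; brute. Qed.

Let covI B : x |: (y |: (I :\: B)) \subset V1 :|: V2.
Proof. by apply/subsetP=> u; rewrite /V1 /V2 /I; brute. Qed.

Let covI' B : x |: (y |: (I :\: B)) \subset V2 :|: V1.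
Proof. by rewrite (setUC V2). Qed.

Let shared_m u : u \in V1 -> u \in V2 -> u = m.
Proof.
have [->//|] := eqVneq u m; rewrite /V1 /V2; by move: (dis u); brute.
Qed.

Let I1nm B : B \subset I1 -> m \notin B.
Proof. by move/subE/(_ m); move: (dis m); brute. Qed.

Let I2nm B : B \subset I2 -> m \notin B.
Proof. by move/subE/(_ m); move: (dis m); brute. Qed.

Let mV1 : m \in V1. Proof. by rewrite /V1; brute. Qed.
Let mV2 : m \in V2. Proof. by rewrite /V2; brute. Qed.

Let mrest B : m \notin B -> m \in x |: (y |: (I :\: B)).
Proof. by rewrite /I; brute. Qed.

Let rest_left B : B \subset I1 ->
  (x |: (y |: (I :\: B))) :&: V1 = x |: (m |: (I1 :\: B)).
Proof.
move=> s1; have := I1nm s1; move/subE: s1 => s1 mB; apply/setP=> u.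
by move: mB (dis u) (s1 u); rewrite /I /V1; brute_at u m.
Qed.

Let rest_left2 B : B \subset I1 -> (x |: (y |: (I :\: B))) :&: V2 = V2.
Proof.
move=> s1; have := I1nm s1; move/subE: s1 => s1 mB; apply/setP=> u.
by move: mB (dis u) (s1 u); rewrite /I /V2; brute_at u m.
Qed.

Let rest_right B : B \subset I2 ->
  (x |: (y |: (I :\: B))) :&: V2 = m |: (y |: (I2 :\: B)).
Proof.
move=> s1; have := I2nm s1; move/subE: s1 => s1 mB; apply/setP=> u.
by move: mB (dis u) (s1 u); rewrite /I /V2; brute_at u m.
Qed.

Let rest_right2 B : B \subset I2 -> (x |: (y |: (I :\: B))) :&: V1 = V1.
Proof.
move=> s1; have := I2nm s1; move/subE: s1 => s1 mB; apply/setP=> u.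
by move: mB (dis u) (s1 u); rewrite /I /V1; brute_at u m.
Qed.

Let inn_split es' es1' es2' :
    (forall B, B \subset I1 -> conn es' (x |: (y |: (I :\: B))) =
                               conn es1' (x |: (m |: (I1 :\: B)))) ->
    (forall B, B \subset I2 -> conn es' (x |: (y |: (I :\: B))) =
                               conn es2' (m |: (y |: (I2 :\: B)))) ->
  forall B, m \notin B ->
  (B \in inn x y I es es') =
  (B \in inn x m I1 es1 es1') || (B \in inn m y I2 es2 es2').
Proof.
move=> E1 E2 B mB; apply/idP/idP.
  move=> BD; case/orP: (ser_closed_side mB BD) => sB; case/innP: BD => _ nz cB cR.
    by apply/orP; left; apply/innP; rewrite -ser_conn_left // -E1.
  by apply/orP; right; apply/innP; rewrite -ser_conn_right // -E2.
case/orP=> /innP[sB nz cB cR]; apply/innP; split=> //.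
- exact: subIl.
- by rewrite ser_conn_left.
- by rewrite E1.
- exact: subIr.
- by rewrite ser_conn_right.
- by rewrite E2.
Qed.

(** The half that misses [B] is connected and contracts to [m]; the outside edge [xy] thereby
    becomes an outside edge across the other half. *)
Lemma ser_open_out B : m \notin B ->
  (B \in open_inn x y I es) =
  (B \in open_inn x m I1 es1) || (B \in open_inn m y I2 es2).
Proof.
apply: inn_split => {}B sB.
  rewrite (conn_glue_chord in1 in2 (@covI B) (m:=m)) ?rest_left ?rest_left2 //;
    by rewrite ?mrest ?I1nm ?inE ?eqxx ?orbT // => u _; apply: shared_m.
rewrite conn_cons_sym (@conn_eq_mem _ _ ((y, x) :: (es2 ++ es1))); last first.
  by move=> e; rewrite !inE !mem_cat (orbC (e \in es1)).
rewrite (conn_glue_chord in2 in1 (@covI' B) (m:=m)) ?rest_right ?rest_right2 //;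
  rewrite ?mrest ?I2nm ?inE ?eqxx ?orbT //; first exact: conn_cons_sym.
by move=> u _ u2 u1; apply: shared_m.
Qed.

Lemma ser_closed_out B : m \notin B ->
  (B \in closed_inn x y I es) =
  (B \in closed_inn x m I1 es1) || (B \in closed_inn m y I2 es2).
Proof.
apply: inn_split => {}B sB.
  rewrite (conn_glue_pt in1 in2 (@covI B) (z:=m)) ?mrest ?I1nm //.
    by rewrite rest_left ?rest_left2 // c2 andbT.
  by move=> u _; apply: shared_m.
rewrite (conn_glue_pt in1 in2 (@covI B) (z:=m)) ?mrest ?I2nm //.
  by rewrite rest_right ?rest_right2 // c1.
by move=> u _; apply: shared_m.
Qed.

(** A block through [m] cuts [x] from [y], and the outside edge alone rejoins them, so each half is
    split between its terminals. For the second half [m] is the source, whence [I2 :\: B] instead of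
    [B :&: I2]. *)
Lemma ser_open_in B : m \in B -> 
  (B \in open_inn x y I es) =
  [&& B \subset I, B :&: I1 \in sep x m I1 es1 & I2 :\: B \in sep m y I2 es2].
Proof.
move=> mB; rewrite !inE; have -> : B != set0 by apply/set0Pn; exists m.
case: (boolP (B \subset I)) => //= /subE sB.
have sA' : B \subset V1 :|: V2.
  by apply/subsetP=> u; move: (sB u); rewrite /V1 /V2 /I; brute.
rewrite subsetIr subsetDl /= (conn_glue_pt in1 in2 sA' mB) //; last first.
  by move=> u _; apply: shared_m.
rewrite (conn_glue_bridge in1 in2 (@covI B)) ?inE ?eqxx ?orbT //; last first.
  move=> u uA u1; apply/negP=> u2; have um := shared_m u1 u2.
  by move: uA mB (dis m); rewrite um; brute.
have -> : B :&: V1 = m |: B :&: I1.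
  by apply/setP=> u; move: mB (dis u) (sB u); rewrite /V1 /I; brute_at u m.
have -> : B :&: V2 = m |: (I2 :\: (I2 :\: B)).
  by apply/setP=> u; move: mB (dis u) (sB u); rewrite /V2 /I; brute_at u m.
have -> : (x |: (y |: I :\: B)) :&: V1 = x |: I1 :\: (B :&: I1).
  by apply/setP=> u; move: mB (dis m) (dis u) (sB u); rewrite /V1 /I; brute_at u m.
have -> : (x |: (y |: I :\: B)) :&: V2 = y |: I2 :\: B.
  by apply/setP=> u; move: mB (dis m) (dis u) (sB u); rewrite /V2 /I; brute_at u m.
by rewrite -!andbA; do !bool_congr.
Qed.

(** Without the outside edge, taking [m] away disconnects the block of the terminals. *)
Lemma ser_closed_in B : m \in B -> (B \in closed_inn x y I es) = false.
Proof.
move=> mB; apply/negP=> /innP[/subE sB _ _ cR].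
have mN : m \notin x |: (y |: (I :\: B)).
  by move: mB (dis m); rewrite /I; brute.
have s1 : x |: (y |: (I :\: B)) \subset V1.
  apply: (conn_side in1 in2 (u:=x)); rewrite ?inE ?eqxx //.
  by move=> v vA v1; apply/negP=> /(shared_m v1) vm; rewrite -vm vA in mN.
move: (subE s1 y) (dis y); rewrite /V1 !inE eqxx orbT /=.
by brute.
Qed.
End Series.
End Counting.

(** * Parallel composition at two shared terminals *)

Section Parallel.
Variable T : finType.
Variables (x y : T) (I1 I2 : {set T}) (es1 es2 : seq (T * T)).
Implicit Types (u : T) (B : {set T}).
Let V1 := x |: (y |: I1).
Let V2 := x |: (y |: I2).
Let I := I1 :|: I2.
Let es := es1 ++ es2.
Hypothesis dis : forall u, (u == x) + (u == y) + (u \in I1) + (u \in I2) <= 1.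
Hypotheses (in1 : within es1 V1) (in2 : within es2 V2).
Hypotheses (c1 : conn es1 V1) (c2 : conn es2 V2).

Let covI B : x |: (y |: (I :\: B)) \subset V1 :|: V2.
Proof. by apply/subsetP=> u; rewrite /V1 /V2 /I; brute. Qed.

Let shared u : u \in V1 -> u \in V2 -> (u == x) || (u == y).
Proof. by rewrite /V1 /V2; move: (dis u); brute. Qed.

(** Each block glues at a single terminal, that of [y] at [y] and that of [x] at [x], so the choices
    in the two parts are independent. *)
Lemma par_sep B :
  (B \in sep x y I es) =
  [&& B \subset I, B :&: I1 \in sep x y I1 es1 & B :&: I2 \in sep x y I2 es2].
Proof.
rewrite !inE !subsetIr /=; case: (boolP (B \subset I)) => //= /subE sB.
have sA : y |: B \subset V1 :|: V2.
  by apply/subsetP=> u; move: (sB u); rewrite /V1 /V2 /I; brute.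
have sA' : x |: (I :\: B) \subset V1 :|: V2.
  by apply/subsetP=> u; rewrite /V1 /V2 /I; brute.
have xy : x != y by move: (dis x); brute.
rewrite (conn_glue_pt in1 in2 sA (z:=y)) ?inE ?eqxx ?orbT //; last first.
  move=> u uA u1 u2; case/orP: (shared u1 u2) => /eqP ux //.
  by move: uA xy (dis x) (sB x); rewrite ux /I; brute.
rewrite (conn_glue_pt in1 in2 sA' (z:=x)) ?inE ?eqxx ?orbT //; last first.
  move=> u uA u1 u2; case/orP: (shared u1 u2) => /eqP uy //.
  by move: uA xy (dis y) (sB y); rewrite uy /I eq_sym; brute.
have -> : (y |: B) :&: V1 = y |: B :&: I1.
  apply/setP=> u; move: xy (dis u) (sB u); rewrite /V1 /I.
  by brute.
have -> : (y |: B) :&: V2 = y |: B :&: I2.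
  apply/setP=> u; move: xy (dis u) (sB u); rewrite /V2 /I.
  by brute.
have -> : (x |: (I :\: B)) :&: V1 = x |: I1 :\: (B :&: I1).
  by apply/setP=> u; move: (dis u) (sB u); rewrite /V1 /I; brute.
have -> : (x |: (I :\: B)) :&: V2 = x |: I2 :\: (B :&: I2).
  by apply/setP=> u; move: (dis u) (sB u); rewrite /V2 /I; brute.
by rewrite -!andbA; do !bool_congr.
Qed.

Let subI_notin B : B \subset I -> (x \notin B) && (y \notin B).
Proof.
by move/subE=> sB; move: (sB x) (sB y) (dis x) (dis y); rewrite /I; brute.
Qed.

Lemma par_side B es' : B \in inn x y I es es' -> (B \subset I1) || (B \subset I2).
Proof.
move=> /innP[sI [v vB] cB _]; case/andP: (subI_notin sI) => xN yN.
move/subE: sI => sB.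
have dB : forall u, u \in B -> u \in V1 -> u \notin V2.
  move=> u uB u1; apply/negP=> u2; case/orP: (shared u1 u2) => /eqP E.
    by rewrite -E uB in xN.
  by rewrite -E uB in yN.
have : (v \in V1) || (v \in V2).
  by move: (sB v); rewrite vB /V1 /V2 /I; brute.
case/orP=> v12; apply/orP; [left|right]; apply/subsetP=> u uB.
  have s1 := conn_side in1 in2 dB cB vB v12.
  move: (subE s1 u) (sB u) (dis u) uB; rewrite /V1 /I.
  by brute.
have {}dB : forall u, u \in B -> u \in V2 -> u \notin V1.
  by move=> w wB; apply: contraL => /(dB w wB).
have {}cB : conn (es2 ++ es1) B by rewrite conn_catC.
have s2 := conn_side in2 in1 dB cB vB v12.
move: (subE s2 u) (sB u) (dis u) uB; rewrite /V2 /I.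
by brute.
Qed.

Let conn_left B : B \subset I1 -> conn es B = conn es1 B.
Proof.
move=> /subE s1; rewrite /es (@conn_local _ es1 es2 V2) //.
apply/pred0P=> u /=; move: (dis u) (s1 u); rewrite /V2.
by brute.
Qed.

Let conn_right B : B \subset I2 -> conn es B = conn es2 B.
Proof.
move=> /subE s2; rewrite /es conn_catC (@conn_local _ es2 es1 V1) //.
apply/pred0P=> u /=; move: (dis u) (s2 u); rewrite /V1.
by brute.
Qed.

Let covI' B : x |: (y |: (I :\: B)) \subset V2 :|: V1.
Proof. by rewrite (setUC V2). Qed.

(** The other part, free of [B], amounts to an edge [xy]. Leaving [es'] general makes this available
    after an outside edge has been added. *)
Let rest_left es' B : within es' V1 -> B \subset I1 ->
  conn (es' ++ es2) (x |: (y |: (I :\: B))) =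
  conn ((x, y) :: es') (x |: (y |: (I1 :\: B))).
Proof.
move=> in' /subE s1.
have E2 : (x |: (y |: (I :\: B))) :&: V2 = V2.
  by apply/setP=> u; move: (dis u) (s1 u); rewrite /I /V2; brute.
rewrite (conn_glue_two in' in2 (@covI B) (x:=x) (y:=y)) ?E2 ?inE ?eqxx ?orbT //.
  congr conn; apply/setP=> u; move: (dis u) (s1 u); rewrite /I /V1.
  by brute.
by move=> u _; apply: shared.
Qed.

Let rest_right es' B : within es' V2 -> B \subset I2 ->
  conn (es1 ++ es') (x |: (y |: (I :\: B))) =
  conn ((x, y) :: es') (x |: (y |: (I2 :\: B))).
Proof.
move=> in' /subE s1.
have E2 : (x |: (y |: (I :\: B))) :&: V1 = V1.
  by apply/setP=> u; move: (dis u) (s1 u); rewrite /I /V1; brute.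
rewrite conn_catC.
rewrite (conn_glue_two in' in1 (@covI' B) (x:=x) (y:=y)) ?E2 ?inE ?eqxx ?orbT //.
  congr conn; apply/setP=> u; move: (dis u) (s1 u); rewrite /I /V2.
  by brute.
by move=> u _ u2 u1; apply: shared.
Qed.

Let within_cons es' (V : {set T}) : x \in V -> y \in V -> within es' V ->
  within ((x, y) :: es') V.
Proof. by move=> xV yV w e; rewrite inE => /orP[/eqP->|/w//]; rewrite xV. Qed.

(** The part not met by [B] joins the terminals, which is exactly the outside connection assumed in
    the open families. *)
Lemma par_closed B :
  (B \in closed_inn x y I es) =
  (B \in open_inn x y I1 es1) || (B \in open_inn x y I2 es2).
Proof.
apply/idP/idP.
  move=> BD; case/orP: (par_side BD) => sB; case/innP: BD => _ nz cB cR.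
    by apply/orP; left; apply/innP; rewrite -conn_left // -rest_left.
  by apply/orP; right; apply/innP; rewrite -conn_right // -rest_right.
case/orP=> /innP[sB nz cB cR]; apply/innP; split=> //.
- by apply: subset_trans sB _; apply: subsetUl.
- by rewrite conn_left.
- by rewrite rest_left.
- by apply: subset_trans sB _; apply: subsetUr.
- by rewrite conn_right.
- by rewrite rest_right.
Qed.

(* One of the two parts is disjoint from B and already joins x to y, so the
   additional edge changes nothing. *)
Lemma par_open B :
  (B \in open_inn x y I es) = (B \in closed_inn x y I es).
Proof.
apply/idP/idP=> BD; last first.
  by case/innP: BD => sB nz cB cR; apply/innP; split=> //; apply: conn_cons.
case/innP: (BD) => sI nz cB cR; apply/innP; split=> //.
have dup es' (A : {set T}) : conn ((x, y) :: (x, y) :: es') A = conn ((x, y) :: es') A.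
  by apply: conn_eq_mem => e; rewrite !inE orbA orbb.
have xyV : (x \in V1) && (y \in V1) && (x \in V2) && (y \in V2).
  by rewrite /V1 /V2 !inE !eqxx !orbT.
case/andP: xyV => /andP[/andP[x1 y1] x2] y2.
case/orP: (par_side BD) => sB.
  rewrite rest_left // -dup -rest_left //; exact: within_cons.
rewrite rest_right // -dup -rest_right //; last exact: within_cons.
by rewrite (@conn_eq_mem _ _ ((x, y) :: es)) // => e; rewrite !(mem_cat, inE) orbCA.
Qed.
End Parallel.

(** * Generating functions of bipartitions *)

(** Decomposition trees over named vertices. Reversal is a constructor because an undirected item
    may be met with either orientation. *)
Inductive dterm (T : Type) :=
| DEdge of T & T
| DRev of dterm T
| DSer of dterm T & dterm T
| DPar of dterm T & dterm T.

Fixpoint ends T (D : dterm T) : T * T :=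
  match D with
  | DEdge x y => (x, y)
  | DRev D => ((ends D).2, (ends D).1)
  | DSer D1 D2 => ((ends D1).1, (ends D2).2)
  | DPar D1 _ => ends D1
  end.

Fixpoint inter T (D : dterm T) : seq T :=
  match D with
  | DEdge _ _ => [::]
  | DRev D => inter D
  | DSer D1 D2 => (ends D1).2 :: inter D1 ++ inter D2
  | DPar D1 D2 => inter D1 ++ inter D2
  end.

Fixpoint dedges T (D : dterm T) : seq (T * T) :=
  match D with
  | DEdge x y => [:: (x, y)]
  | DRev D => dedges D
  | DSer D1 D2 | DPar D1 D2 => dedges D1 ++ dedges D2
  end.

Fixpoint wf (T : eqType) (D : dterm T) : bool :=
  match D with
  | DEdge x y => x != y
  | DRev D => wf D
  | DSer D1 D2 =>
    [&& wf D1, wf D2, (ends D1).2 == (ends D2).1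
      & uniq [:: (ends D1).1, (ends D2).2, (ends D1).2 & inter D1 ++ inter D2]]
  | DPar D1 D2 =>
    [&& wf D1, wf D2, ends D1 == ends D2
      & uniq [:: (ends D1).1, (ends D1).2 & inter D1 ++ inter D2]]
  end.

(* Generating functions, evaluated at Z, of the ways a connected bipartition
   can meet a two-terminal graph, by the weight of its interior vertices:
   - the two terminals are separated, counting the block of the source;
   - the same, counting the block of the sink;
   - one block lies in the interior, and the other one is connected;
   - one block lies in the interior, and the other one becomes connected once
     the two terminals are joined outside;
   the last component is Z to the total interior weight. *)
Record label := Label {
  lsrc : nat; lsnk : nat; lclosed : nat; lopen : nat; ltotal : nat }.

Definition edge_label := Label 1 1 0 0 1.

Definition rev_label l :=
  Label (lsnk l) (lsrc l) (lclosed l) (lopen l) (ltotal l).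

(** If the middle vertex is outside the counted separated block, that block meets a single half; if
    it is inside, it brings its own weight and the whole interior of one half. In the open case the
    inner block may also contain it, and then both halves are split. *)
Definition ser_label z l1 l2 :=
  Label (lsrc l1 + ltotal l1 * z * lsrc l2)
        (lsnk l2 + ltotal l2 * z * lsnk l1)
        (lclosed l1 + lclosed l2)
        (lopen l1 + lopen l2 + lsnk l1 * z * lsrc l2)
        (ltotal l1 * z * ltotal l2).

Definition par_label l1 l2 :=
  Label (lsrc l1 * lsrc l2) (lsnk l1 * lsnk l2)
        (lopen l1 + lopen l2) (lopen l1 + lopen l2)
        (ltotal l1 * ltotal l2).

Fixpoint dlabel T (z : T -> nat) (D : dterm T) : label :=
  match D with
  | DEdge _ _ => edge_label
  | DRev D => rev_label (dlabel z D)
  | DSer D1 D2 => ser_label (z (ends D1).2) (dlabel z D1) (dlabel z D2)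
  | DPar D1 D2 => par_label (dlabel z D1) (dlabel z D2)
  end.

Section Labels.
Variable T : finType.
Implicit Types (x y u : T) (D : dterm T).

Definition interset D : {set T} := [set u in inter D].
Definition verts D : {set T} := (ends D).1 |: ((ends D).2 |: interset D).

Lemma wf_uniq D : wf D -> uniq [:: (ends D).1, (ends D).2 & inter D].
Proof.
elim: D => [x y|D IH|D1 IH1 D2 IH2|D1 IH1 D2 IH2] /=.
- by rewrite inE andbT.
- by move/IH; rewrite /= !inE !negb_or eq_sym => /and3P[/andP[-> ->] -> ->].
- case/and4P=> _ _ _; rewrite !inE !negb_or.
  case/and4P=> /and3P[-> -> ->] /andP[-> ->] -> ->.
  by [].
- by case/and4P.
Qed.

(** Converts distinctness in a list into the indicator sums assumed by the set-level lemmas. *)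
Lemma count_uniq_dis x y (s1 s2 : seq T) u : uniq [:: x, y & s1 ++ s2] ->
  (u == x) + (u == y) + (u \in s1) + (u \in s2) <= 1.
Proof.
move=> U; have := count_uniq_mem u U.
move: U; rewrite /= cat_uniq => /and3P[_ _ /and3P[U1 _ U2]].
rewrite count_cat !(eq_sym _ u) !count_uniq_mem // addnA addnA => ->.
by case: (_ \in _).
Qed.

Lemma count_uniq_dis3 x y m (s1 s2 : seq T) u : uniq [:: x, y, m & s1 ++ s2] ->
  (u == x) + (u == y) + (u == m) + (u \in s1) + (u \in s2) <= 1.
Proof.
move=> U; have := count_uniq_mem u U.
move: U; rewrite /= cat_uniq => /and4P[_ _ _ /and3P[U1 _ U2]].
rewrite count_cat !(eq_sym _ u) !count_uniq_mem // !addnA => ->.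
by case: (_ \in _).
Qed.

Lemma interset_ser D1 D2 :
  interset (DSer D1 D2) = (ends D1).2 |: (interset D1 :|: interset D2).
Proof. by apply/setP=> u; rewrite !inE mem_cat. Qed.

Lemma interset_par D1 D2 : interset (DPar D1 D2) = interset D1 :|: interset D2.
Proof. by apply/setP=> u; rewrite !inE mem_cat. Qed.

Lemma dedges_within D : wf D -> within (dedges D) (verts D).
Proof.
rewrite /verts.
elim: D => [x y|D IH|D1 IH1 D2 IH2|D1 IH1 D2 IH2] /=.
- by move=> _ e; rewrite inE => /eqP->; rewrite !inE !eqxx orbT.
- by move/IH=> H e /H; rewrite setUCA.
- case/and4P=> /IH1 w1 /IH2 w2 /eqP E _ e; rewrite mem_cat interset_ser.
  by case/orP=> [/w1|/w2]; rewrite -?E; brute.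
- case/and4P=> /IH1 w1 /IH2 w2 /eqP E _ e; rewrite mem_cat interset_par.
  by case/orP=> [/w1|/w2]; rewrite -?E; brute.
Qed.

Lemma conn_dedges D : wf D -> conn (dedges D) (verts D).
Proof.
elim: D => [x y|D IH|D1 IH1 D2 IH2|D1 IH1 D2 IH2] /=.
- move=> _; apply/connP=> f cf; have fxy : f x = f y.
    by apply: (cf (x, y)); rewrite ?inE ?eqxx ?orbT.
  have E u : u \in verts (DEdge x y) -> f u = f x.
    by rewrite !inE orbF => /orP[] /eqP->.
  by move=> u v uA vA; rewrite !E.
- by rewrite /verts /= setUCA => /IH.
- case/and4P=> wf1 wf2 /eqP E U; move: (IH1 wf1) (IH2 wf2) => c1 c2.
  apply/connP=> f cf; move/connP: c1 => c1; move/connP: c2 => c2.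
  have s1 : verts D1 \subset verts (DSer D1 D2).
    by apply/subsetP=> u; rewrite /verts interset_ser /=; brute.
  have s2 : verts D2 \subset verts (DSer D1 D2).
    by apply/subsetP=> u; rewrite /verts interset_ser /= -E; brute.
  have cf1 : compat (dedges D1) (verts D1) f.
    by move=> e ee e1 e2; apply: cf; rewrite ?(subsetP s1) // mem_cat ee.
  have cf2 : compat (dedges D2) (verts D2) f.
    by move=> e ee e1 e2; apply: cf; rewrite ?(subsetP s2) // mem_cat ee orbT.
  have to_m u : u \in verts (DSer D1 D2) -> f u = f (ends D1).2.
    move=> uV; have : (u \in verts D1) || (u \in verts D2).
      by move: uV; rewrite /verts interset_ser /=; brute.
    case/orP=> uD; [apply: c1 | apply: c2] => //; rewrite /verts -?E; by brute.
  by move=> u v uA vA; rewrite !to_m.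
- case/and4P=> wf1 wf2 /eqP E U; move: (IH1 wf1) (IH2 wf2) => c1 c2.
  apply/connP=> f cf; move/connP: c1 => c1; move/connP: c2 => c2.
  have s1 : verts D1 \subset verts (DPar D1 D2).
    by apply/subsetP=> u; rewrite /verts interset_par /=; brute.
  have s2 : verts D2 \subset verts (DPar D1 D2).
    by apply/subsetP=> u; rewrite /verts interset_par /= -E; brute.
  have cf1 : compat (dedges D1) (verts D1) f.
    by move=> e ee e1 e2; apply: cf; rewrite ?(subsetP s1) // mem_cat ee.
  have cf2 : compat (dedges D2) (verts D2) f.
    by move=> e ee e1 e2; apply: cf; rewrite ?(subsetP s2) // mem_cat ee orbT.
  have to_m u : u \in verts (DPar D1 D2) -> f u = f (ends D1).1.
    move=> uV; have : (u \in verts D1) || (u \in verts D2).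
      by move: uV; rewrite /verts interset_par -E /=; brute.
    case/orP=> uD; [apply: c1 | apply: c2] => //; rewrite /verts -?E; by brute.
  by move=> u v uA vA; rewrite !to_m.
Qed.

Variables (w : T -> nat) (Z : nat).
Let wt (A : {set T}) := \sum_(i in A) w i.

Lemma wtU (A B : {set T}) : [disjoint A & B] -> Z ^ wt (A :|: B) = Z ^ wt A * Z ^ wt B.
Proof.
move=> dis; rewrite -expnD /wt -bigU //=; congr (_ ^ _).
by apply: eq_bigl => u; rewrite !inE.
Qed.

Lemma wtU1 u (A : {set T}) : u \notin A -> Z ^ wt (u |: A) = Z ^ w u * Z ^ wt A.
Proof. by move=> uA; rewrite -expnD /wt big_setU1. Qed.

Definition label_spec D :=
  let x := (ends D).1 in let y := (ends D).2 in
  let I := interset D in let es := dedges D in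
  let l := dlabel (fun u => Z ^ w u) D in
  [/\ lsrc l = \sum_(B in sep x y I es) Z ^ wt (I :\: B),
      lsnk l = \sum_(B in sep x y I es) Z ^ wt B,
      lclosed l = \sum_(B in closed_inn x y I es) Z ^ wt B,
      lopen l = \sum_(B in open_inn x y I es) Z ^ wt B &
      ltotal l = Z ^ wt I].


Lemma label_edge x y : label_spec (DEdge x y).
Proof.
have I0 : interset (DEdge x y) = set0 by apply/setP=> u; rewrite !inE.
have sep0 : sep x y set0 [:: (x, y)] = [set set0].
  apply/setP=> B; rewrite !inE subset0; case: eqP => //= ->.
  rewrite setD0 !setU0; apply/andP; split; apply/connP=> f _ u v;
    by rewrite !inE => /eqP-> /eqP->.
have inn0 es es' : inn x y set0 es es' = set0.
  by apply/setP=> B; rewrite !inE subset0; case: eqP => //= ->.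
rewrite /label_spec /= I0 sep0 /closed_inn /open_inn !inn0 !big_set1 !big_set0.
by rewrite setD0 /wt big_set0.
Qed.

(** Complements within the interior exchange the roles of the two separated blocks; the inner
    families are symmetric in the terminals. *)
Lemma label_rev D : label_spec D -> label_spec (DRev D).
Proof.
rewrite /label_spec /= -[interset (DRev D)]/(interset D).
move: (ends D).1 (ends D).2 (interset D) => x y I.
case=> -> -> -> -> ->.
have sepE B : (I :\: B \in sep x y I (dedges D)) && (I :\: (I :\: B) == B) =
              (B \in sep y x I (dedges D)).
  rewrite !inE subsetDl /= setDDr setDv set0U (sameP eqP setIidPr).
  case: (boolP (B \subset I)) => /= [/setIidPr->|_].
    by rewrite andbT andbC.
  by rewrite andbF.
have DD B : B \in sep x y I (dedges D) -> I :\: (I :\: B) = B.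
  by rewrite inE setDDr setDv set0U => /and3P[/setIidPr].
have innE es es' : inn x y I es es' = inn y x I es es'.
  by apply/setP=> B; rewrite !inE setUCA.
split.
- rewrite (reindex_onto (fun B => I :\: B) (fun B => I :\: B)) //=.
  by apply: eq_bigl => B; rewrite sepE.
- rewrite (reindex_onto (fun B => I :\: B) (fun B => I :\: B)) //=.
  apply: eq_big => B; first by rewrite sepE.
  by case/andP=> _ /eqP->.
- by rewrite /closed_inn innE.
- apply: eq_bigl => B; rewrite /open_inn innE !inE.
  by rewrite (conn_cons_sym x y).
- by [].
Qed.

Lemma sum_disjoint_sets (S S1 S2 : {set {set T}}) (F : {set T} -> nat) :
    (forall B, (B \in S) = (B \in S1) || (B \in S2)) ->
    (forall B, B \in S1 -> B \notin S2) ->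
  \sum_(B in S) F B = \sum_(B in S1) F B + \sum_(B in S2) F B.
Proof.
move=> SE dis; rewrite (bigID (mem S1)) /=; congr (_ + _); apply: eq_bigl => B.
  by rewrite SE; case: (B \in S1) => //; rewrite andbF.
by rewrite SE; case: (boolP (B \in S1)) => [/dis/negbTE->|] /=; rewrite ?andbT.
Qed.

Lemma inn_disjoint a b c d (I1 I2 : {set T}) es1 es2 es1' es2' B :
    (forall u, u \in I1 -> u \notin I2) ->
  B \in inn a b I1 es1 es1' -> B \notin inn c d I2 es2 es2'.
Proof.
move=> dis /innP[/subsetP s1 [v vB] _ _]; apply/negP=> /innP[/subsetP s2 _ _ _].
by have := dis v (s1 v vB); rewrite (s2 v vB).
Qed.

Section LabelSer.
Variables D1 D2 : dterm T.
Hypothesis wfD : wf (DSer D1 D2).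
Let x := (ends D1).1.
Let m := (ends D1).2.
Let y := (ends D2).2.
Let I1 := interset D1.
Let I2 := interset D2.
Let I := m |: (I1 :|: I2).

Let dis u : (u == x) + (u == y) + (u == m) + (u \in I1) + (u \in I2) <= 1.
Proof. by case/and4P: wfD => _ _ _ U; rewrite !inE; apply: count_uniq_dis3. Qed.
Let in1 : within (dedges D1) (x |: (m |: I1)).
Proof. by case/and4P: wfD => /dedges_within. Qed.
Let in2 : within (dedges D2) (m |: (y |: I2)).
Proof. by rewrite /m; case/and4P: wfD => _ /dedges_within w2 /eqP->. Qed.
Let c1 : conn (dedges D1) (x |: (m |: I1)).
Proof. by case/and4P: wfD => /conn_dedges. Qed.
Let c2 : conn (dedges D2) (m |: (y |: I2)).
Proof. by rewrite /m; case/and4P: wfD => _ /conn_dedges w2 /eqP->. Qed.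
Let es := dedges D1 ++ dedges D2.

Let m1 (B : {set T}) : B \subset I1 -> m \notin B.
Proof. by move/subE/(_ m); move: (dis m); brute. Qed.
Let m2 (B : {set T}) : B \subset I2 -> m \notin B.
Proof. by move/subE/(_ m); move: (dis m); brute. Qed.

Lemma ser_sep_sum (F : {set T} -> nat) :
  \sum_(B in sep x y I es) F B =
  \sum_(B in sep x m I1 (dedges D1)) F (m |: (I2 :|: B)) +
  \sum_(B in sep m y I2 (dedges D2)) F B.
Proof.
rewrite (bigID (fun B : {set T} => m \in B)) /=; congr (_ + _); last first.
  apply: eq_bigl => B; case: (boolP (m \in B)) => mB; rewrite ?andbT ?andbF.
    by apply/esym/negP; rewrite inE => /and3P[/m2]; rewrite mB.
  exact: (ser_sep_out dis).
(* For [m] in [B], the set [I2] lies in [B], so [B] and its trace on [I1] determine each other. *)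
rewrite (reindex_onto (fun B : {set T} => m |: (I2 :|: B)) (fun B : {set T} => B :&: I1)) /=; last first.
  move=> B /andP[BS mB]; move: BS; rewrite (ser_sep_in dis) //.
  case/and3P=> /subE sB /subE s2 _; apply/setP=> u.
  by move: mB (dis u) (sB u) (s2 u); rewrite /I; brute_at u m.
apply: eq_bigl => B; rewrite setU11 andbT.
case: (boolP (B \subset I1)) => [s1|n1]; last first.
  rewrite [RHS]inE (negbTE n1); apply/negP=> /andP[_ /eqP E].
  by rewrite -E subsetIr in n1.
have E : (m |: (I2 :|: B)) :&: I1 = B.
  by apply/setP=> u; move: (subE s1 u) (dis u) (dis m); brute_at u m.
rewrite E eqxx andbT (ser_sep_in dis) ?setU11 // E.
have -> : m |: (I2 :|: B) \subset I.
  by apply/subsetP=> u; move: (subE s1 u); rewrite /I; brute.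
by have -> : I2 \subset m |: (I2 :|: B) by apply/subsetP=> u; brute.
Qed.

Lemma ser_closed_sum (F : {set T} -> nat) :
  \sum_(B in closed_inn x y I es) F B =
  \sum_(B in closed_inn x m I1 (dedges D1)) F B +
  \sum_(B in closed_inn m y I2 (dedges D2)) F B.
Proof.
apply: sum_disjoint_sets => B; last by apply: inn_disjoint => u; move: (dis u); brute.
case: (boolP (m \in B)) => mB; last exact: (ser_closed_out dis).
apply: etrans (ser_closed_in dis in1 in2 mB) _; apply/esym/negP; rewrite !inE.
by case/orP=> /and4P[]; [move/m1 | move/m2]; rewrite mB.
Qed.

Lemma ser_open_sum (F : {set T} -> nat) :
  \sum_(B in open_inn x y I es) F B =
  \sum_(B in open_inn x m I1 (dedges D1)) F B +
  \sum_(B in open_inn m y I2 (dedges D2)) F B +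
  \sum_(B1 in sep x m I1 (dedges D1)) \sum_(B2 in sep m y I2 (dedges D2))
    F (m |: (B1 :|: (I2 :\: B2))).
Proof.
rewrite [LHS](bigID (fun B : {set T} => m \in B)) /= addnC; congr (_ + _).
  rewrite -(@sum_disjoint_sets (open_inn x m I1 (dedges D1) :|:
    open_inn m y I2 (dedges D2))); first last.
  - by move=> B; apply: inn_disjoint => u; move: (dis u); brute.
  - by move=> B; rewrite in_setU.
  apply: eq_bigl => B; rewrite in_setU; case: (boolP (m \in B)) => mB.
    rewrite andbF; apply/esym/negP; rewrite !inE.
    by case/orP=> /and4P[]; [move/m1 | move/m2]; rewrite mB.
  by rewrite andbT; apply: (ser_open_out dis).
rewrite pair_big /=.
(* The second coordinate is a complement: [sep m y] records the side of [y], while the block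
   contains [m]. *)
rewrite (reindex_onto (fun p : {set T} * {set T} => m |: (p.1 :|: (I2 :\: p.2)))
           (fun B : {set T} => (B :&: I1, I2 :\: B))) /=; last first.
  move=> B /andP[BS mB]; move: BS; rewrite (ser_open_in dis) //.
  case/and3P=> /subE sB _ _; apply/setP=> u.
  by move: mB (dis u) (sB u); rewrite /I; brute_at u m.
apply: eq_bigl => -[B1 B2] /=; rewrite setU11 andbT.
case: (boolP ((B1 \subset I1) && (B2 \subset I2))) => [/andP[s1 s2]|n12]; last first.
  have -> : (B1 \in sep x m I1 (dedges D1)) && (B2 \in sep m y I2 (dedges D2)) = false.
    by apply/negP; rewrite !inE => /andP[/and3P[s1 _ _] /and3P[s2 _ _]]; rewrite s1 s2 in n12.
  by apply/negP=> /andP[_ /eqP[E1 E2]]; rewrite -E1 -E2 subsetIr subsetDl in n12.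
have E1 : (m |: (B1 :|: I2 :\: B2)) :&: I1 = B1.
  by apply/setP=> u; move: (subE s1 u) (dis u) (dis m); brute_at u m.
have E2 : I2 :\: (m |: (B1 :|: I2 :\: B2)) = B2.
  by apply/setP=> u; move: (subE s1 u) (subE s2 u) (dis u) (dis m); brute_at u m.
rewrite E1 E2 eqxx andbT (ser_open_in dis) ?setU11 // E1 E2.
have -> //: m |: (B1 :|: I2 :\: B2) \subset I.
by apply/subsetP=> u; move: (subE s1 u); rewrite /I; brute.
Qed.

Lemma label_ser : label_spec D1 -> label_spec D2 -> label_spec (DSer D1 D2).
Proof.
rewrite /label_spec interset_ser /=.
have Ey : (ends D2).1 = m by rewrite /m; case/and4P: wfD => _ _ /eqP->.
rewrite Ey -/I1 -/I2 -/x -/y -/m -/I -/es.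
case=> -> -> -> -> -> [-> -> -> -> ->].
have zm : Z ^ w m * Z ^ wt I2 = Z ^ wt (m |: I2) by rewrite wtU1 // m2.
have zm1 : Z ^ w m * Z ^ wt I1 = Z ^ wt (m |: I1) by rewrite wtU1 // m1.
have dI : [disjoint I1 & I2].
  by apply/pred0P=> u /=; move: (dis u); brute.
split.
- rewrite ser_sep_sum; congr (_ + _).
    apply: eq_bigr => B; rewrite inE => /and3P[/subE sB _ _]; congr (_ ^ wt _).
    by apply/setP=> u; move: (sB u) (dis u) (dis m); rewrite /I; brute_at u m.
  rewrite big_distrr; apply: eq_bigr => B; rewrite inE => /and3P[/subE sB _ _] /=.
  rewrite (mulnC (_ ^ wt I1)) zm1 -wtU.
    congr (_ ^ wt _); apply/setP=> u; move: (sB u) (dis u) (dis m); rewrite /I.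
    by brute_at u m.
  by apply/pred0P=> u /=; move: (sB u) (dis u) (dis m); brute_at u m.
- rewrite ser_sep_sum addnC; congr (_ + _).
  rewrite big_distrr; apply: eq_bigr => B; rewrite inE => /and3P[/subE sB _ _] /=.
  rewrite (mulnC (_ ^ wt I2)) zm -wtU ?setUA //.
  by apply/pred0P=> u /=; move: (sB u) (dis u) (dis m); brute_at u m.
- exact/esym/ser_closed_sum.
- apply: etrans _ (esym (ser_open_sum _)); congr (_ + _).
  rewrite -mulnA big_distrl /=.
  apply: eq_bigr => B1; rewrite inE => /and3P[/subE s1 _ _]; rewrite !big_distrr /=.
  apply: eq_bigr => B2; rewrite inE => /and3P[/subE s2 _ _].
  rewrite mulnCA -wtU.
    rewrite -wtU1 //; move: (dis m) (s1 m) (s2 m); brute.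
  by apply/pred0P=> u /=; move: (s1 u) (s2 u) (dis u); brute.
- by rewrite -mulnA mulnCA -wtU // -wtU1 //; move: (dis m); brute.
Qed.
End LabelSer.

Section LabelPar.
Variables D1 D2 : dterm T.
Hypothesis wfD : wf (DPar D1 D2).
Let x := (ends D1).1.
Let y := (ends D1).2.
Let I1 := interset D1.
Let I2 := interset D2.
Let I := I1 :|: I2.

Let dis u : (u == x) + (u == y) + (u \in I1) + (u \in I2) <= 1.
Proof. by case/and4P: wfD => _ _ _ U; rewrite !inE; apply: count_uniq_dis. Qed.
Let in1 : within (dedges D1) (x |: (y |: I1)).
Proof. by case/and4P: wfD => /dedges_within. Qed.
Let in2 : within (dedges D2) (x |: (y |: I2)).
Proof. by rewrite /x /y; case/and4P: wfD => _ /dedges_within w2 /eqP->. Qed.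
Let c1 : conn (dedges D1) (x |: (y |: I1)).
Proof. by case/and4P: wfD => /conn_dedges. Qed.
Let c2 : conn (dedges D2) (x |: (y |: I2)).
Proof. by rewrite /x /y; case/and4P: wfD => _ /conn_dedges w2 /eqP->. Qed.
Let es := dedges D1 ++ dedges D2.

Lemma par_sep_sum (F : {set T} -> nat) :
  \sum_(B in sep x y I es) F B =
  \sum_(B1 in sep x y I1 (dedges D1)) \sum_(B2 in sep x y I2 (dedges D2))
    F (B1 :|: B2).
Proof.
rewrite pair_big /=.
rewrite (reindex_onto (fun p : {set T} * {set T} => p.1 :|: p.2)
           (fun B : {set T} => (B :&: I1, B :&: I2))) /=; last first.
  move=> B; rewrite (par_sep dis) // => /and3P[/subE sB _ _]; apply/setP=> u.
  by move: (dis u) (sB u); rewrite /I; brute.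
apply: eq_bigl => -[B1 B2] /=.
case: (boolP ((B1 \subset I1) && (B2 \subset I2))) => [/andP[s1 s2]|n12]; last first.
  have -> : (B1 \in sep x y I1 (dedges D1)) && (B2 \in sep x y I2 (dedges D2)) = false.
    by apply/negP; rewrite !inE => /andP[/and3P[s1 _ _] /and3P[s2 _ _]]; rewrite s1 s2 in n12.
  by apply/negP=> /andP[_ /eqP[E1 E2]]; rewrite -E1 -E2 !subsetIr in n12.
have E1 : (B1 :|: B2) :&: I1 = B1.
  by apply/setP=> u; move: (subE s1 u) (subE s2 u) (dis u); brute.
have E2 : (B1 :|: B2) :&: I2 = B2.
  by apply/setP=> u; move: (subE s1 u) (subE s2 u) (dis u); brute.
rewrite E1 E2 eqxx andbT (par_sep dis) // E1 E2.
by rewrite setUSS.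
Qed.

Lemma par_open_sum (F : {set T} -> nat) :
  \sum_(B in open_inn x y I es) F B =
  \sum_(B in open_inn x y I1 (dedges D1)) F B +
  \sum_(B in open_inn x y I2 (dedges D2)) F B.
Proof.
apply: sum_disjoint_sets => B; last by apply: inn_disjoint => u; move: (dis u); brute.
by apply: etrans (par_closed dis in1 in2 c1 c2 B); apply: (par_open dis).
Qed.

Lemma label_par : label_spec D1 -> label_spec D2 -> label_spec (DPar D1 D2).
Proof.
rewrite /label_spec interset_par /=.
have E : ends D2 = ends D1 by case/and4P: wfD => _ _ /eqP->.
rewrite E -/I1 -/I2 -/x -/y -/I -/es.
case=> -> -> _ -> -> [-> -> _ -> ->].
have dI : [disjoint I1 & I2].
  by apply/pred0P=> u /=; move: (dis u); brute.
split.
- rewrite par_sep_sum big_distrl; apply: eq_bigr => B1.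
  rewrite inE => /and3P[/subE s1 _ _]; rewrite big_distrr; apply: eq_bigr => B2.
  rewrite inE => /and3P[/subE s2 _ _] /=; rewrite -wtU.
    congr (_ ^ wt _); apply/setP=> u; move: (s1 u) (s2 u) (dis u); rewrite /I.
    by brute.
  by apply/pred0P=> u /=; move: (s1 u) (s2 u) (dis u); brute.
- rewrite par_sep_sum big_distrl; apply: eq_bigr => B1.
  rewrite inE => /and3P[/subE s1 _ _]; rewrite big_distrr; apply: eq_bigr => B2.
  rewrite inE => /and3P[/subE s2 _ _] /=; rewrite -wtU //.
  by apply/pred0P=> u /=; move: (s1 u) (s2 u) (dis u); brute.
- rewrite -par_open_sum; apply: eq_bigl => B.
  by rewrite (par_open dis).
- exact/esym/par_open_sum.
- by rewrite wtU.
Qed.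
End LabelPar.

Theorem label_correct D : wf D -> label_spec D.
Proof.
elim: D => [x y|D IH|D1 IH1 D2 IH2|D1 IH1 D2 IH2] wfD.
- exact: label_edge.
- exact/label_rev/IH.
- by case/and4P: (wfD) => /IH1 l1 /IH2 l2 _ _; apply: label_ser.
- by case/and4P: (wfD) => /IH1 l1 /IH2 l2 _ _; apply: label_par.
Qed.
End Labels.

(** Fewer than [X] summands produce no carry: the terms with exponent below [k] add up to less than
    [X ^ k], and the number of those with exponent [k] is a genuine digit. *)
Lemma digit_sum (T : finType) (S : {set T}) (e : T -> nat) (X k : nat) :
  #|S| < X ->
  (\sum_(i in S) X ^ e i) %% X ^ k.+1 %/ X ^ k = #|[set i in S | e i == k]|.
Proof.
move=> SX; have X0 : 0 < X by apply: leq_ltn_trans SX.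
have Xk : 0 < X ^ k by rewrite expn_gt0 X0.
set c := #|_|.
have [q hi] : exists q, \sum_(i in S | k < e i) X ^ e i = q * X ^ k.+1.
  apply/dvdnP; apply: (big_ind (dvdn _)) => [|a b|i /andP[_ lt]]; first exact: dvdn0.
    exact: dvdn_add.
  exact: dvdn_exp2l.
have mid : \sum_(i in S | e i == k) X ^ e i = c * X ^ k.
  rewrite /c -sum_nat_const; rewrite (eq_bigr (fun=> X ^ k)).
    by apply: eq_bigl => i; rewrite inE.
  by move=> i /andP[_ /eqP->].
set low := \sum_(i in S | e i < k) X ^ e i.
have lo : low < X ^ k.
  (* For [k = 0] the sum is empty; otherwise it has at most [#|S|] terms, each at most
     [X ^ k.-1]. *)
  have [k0|k0] := posnP k.
    by rewrite /low k0 big_pred0 // => i; rewrite ltn0 andbF.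
  rewrite -(ltn_pmul2r X0) -expnSr.
  have le : low <= #|S| * X ^ k.-1.
    rewrite /low -sum_nat_const big_mkcondr /=; apply: leq_sum => i _.
    case: ifP => // lt; apply: leq_pexp2l => //; by rewrite -ltnS prednK.
  have : low * X <= #|S| * X ^ k.
    by rewrite -[in X ^ k](prednK k0) expnSr mulnA leq_mul2r le orbT.
  move/leq_ltn_trans; apply; rewrite expnS ltn_mul2r Xk SX.
  by [].
have -> : \sum_(i in S) X ^ e i = low + c * X ^ k + q * X ^ k.+1.
  rewrite (bigID (fun i => e i < k)) /= -/low -addnA; congr addn.
  rewrite (bigID (fun i => e i == k)) /= -mid -hi; congr addn; apply: eq_bigl => i.
    by rewrite -andbA; congr andb; case: eqP => [->|]; rewrite ?ltnn ?andbF.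
  by rewrite -andbA; congr andb; case: ltngtP.
have cX : c < X.
  by apply: leq_ltn_trans SX; apply: subset_leq_card; apply/subsetP=> i; rewrite inE => /andP[].
rewrite addnC modnMDl modn_small.
  by rewrite addnC divnMDl // divn_small // addn0.
rewrite expnS; apply: (@leq_trans (c.+1 * X ^ k)); last by rewrite leq_mul2r cX orbT.
by rewrite mulSn addnC (addnC (X ^ k)) ltn_add2l.
Qed.

(** * From labels to counts of balanced connected bipartitions *)

Section Final.
Variable T : finType.
Implicit Types (D : dterm T) (B : {set T}).

Definition bipartitions D : {set {set T}} :=
  [set B : {set T} | [&& (ends D).1 \notin B, B != set0,
     conn (dedges D) B & conn (dedges D) (~: B)]].

(** A block avoiding the source either contains the sink, so that the terminals are separated, or
    lies in the interior. Nothing lies outside the whole graph, so the closed count applies. *)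
Lemma label_total (w : T -> nat) Z D : wf D -> verts D = setT ->
  let l := dlabel (fun u => Z ^ w u) D in
  lsnk l * Z ^ w (ends D).2 + lclosed l =
  \sum_(B in bipartitions D) Z ^ \sum_(i in B) w i.
Proof.
move=> wfD V /=; have [_ -> -> _ _] := label_correct w Z wfD.
have U := wf_uniq wfD; have dis u := @count_uniq_dis _ (ends D).1 (ends D).2 (inter D) [::] u.
have {}dis u : (u == (ends D).1) + (u == (ends D).2) + (u \in interset D) <= 1.
  by have := dis u; rewrite cats0 in_nil [u \in interset D]inE addn0; apply.
have all u : [|| u == (ends D).1, u == (ends D).2 | u \in interset D].
  by have := in_setT u; rewrite -V /verts !inE.
move: dis all; rewrite /bipartitions; move: (ends D) => [x y] /= dis all.
move: (interset D) dis all => I dis all.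
have yI B : B \subset I -> y \notin B.
  by move/subE/(_ y); move: (dis y); brute.
rewrite [RHS](bigID (fun B : {set T} => y \in B)) /=; congr (_ + _).
  rewrite big_distrl /=.
  rewrite [RHS](reindex_onto (fun B => y |: B) (fun B => B :\ y)) /=; last first.
    by move=> B /andP[_ yB]; rewrite setD1K.
  apply: eq_big => B; last first.
    by rewrite inE => /and3P[/yI yB _ _]; rewrite -expnD big_setU1 // addnC.
  rewrite !inE eqxx andbT -andbA.
  have -> : y |: B != set0 by apply/set0Pn; exists y; rewrite setU11.
  case: (boolP (B \subset I)) => [sB|nB] /=.
    have E1 : (y |: B) :\ y == B by apply/eqP; apply: setU1K; apply: yI.
    rewrite E1 andbT; have -> : ~: (y |: B) = x |: I :\: B.
      apply/setP=> u; move: (dis u) (all u) (subE sB u); by brute.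
    by move: (dis x) (subE sB x); rewrite ?eqxx; brute.
  apply/esym/negP=> /and3P[/norP[_ xB] _ /eqP E]; case/negP: nB.
  apply/subsetP=> u; rewrite -E => /setD1P[uy /setU1P[|uB]].
    by move/eqP; rewrite (negbTE uy).
  have := all u; rewrite (negbTE uy) /=; case: eqP uB => //= ->.
  by rewrite (negbTE xB).
apply: eq_bigl => B; rewrite !inE.
case: (boolP (B \subset I)) => [sB|nB] /=.
  have -> : ~: B = x |: (y |: I :\: B).
    by apply/setP=> u; move: (dis u) (all u) (subE sB u); brute.
  rewrite yI // andbT; suff -> : x \notin B by [].
  by move: (dis x) (subE sB x); brute.
apply/esym/negP=> /andP[/and4P[xB _ _ _] yB]; case/negP: nB.
by apply/subsetP=> u uB; move: (all u); have [E|_] := eqVneq u x; 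
  [rewrite -E uB in xB | have [E|] := eqVneq u y; [rewrite -E uB in yB|]].
Qed.

(** By [label_correct] each component is a power of [Z] or a sum of such powers over at most
    [2 ^ #|T|] vertex sets, with exponents at most [W]; the bound does not depend on the shape of
    the term. *)
Lemma label_bounds (w : T -> nat) Z D (W := \sum_i w i) (M := 2 ^ #|T| * Z ^ W) :
  0 < Z -> wf D ->
  let l := dlabel (fun u => Z ^ w u) D in
  [/\ lsrc l <= M, lsnk l <= M, lclosed l <= M, lopen l <= M & ltotal l <= M].
Proof.
move=> Z0 wfD /=; have [-> -> -> -> ->] := label_correct w Z wfD.
have bd (A : {set T}) : (Z ^ (\sum_(i in A) w i) <= Z ^ W)%N.
  by apply: leq_pexp2l => //; rewrite /W [X in _ <= X](bigID (mem A)) leq_addr.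
have sum (S : {set {set T}}) (F : {set T} -> {set T}) :
    (\sum_(B in S) Z ^ (\sum_(i in F B) w i) <= M)%N.
  apply: (@leq_trans (\sum_(B in S) Z ^ W)); first by apply: leq_sum.
  rewrite sum_nat_const leq_mul2r; apply/orP; right.
  by rewrite -cardsT -card_powerset subset_leq_card // powersetT subsetT.
split; rewrite ?(sum _ id) ?sum //.
by rewrite (leq_trans (bd _)) // leq_pmull // expn_gt0.
Qed.

Lemma card_bipartitions D : #|bipartitions D| <= 2 ^ #|T|.
Proof.
by rewrite -cardsT -card_powerset subset_leq_card // powersetT subsetT.
Qed.

End Final.

Lemma conn_connected_in (G : ttgraph) (A : {set 'I_(nv G)}) :
  conn (edges G) A = connected_in A.
Proof.
set R := [rel u v | [&& u \in A, v \in A & adj u v]].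
have Rsym : symmetric R.
  by move=> u v; rewrite /= andbCA /adj /= orbC.
apply/connP/forall_inP => [H x xA|H f cf x y xA yA].
  apply/forall_inP=> y yA.
  (* Reachability from [x] serves as the colouring. *)
  have cR : compat (edges G) A (connect R x).
    move=> e ee e1 e2.
    apply/idP/idP=> /connect_trans; apply; apply: connect1; rewrite /= e1 e2 /adj /=.
      by rewrite -surjective_pairing ee.
    by rewrite -surjective_pairing ee orbT.
  by rewrite -(H _ cR x y) // connect0.
move/forall_inP: (H x xA) => /(_ y yA) /connectP[p].
elim: p x xA => [|z p IH] x xA /= => [_ -> //|/andP[/and3P[_ zA xz] pz] yE].
rewrite -(IH z zA pz yE); case/orP: xz => e.
  exact: (cf (x, z)).
by apply/esym; apply: (cf (z, x)).
Qed.

(* A balanced bipartition is determined by its block that avoids s. *)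
Lemma card_P20 (G : ttgraph) (w : 'I_(nv G) -> nat) (s : 'I_(nv G)) :
  #|P20 w| =
  #|[set B : {set 'I_(nv G)} |
      [&& s \notin B, B != set0, conn (edges G) B & conn (edges G) (~: B)]
      && (2 * weight w B == weight w [set: 'I_(nv G)])]|.
Proof.
set S := [set B | _].
have wC B : weight w [set: 'I_(nv G)] = weight w B + weight w (~: B).
  rewrite /weight (bigID (mem B)) /=; congr (_ + _); apply: eq_bigl => u;
  by rewrite !inE.
pose h (B : {set 'I_(nv G)}) := [set B; ~: B].
have hinj : {in S &, injective h}.
  move=> A B; rewrite !inE => /andP[/and4P[sA _ _ _] _] /andP[/and4P[sB _ _ _] _] E.
  have : A \in h B by rewrite -E /h !inE eqxx.
  rewrite !inE => /orP[/eqP//|/eqP AE].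
  by move: sA; rewrite AE inE sB.
rewrite -(card_in_imset hinj); congr #|pred_of_set _|; apply/setP=> P.
apply/idP/imsetP => [|[B BS ->]]; rewrite !inE.
  case/and4P=> /and3P[/eqP cov triv nz] /cards2P[A [B [AB PE]]] cP wP.
  have AP : A \in P by rewrite PE !inE eqxx.
  have BP : B \in P by rewrite PE !inE eqxx orbT.
  have BC : B = ~: A.
    apply/setP=> u; have := in_setT u; rewrite -cov PE /cover big_setU1 ?inE //.
    rewrite big_set1 => uAB; case: (boolP (u \in A)) uAB => //= uA _.
    have /trivIsetP/(_ A B AP BP AB) dAB := triv.
    by rewrite (disjointFr dAB uA).
  move/forall_inP: cP => cP; move/forall_inP: wP => wP.
  have wAB : weight w A = weight w B.
    by apply/eqP; move/forall_inP: (wP A AP) => /(_ B BP).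
  (* Symmetric in the two blocks: applied to whichever of them avoids [s]. *)
  have key C : C \in P -> ~: C \in P -> weight w C = weight w (~: C) ->
      s \notin C -> C \in S.
    move=> CP C'P wCC sC; rewrite inE sC !conn_connected_in !cP // !andbT /=.
    rewrite (wC C) -wCC mul2n addnn eqxx andbT.
    by apply: contraNneq nz => <-.
  have [sA|sA] := boolP (s \in A).
    exists B; last by rewrite PE /h BC setCK setUC.
    have sB : s \notin B by rewrite BC inE sA.
    have BCA : ~: B = A by rewrite BC setCK.
    by apply: key; rewrite ?BCA.
  exists A; last by rewrite PE BC.
  by apply: key; rewrite -?BC.
move: BS; rewrite inE => /andP[/and4P[sB nz cB cC] /eqP wB].
have BnC : B != ~: B.
  case/set0Pn: nz => u uB; apply/eqP=> E; move: (uB); rewrite E inE.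
  by rewrite uB.
have wBC : weight w B = weight w (~: B).
  by move: wB; rewrite (wC B) mul2n -addnn => /addnI.
apply/and4P; split.
- apply/and3P; split.
  + apply/eqP/setP=> u; rewrite /cover in_setT; apply/bigcupP.
    by case: (boolP (u \in B)) => uB; [exists B | exists (~: B)];
      rewrite ?inE ?eqxx ?orbT.
  + apply/trivIsetP=> C1 C2; rewrite !inE => /orP[]/eqP-> /orP[]/eqP->;
      rewrite ?eqxx // => _; rewrite -setI_eq0 ?setICr // setIC setICr //.
  + rewrite !inE negb_or eq_sym nz eq_sym /=.
    by apply/set0Pn; exists s; rewrite inE.
- by rewrite cards2 BnC.
- by apply/forall_inP=> C; rewrite !inE -conn_connected_in => /orP[]/eqP->.
- apply/forall_inP=> C1; rewrite !inE => h1; apply/forall_inP=> C2; rewrite !inE.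
  by case/orP: h1 => /eqP-> /orP[]/eqP->; rewrite ?wBC ?eqxx.
Qed.

(** * Vertex elimination *)

(** The elimination graph: [v] is isolated, not removed from the type, and its neighbours become
    adjacent. The diagonal is cleared so that fill-in creates no loops. *)
Definition elimr (T : eqType) (v : T) (E : rel T) : rel T :=
  fun x y => [&& x != v, y != v, x != y & E x y || (E x v && E v y)].

Section Elimination.
Variable T : finType.
Implicit Types (E : rel T) (u v x y : T) (us : seq T) (U : {set T}).

Definition nbrs E v : {set T} := [set y | E v y].

(** An elimination order of width at most 2; vertices that are not listed, such as terminals, are
    kept. *)
Fixpoint good E us : bool :=
  if us is u :: us' then (#|nbrs E u| <= 2) && good (elimr u E) us' else true.

(* No vertex a separates a set of internal vertices us from the rest. *)
Definition nosep E us : Prop := forall U a,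
  {subset U <= us} -> U != set0 ->
  exists u, exists y, [/\ u \in U, y \notin U, y != a & E u y].

Lemma elimr_ext E E' v : E =2 E' -> elimr v E =2 elimr v E'.
Proof. by move=> eqE x y; rewrite /elimr !eqE. Qed.

Lemma good_ext E E' us : E =2 E' -> good E us = good E' us.
Proof.
elim: us E E' => //= u us IH E E' eqE; rewrite (IH _ _ (elimr_ext u eqE)).
by congr ((#|pred_of_set _| <= 2) && _); apply/setP=> y; rewrite !inE eqE.
Qed.

Lemma elimr_sym E v : symmetric E -> symmetric (elimr v E).
Proof.
move=> sE x y; rewrite /elimr (eq_sym y x) (sE y x) (sE y v) (sE v x).
by rewrite (andbC (E v y)); do !case: (_ != _).
Qed.

Lemma elimr_irr E v : irreflexive (elimr v E).
Proof. by move=> x; rewrite /elimr eqxx !andbF. Qed.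

(** After both eliminations, remaining distinct vertices are adjacent exactly when an edge or a path
    with interior in [u] and [v] joins them, a condition symmetric in the two. *)
Lemma elimrC E u v : symmetric E -> elimr u (elimr v E) =2 elimr v (elimr u E).
Proof.
move=> sE x y; rewrite /elimr (sE u v) (eq_sym v u).
have [<-|xy] := eqVneq x y; first by rewrite /= !andbF.
have [<-|uv] := eqVneq u v; first by [].
have [->|xu] := eqVneq x u; first by rewrite /= !andbF.
have [->|xv] := eqVneq x v; first by rewrite /= ?andbF.
have [->|yu] := eqVneq y u; first by rewrite /= ?andbF.
have [->|yv] := eqVneq y v; first by rewrite /= ?andbF.
rewrite ?(eq_sym u y) ?(eq_sym v y) ?(negbTE yu) ?(negbTE yv) /=.
by case: (E x y); case: (E x u); case: (E x v); case: (E v y); case: (E u y);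
  case: (E v u).
Qed.

(** If [v] is adjacent to [u], it loses this neighbour and gains at most the one other neighbour of
    [u]; otherwise its neighbourhood does not grow. *)
Lemma deg_elimr E u v : symmetric E -> irreflexive E ->
  #|nbrs E u| <= 2 -> #|nbrs E v| <= 2 -> #|nbrs (elimr u E) v| <= 2.
Proof.
move=> sE iE du dv; case: (boolP (E v u)) => Evu; last first.
  apply: leq_trans dv; apply: subset_leq_card; apply/subsetP=> y.
  by rewrite !inE /elimr (negbTE Evu) orbF => /and4P[].
have dv' : #|nbrs E v :\ u| <= 1.
  by move: dv; rewrite (cardsD1 u) inE Evu.
have du' : #|nbrs E u :\ v| <= 1.
  by move: du; rewrite (cardsD1 v) inE sE Evu.
apply: (@leq_trans #|(nbrs E v :\ u) :|: (nbrs E u :\ v)|).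
  apply: subset_leq_card; apply/subsetP=> y; rewrite !inE /elimr Evu /=.
  by case/and4P=> _ -> vy; rewrite eq_sym vy.
apply: leq_trans (leq_card_setU _ _) _; lia.
Qed.

(** A vertex of degree at most 2 can be moved to the front: its elimination commutes with that of
    the head, and neither raises the degree of the other vertex above 2. A greedy choice thus never
    spoils the remaining order. *)
Lemma good_elim E us v : symmetric E -> irreflexive E -> v \in us -> uniq us ->
  good E us -> #|nbrs E v| <= 2 -> good (elimr v E) (rem v us).
Proof.
elim: us E => //= u us IH E sE iE; rewrite inE.
have [<-|uv] := eqVneq u v; first by move=> _ _ /andP[].
rewrite /= => vus /andP[unus uniq_us] /andP[du gus] dv.
rewrite deg_elimr //= (good_ext _ (elimrC u v sE)); apply: IH => //.
- exact: elimr_sym.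
- exact: elimr_irr.
- exact: deg_elimr.
Qed.

Lemma nosep_elim E us v : symmetric E -> v \in us -> uniq us -> nosep E us ->
  nosep (elimr v E) (rem v us).
Proof.
move=> sE vus uniq_us H U a sU nU.
have vU : v \notin U by apply/negP=> /sU; rewrite mem_rem_uniqF.
have sU' : {subset U <= us} by move=> u /sU /mem_rem.
have [u [y [uU yU ya Euy]]] := H U a sU' nU.
have uv : u != v by apply: contraNneq vU => <-.
have [yv|yv] := eqVneq y v; last first.
  exists u, y; split=> //; rewrite /elimr uv yv Euy /= andbT.
  by apply: contraNneq yU => <-.
(* Here the exit found is [v], which disappears. An exit of [v |: U] either starts in [U] or
   continues through [v] as a fill edge. *)
have [||u' [y' [u'U y'U y'a E']]] := H (v |: U) a.
- by move=> z; rewrite !inE => /orP[/eqP->//|/sU'].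
- by apply/set0Pn; exists v; rewrite setU11.
move: u'U y'U; rewrite !inE negb_or => u'U /andP[y'v y'U].
case/orP: u'U => [/eqP u'v|u'U].
  exists u, y'; split=> //; rewrite /elimr uv y'v -{1}yv Euy -u'v E' orbT andbT /=.
  by apply: contraNneq y'U => <-.
exists u', y'; split=> //; rewrite /elimr y'v E' /= andbT.
by apply/andP; split; [apply: contraNneq vU | apply: contraNneq y'U] => <-.
Qed.

(** Applied to the singleton of [v], [nosep] gives a neighbour; forbidding that neighbour gives a
    second one. *)
Lemma nosep_deg E us v : nosep E us -> v \in us -> irreflexive E -> 2 <= #|nbrs E v|.
Proof.
move=> H vus iE.
have sv : {subset [set v] <= us} by move=> u; rewrite inE => /eqP->.
have nv : [set v] != set0 by apply/set0Pn; exists v; rewrite set11.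
have [u [y [/set1P-> _ _ Ey]]] := H _ v sv nv.
have [u' [y' [/set1P-> _ ny Ey']]] := H _ y sv nv.
have : [set y; y'] \subset nbrs E v.
  by apply/subsetP=> z; rewrite !inE => /orP[] /eqP->.
by move/subset_leq_card; rewrite cards2 eq_sym ny.
Qed.

End Elimination.

(** * Elimination orders of series-parallel graphs *)

Definition elims (T : eqType) (us : seq T) (E : rel T) : rel T :=
  foldl (fun E u => elimr u E) E us.

Lemma good_cat (T : finType) (E : rel T) us1 us2 :
  good E (us1 ++ us2) = good E us1 && good (elims us1 E) us2.
Proof. by elim: us1 E => //= u us1 IH E; rewrite IH andbA. Qed.

Lemma elims_irr (T : finType) (us : seq T) (E : rel T) :
  irreflexive E -> irreflexive (elims us E).
Proof. by elim: us E => //= u us IH E iE; apply: IH; apply: elimr_irr. Qed.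

Lemma elims_isolated (T : eqType) (us : seq T) (E : rel T) u :
  (forall x, E x u = false) -> forall x, elims us E x u = false.
Proof.
elim: us E => //= v us IH E Eu; apply: IH => x.
by rewrite /elimr !Eu andbF !andbF.
Qed.

Lemma elims_notin (T : eqType) (us : seq T) (E : rel T) x y :
  elims us E x y -> y \notin us.
Proof.
elim: us E => //= u us IH E Exy; rewrite inE negb_or (IH _ Exy) andbT.
apply: contraTneq Exy => ->; rewrite elims_isolated // => z.
by rewrite /elimr eqxx andbF.
Qed.

(** Faithful around the listed vertices only: their neighbourhoods are copied exactly, whereas glued
    vertices may have further neighbours in [E]. *)
Definition embeds (T1 T : eqType) (f : T1 -> T) (us : seq T1)
    (E1 : rel T1) (E : rel T) : Prop :=
  forall x, x \in us ->
    (forall y, E (f x) (f y) = E1 x y) /\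
    (forall z, E (f x) z -> exists y, z = f y).

Lemma good_embeds (T1 T : finType) (f : T1 -> T) us E1 E :
    injective f -> uniq us -> embeds f us E1 E -> good E1 us ->
  good E (map f us).
Proof.
move=> inj_f; elim: us E1 E => //= u us IH E1 E /andP[nu uniq_us] H /andP[du gus].
have [Eu cu] := H u (mem_head _ _).
apply/andP; split.
  have -> : nbrs E (f u) = f @: nbrs E1 u.
    apply/setP=> z; rewrite inE; apply/idP/imsetP => [Ez|[y]].
      by have [y zE] := cu z Ez; exists y; rewrite // inE -Eu -zE.
    by rewrite inE -Eu => Ey ->.
  by rewrite card_imset.
apply: IH gus => // x xus; have [Ex cx] := H x (mem_behead (s := u :: us) xus).
split=> [y|z /and4P[_ _ _ /orP[/cx//|/andP[_ /cu//]]]].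
by rewrite /elimr !(inj_eq inj_f) !Ex Eu.
Qed.

(** No listed vertex has a neighbour in [vs], so eliminating [vs] adds no edge there. Irreflexivity
    of [E1] accounts for the diagonal that elimination clears. *)
Lemma embeds_elims (T1 T : eqType) (f : T1 -> T) us vs E1 E :
    injective f -> irreflexive E1 -> (forall x, f x \notin vs) ->
  embeds f us E1 E -> embeds f us E1 (elims vs E).
Proof.
move=> inj_f iE; elim: vs E => //= v vs IH E nvs H.
apply: IH => [x|x xus]; first by have := nvs x; rewrite inE => /norP[].
have [Ex cx] := H x xus.
have fv z : f z != v by have := nvs z; rewrite inE => /norP[].
have Exv : E (f x) v = false.
  by apply/negP=> /cx [y vy]; have := fv y; rewrite vy eqxx.
split=> [y|z]; rewrite /elimr Exv orbF; last by case/and4P=> _ _ _ /cx.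
rewrite !fv Ex (inj_eq inj_f) /=; have [->|//] := eqVneq x y.
by rewrite iE.
Qed.

Lemma set2_eq (T : finType) (x y a b : T) : [set x; y] = [set a; b] ->
  x = a /\ y = b \/ x = b /\ y = a.
Proof.
move=> E; have : (x \in [set a; b]) && (y \in [set a; b]) by rewrite -E !inE !eqxx orbT.
have : (a \in [set x; y]) && (b \in [set x; y]) by rewrite E !inE !eqxx orbT.
rewrite !inE => /andP[/pred2P ax /pred2P bx] /andP[/pred2P xa /pred2P ya].
by intuition congruence.
Qed.

Lemma adjE (G : ttgraph) (x y : 'I_(nv G)) :
  adj x y = ([set x; y] \in [seq endpoints e | e <- edges G]).
Proof.
apply/idP/mapP => [/orP[] e|[[a b] e]]; first by exists (x, y).
  by exists (y, x); rewrite // /endpoints setUC.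
by case/set2_eq => -[-> ->]; rewrite /adj /= e ?orbT.
Qed.

Lemma adj_sym (G : ttgraph) : symmetric (@adj G).
Proof. by move=> x y; rewrite /adj /= orbC. Qed.

Section Glued.
Variables (G1 G2 G : ttgraph) (R : 'I_(nv G1) -> 'I_(nv G2) -> bool).
Variables (f1 : 'I_(nv G1) -> 'I_(nv G)) (f2 : 'I_(nv G2) -> 'I_(nv G)).
Hypothesis glue : @glued G1 G2 G R f1 f2.

Let i1 : injective f1. Proof. by case: glue. Qed.
Let i2 : injective f2. Proof. by case: glue. Qed.

Let endpointsE (H : ttgraph) (f : 'I_(nv H) -> 'I_(nv G)) (z z' : 'I_(nv G)) :
  injective f ->
  reflect (exists x y, [/\ z = f x, z' = f y & adj x y])
          ([set z; z'] \in [seq endpoints (f e.1, f e.2) | e <- edges H]).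
Proof.
move=> inj_f.
have E : [seq endpoints (f e.1, f e.2) | e <- edges H] =
         [seq f @: A | A : {set _} <- [seq endpoints e | e <- edges H]].
  by rewrite -map_comp; apply: eq_map => e /=; rewrite /endpoints imsetU1 imset_set1.
rewrite E; apply: (iffP mapP) => [[A AH zE]|[x [y [-> -> xy]]]]; last first.
  by exists [set x; y]; rewrite -?adjE // imsetU1 imset_set1.
have : z \in f @: A by rewrite -zE !inE eqxx.
have : z' \in f @: A by rewrite -zE !inE eqxx orbT.
case/imsetP=> y yA z'E /imsetP[x xA zE']; exists x, y; split=> //.
rewrite adjE; suff -> : [set x; y] = A by [].
by apply: (imset_inj inj_f); rewrite imsetU1 imset_set1 -z'E -zE'.
Qed.

Lemma glued_adjP z z' :
  reflect ((exists x y, [/\ z = f1 x, z' = f1 y & adj x y]) \/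
           (exists x y, [/\ z = f2 x, z' = f2 y & adj x y])) (adj z z').
Proof.
rewrite adjE; case: glue => _ _ _ _ /perm_mem ->; rewrite mem_cat.
apply: (iffP orP) => -[H|H]; [left|right|left|right];
  by [exact/endpointsE | apply/endpointsE].
Qed.

Lemma glued_adj1 x y : adj x y -> adj (f1 x) (f1 y).
Proof. by move=> xy; apply/glued_adjP; left; exists x, y. Qed.

Lemma glued_adj2 x y : adj x y -> adj (f2 x) (f2 y).
Proof. by move=> xy; apply/glued_adjP; right; exists x, y. Qed.

Lemma gluedE x y : (f1 x == f2 y) = R x y.
Proof. by case: glue. Qed.

Lemma glued_cover z : (exists x, z = f1 x) \/ (exists y, z = f2 y).
Proof.
by case: glue => _ _ _ /(_ z) /orP[/codomP[x ->]|/codomP[y ->]] _; [left|right]; eexists.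
Qed.

Lemma glued_irr : irreflexive (@adj G1) -> irreflexive (@adj G2) ->
  irreflexive (@adj G).
Proof.
move=> I1 I2 z; apply/negP=> /glued_adjP[] [x [y [-> E]]].
  by move/i1: E => <-; rewrite I1.
by move/i2: E => <-; rewrite I2.
Qed.

Lemma glued_embeds1 us : (forall x y, x \in us -> ~~ R x y) ->
  embeds f1 us (@adj G1) (@adj G).
Proof.
move=> nR x xus; split=> [y|z].
  apply/idP/idP; last exact: glued_adj1.
  case/glued_adjP=> [] [x' [y' [E1 E2]]]; first by rewrite (i1 E1) (i1 E2).
  by have := nR x x' xus; rewrite -gluedE E1 eqxx.
case/glued_adjP=> [] [x' [y' [E1 E2 _]]]; first by exists y'.
by have := nR x x' xus; rewrite -gluedE E1 eqxx.
Qed.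

Lemma glued_embeds2 us : (forall x y, y \in us -> ~~ R x y) ->
  embeds f2 us (@adj G2) (@adj G).
Proof.
move=> nR x xus; split=> [y|z].
  apply/idP/idP; last exact: glued_adj2.
  case/glued_adjP=> [] [x' [y' [E1 E2]]]; last by rewrite (i2 E1) (i2 E2).
  by have := nR x' x xus; rewrite -gluedE E1 eqxx.
case/glued_adjP=> [] [x' [y' [E1 E2 _]]]; last by exists y'.
by have := nR x' x xus; rewrite -gluedE E1 eqxx.
Qed.

End Glued.

Lemma nosep_image (T1 T : finType) (f : T1 -> T) us1 (E1 : rel T1) (E : rel T)
    (U : {set T}) x0 a :
    injective f -> (forall x y, E1 x y -> E (f x) (f y)) -> nosep E1 us1 ->
    (forall x, f x \in U -> x \in us1) -> f x0 \in U ->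
  exists u y, [/\ u \in U, y \notin U, y != a & E u y].
Proof.
move=> inj_f homE H sU x0U.
(* If [a] is outside the image of [f], it excludes nothing there, and any default is harmless. *)
pose a1 := odflt x0 [pick x | f x == a].
have [||u [y [uU yU ya uy]]] := H (f @^-1: U) a1.
- by move=> x; rewrite inE => /sU.
- by apply/set0Pn; exists x0; rewrite inE.
exists (f u), (f y); move: uU yU; rewrite !inE => uU yU; split=> //; last exact: homE.
apply: contraNneq ya => fya; rewrite /a1; case: pickP => [x /eqP fx|/(_ y)].
  by rewrite -(inj_eq inj_f) fx fya.
by rewrite fya eqxx.
Qed.

(** Connection of the terminals, stated with cuts. In a series composition it supplies the exits of
    a set containing the middle vertex; applied to the source alone it shows that there is an
    edge. *)
Definition separators_cross (G : ttgraph) : Prop := forall U : {set 'I_(nv G)},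
  source G \in U -> sink G \notin U ->
  exists u y, [/\ u \in U, y \notin U & adj u y].

Definition reducible (G : ttgraph) : Prop :=
  [/\ source G != sink G, irreflexive (@adj G), separators_cross G &
      exists us, [/\ uniq us,
        forall x, (x \in us) = (x != source G) && (x != sink G),
        nosep (@adj G) us & good (@adj G) us]].

Lemma reducible_K2 G : is_K2 G -> reducible G.
Proof.
case=> nv2 st E; have aE x y : adj x y = ([set x; y] == [set source G; sink G]).
  by rewrite adjE E inE.
have all x : (x == source G) || (x == sink G).
  have : [set source G; sink G] == [set: 'I_(nv G)].
    by rewrite eqEcard subsetT cards2 st cardsT card_ord nv2.
  by move/eqP/setP/(_ x); rewrite !inE.
split=> //.
- move=> x; rewrite aE; apply/negP=> /eqP/set2_eq E'; case/negP: st; apply/eqP.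
  by case: E' => -[<- <-].
- by move=> U sU tU; exists (source G), (sink G); rewrite aE eqxx.
- exists [::]; split=> // [x|U a sU].
    by rewrite in_nil -negb_or all.
  by case/set0Pn=> x /sU.
Qed.

(** The interior orders are concatenated, since interior vertices of different parts are never
    adjacent. A set of interior vertices inherits its exit from any part that it meets. *)
Lemma reducible_parallel G1 G2 G :
  reducible G1 -> reducible G2 -> is_parallel G1 G2 G -> reducible G.
Proof.
case=> st1 irr1 cross1 [us1 [uniq1 mem1 ns1 good1]].
case=> st2 irr2 cross2 [us2 [uniq2 mem2 ns2 good2]].
case=> f1 [f2 [glue sE tE]].
have [i1 i2 _ _ _] := glue.
have fs : f1 (source G1) = f2 (source G2).
  by apply/eqP; rewrite (gluedE glue) !eqxx.
have ft : f1 (sink G1) = f2 (sink G2).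
  by apply/eqP; rewrite (gluedE glue) !eqxx orbT.
have R1 x y : x \in us1 -> ~~ ((x == source G1) && (y == source G2)
                                || (x == sink G1) && (y == sink G2)).
  by rewrite mem1 => /andP[/negbTE-> /negbTE->].
have R2 x y : y \in us2 -> ~~ ((x == source G1) && (y == source G2)
                                || (x == sink G1) && (y == sink G2)).
  by rewrite mem2 => /andP[/negbTE-> /negbTE->]; rewrite !andbF.
have irr := glued_irr glue irr1 irr2.
have memE x : (x \in map f1 us1 ++ map f2 us2) = (x != source G) && (x != sink G).
  rewrite mem_cat sE tE; case: (glued_cover glue x) => [[y ->]|[y ->]].
    rewrite mem_map // !(inj_eq i1) mem1; case: andP => //= H.
    apply/mapP=> -[z zus E]; apply: H; apply/andP; rewrite -mem1.
    by have := R2 y z zus; rewrite -(gluedE glue) E eqxx.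
  rewrite fs ft !(inj_eq i2) (mem_map i2) mem2 orbC; case: andP => //= H.
  apply/mapP=> -[z zus E]; apply: H; apply/andP; rewrite -mem2.
  by have := R1 z y zus; rewrite -(gluedE glue) E eqxx.
split=> //.
- by rewrite sE tE (inj_eq i1).
- move=> U; rewrite sE tE => sU tU.
  have [||u [y [uU yU uy]]] := cross1 (f1 @^-1: U); rewrite ?inE //.
  by exists (f1 u), (f1 y); move: uU yU; rewrite !inE; split=> //; apply: (glued_adj1 glue).
exists (map f1 us1 ++ map f2 us2); split=> //.
- rewrite cat_uniq !map_inj_uniq // uniq1 uniq2 andbT /=.
  apply/hasPn=> z /mapP[y yus ->]; apply/mapP=> -[x xus E].
  by have := R1 x y xus; rewrite -(gluedE glue) E eqxx.
- move=> U a sU /set0Pn[z zU].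
  case: (glued_cover glue z) => [[x zE]|[x zE]]; rewrite zE in zU.
    apply: (nosep_image a i1 (glued_adj1 glue) ns1 _ zU) => // y /sU.
    by rewrite memE mem1 sE tE !(inj_eq i1).
  apply: (nosep_image a i2 (glued_adj2 glue) ns2 _ zU) => // y /sU.
  by rewrite memE mem2 sE tE fs ft !(inj_eq i2).
- rewrite good_cat (good_embeds i1 uniq1 (glued_embeds1 glue R1) good1) /=.
  apply: (good_embeds i2 uniq2 _ good2); apply: embeds_elims => //.
    move=> x; apply/mapP=> -[z zus E].
    by have := R1 z x zus; rewrite -(gluedE glue) -E eqxx.
  exact: (glued_embeds2 glue).
Qed.

Lemma reducible_series G1 G2 G :
  reducible G1 -> reducible G2 -> is_series G1 G2 G -> reducible G.
Proof.
case=> st1 irr1 cross1 [us1 [uniq1 mem1 ns1 good1]].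
case=> st2 irr2 cross2 [us2 [uniq2 mem2 ns2 good2]].
case=> f1 [f2 [glue sE tE]].
have [i1 i2 _ _ _] := glue.
set m := f1 (sink G1).
have fm : m = f2 (source G2).
  by apply/eqP; rewrite (gluedE glue) !eqxx.
have R1 x y : x \in us1 -> ~~ ((x == sink G1) && (y == source G2)).
  by rewrite mem1 => /andP[_ /negbTE->].
have R2 x y : y \in us2 -> ~~ ((x == sink G1) && (y == source G2)).
  by rewrite mem2 => /andP[/negbTE-> _]; rewrite andbF.
have irr := glued_irr glue irr1 irr2.
have f1t x : f1 x != sink G.
  by rewrite tE (gluedE glue) (eq_sym (sink G2)) (negbTE st2) andbF.
have f2s x : f2 x != source G.
  by rewrite sE eq_sym (gluedE glue) (negbTE st1).
have mem' x : (x \in map f1 us1 ++ map f2 us2) = [&& x != source G, x != sink G & x != m].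
  rewrite mem_cat; case: (glued_cover glue x) => [[y ->]|[y ->]].
    rewrite f1t sE mem_map // !(inj_eq i1) mem1 /=; case: andP => //= H.
    apply/mapP=> -[z zus E].
    by have := R2 y z zus; rewrite -(gluedE glue) E eqxx.
  rewrite f2s tE fm !(inj_eq i2) (mem_map i2) mem2 orbC andbC /=; case: andP => //= H.
  apply/mapP=> -[z zus E].
  by have := R1 z y zus; rewrite -(gluedE glue) E eqxx.
(* The middle vertex is eliminated last, when only the two terminals can still be its neighbours. *)
pose us := (map f1 us1 ++ map f2 us2) ++ [:: m].
have memE x : (x \in us) = (x != source G) && (x != sink G).
  rewrite mem_cat mem' mem_seq1; have [->|] := eqVneq x m; last by rewrite andbT orbF.
  by rewrite orbT fm f2s -fm f1t.
split=> //.
- by rewrite sE f1t.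
- move=> U; rewrite sE tE => sU tU; case: (boolP (m \in U)) => mU.
    have [||u [y [uU yU uy]]] := cross2 (f2 @^-1: U); rewrite ?inE -?fm //.
    by exists (f2 u), (f2 y); move: uU yU; rewrite !inE; split=> //; apply: (glued_adj2 glue).
  have [||u [y [uU yU uy]]] := cross1 (f1 @^-1: U); rewrite ?inE //.
  by exists (f1 u), (f1 y); move: uU yU; rewrite !inE; split=> //; apply: (glued_adj1 glue).
exists us; split=> //.
- rewrite cat_uniq cat_uniq !map_inj_uniq // uniq1 uniq2 andbT /= orbF mem' eqxx !andbF /= !andbT.
  apply/hasPn=> z /mapP[y yus ->]; apply/mapP=> -[x xus E].
  by have := R1 x y xus; rewrite -(gluedE glue) E eqxx.
- move=> U a sU /set0Pn[z zU]; case: (boolP (m \in U)) => mU; last first.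
    case: (glued_cover glue z) => [[x zE]|[x zE]]; rewrite zE in zU.
      apply: (nosep_image a i1 (glued_adj1 glue) ns1 _ zU) => // y yU.
      have := sU _ yU; rewrite memE mem1 sE !(inj_eq i1) => /andP[-> _].
      by apply: contraNneq mU => E; rewrite /m -E.
    apply: (nosep_image a i2 (glued_adj2 glue) ns2 _ zU) => // y yU.
    have := sU _ yU; rewrite memE mem2 tE !(inj_eq i2) andbC => /andP[-> _].
    by rewrite andbT; apply: contraNneq mU => E; rewrite fm -E.
  have sU' : source G \notin U by apply/negP=> /sU; rewrite memE eqxx.
  have tU' : sink G \notin U by apply/negP=> /sU; rewrite memE eqxx andbF.
  (* [U] contains [m] but neither terminal, so it has an exit in each half. The half chosen contains
     [a] at most as [m], which lies in [U]. *)
  have [x fxa|na] := pickP (fun x => f1 x == a).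
    have [||u [y [uU yU uy]]] := cross2 (f2 @^-1: U); rewrite ?inE -?fm -?tE //.
    exists (f2 u), (f2 y); move: uU yU; rewrite !inE => uU yU; split=> //.
      apply: contraNneq yU => ya; have : f1 x == f2 y by rewrite (eqP fxa) ya.
      by rewrite (gluedE glue) => /andP[_ /eqP->]; rewrite -fm.
    exact: (glued_adj2 glue).
  (* In the first half [m] is the sink, so the cut is taken around the source and its edge read
     backwards. *)
  have [||u [y [uU yU uy]]] := cross1 (~: (f1 @^-1: U)); rewrite ?inE -?sE ?negbK //.
  exists (f1 y), (f1 u); move: uU yU; rewrite !inE negbK => uU yU.
  by rewrite na adj_sym; split=> //; apply: (glued_adj1 glue).
- rewrite good_cat good_cat (good_embeds i1 uniq1 (glued_embeds1 glue R1) good1) /=.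
  apply/andP; split.
    apply: (good_embeds i2 uniq2 _ good2); apply: embeds_elims => //.
      move=> x; apply/mapP=> -[z zus E].
      by have := R1 z x zus; rewrite -(gluedE glue) -E eqxx.
    exact: (glued_embeds2 glue).
  rewrite andbT; apply: (@leq_trans #|[set source G; sink G]|).
    apply: subset_leq_card; apply/subsetP=> y; rewrite !inE => Ey.
    have := elims_notin Ey; rewrite mem' !negb_and !negbK.
    case/or3P=> [->//|->|/eqP ym]; first by rewrite orbT.
    by rewrite ym elims_irr in Ey.
  by rewrite cards2; case: (_ != _).
Qed.

Theorem sp_reducible G : series_parallel G -> reducible G.
Proof.
elim=> {}G; first exact: reducible_K2.
  by move=> G2 G' _ r1 _ r2; apply: reducible_series.
by move=> G2 G' _ r1 _ r2; apply: reducible_parallel.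
Qed.

(** * The reduction algorithm *)

Section Reduction.
Variable T : finType.
Implicit Types (D H : dterm T) (L : seq (dterm T)) (u v x y : T) (us vs A : seq T).

(** Merging at insertion keeps at most one item per pair of ends, so that the items are the edges of
    a simple graph. *)
Fixpoint insertD D L :=
  if L is H :: L' then
    if ends H == ends D then DPar H D :: L'
    else if ends H == ends (DRev D) then DPar H (DRev D) :: L'
    else H :: insertD D L'
  else [:: D].

(** Items are turned to end at [v]; two of them compose in series once the second is reversed. *)
Fixpoint incD v L :=
  if L is H :: L' then
    if (ends H).2 == v then H :: incD v L'
    else if (ends H).1 == v then DRev H :: incD v L'
    else incD v L'
  else [::].

Fixpoint restD v L :=
  if L is H :: L' then
    if ((ends H).1 == v) || ((ends H).2 == v) then restD v L' else H :: restD v L'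
  else [::].

(** [vs] may list all vertices: eliminated ones have no incident item left and are passed over.
    Without a candidate the list is returned unchanged. *)
Fixpoint searchD s t vs L :=
  if vs is v :: vs' then
    if (v == s) || (v == t) then searchD s t vs' L
    else if incD v L is [:: D1; D2] then insertD (DSer D1 (DRev D2)) (restD v L)
    else searchD s t vs' L
  else L.

Definition buildD (es : seq (T * T)) := foldr (fun e => insertD (DEdge e.1 e.2)) [::] es.

Definition key D : {set T} := [set (ends D).1; (ends D).2].
Definition inters L := flatten (map (@inter T) L).
Definition alledges L := flatten (map (@dedges T) L).
Definition rel_of L : rel T := fun x y => [set x; y] \in map key L.

Definition dterm_over A D := [&& wf D, (ends D).1 \in A & (ends D).2 \in A].

Lemma wf_neq D : wf D -> (ends D).1 != (ends D).2.
Proof. by move/wf_uniq; rewrite /= inE negb_or => /andP[/andP[]]. Qed.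

Lemma key_rev D : key (DRev D) = key D.
Proof. by rewrite /key setUC. Qed.

Lemma key_eq D H : key H = key D -> ends H = ends D \/ ends H = ends (DRev D).
Proof.
rewrite /key /=; case: (ends H) (ends D) => [a b] [c d] /=.
by case/set2_eq => -[-> ->]; [left|right].
Qed.

Lemma insert_inters D L : perm_eq (inters (insertD D L)) (inter D ++ inters L).
Proof.
elim: L => //= H L IH; rewrite /inters /=.
case: ifP => _; first by rewrite /= -!catA perm_catCA.
case: ifP => _; first by rewrite /= -!catA perm_catCA.
by rewrite /= (perm_catl _ IH) perm_catCA.
Qed.

Lemma insert_edges D L : alledges (insertD D L) =i dedges D ++ alledges L.
Proof.
move=> e; elim: L => //= H L IH; rewrite /alledges /=.
case: ifP => _; first by rewrite /= !mem_cat orbCA orbA.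
case: ifP => _; first by rewrite /= !mem_cat orbCA orbA.
by rewrite /= !mem_cat -!/(alledges _) IH mem_cat orbCA.
Qed.

Lemma insert_key D L : map key (insertD D L) =i key D :: map key L.
Proof.
move=> K; elim: L => //= H L IH.
case: eqP => [E|_]; first by rewrite /= !inE /key /= -E orbA orbb.
case: eqP => [E|_] /=; last by rewrite !inE IH inE orbCA.
by rewrite !inE -(key_rev D) /key /= E /= orbA orbb.
Qed.

Lemma insert_uniq_key D L : uniq (map key L) -> uniq (map key (insertD D L)).
Proof.
elim: L => //= H L IH /andP[nH uL].
case: eqP => [//|E1]; first by rewrite /= nH.
case: eqP => [//|E2] /=; first by rewrite nH.
rewrite IH // insert_key inE negb_or nH andbT andbT.
by apply/eqP=> /key_eq[].
Qed.

Lemma over_rev A D : dterm_over A (DRev D) = dterm_over A D.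
Proof. by rewrite /dterm_over /= (andbC (_ \in A)). Qed.

Lemma over_par A D H : dterm_over A D -> dterm_over A H -> ends H = ends D ->
  uniq (A ++ inter D ++ inter H) -> dterm_over A (DPar H D).
Proof.
move=> /and3P[wD D1 D2] /and3P[wH H1 H2] E; rewrite /dterm_over /= wH wD E eqxx D1 D2 !andbT.
rewrite cat_uniq => /and3P[_ /hasPn dis U].
have := wf_neq wD; rewrite inE negb_or => -> /=; rewrite uniq_catC U andbT.
by apply/andP; split; apply/negP; rewrite mem_cat orbC -mem_cat => /dis /negP[].
Qed.

Lemma insert_over A D L : uniq (A ++ inter D ++ inters L) ->
  dterm_over A D -> all (dterm_over A) L -> all (dterm_over A) (insertD D L).
Proof.
elim: L => /= [_ ->//|H L IH]; rewrite /inters /= => U oD /andP[oH oL].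
have UH : uniq (A ++ inter D ++ inter H).
  by move: U; rewrite !catA cat_uniq => /andP[].
case: eqP => [E|_]; first by rewrite /= oL over_par //.
case: eqP => [E|_]; first by rewrite /= oL over_par // over_rev.
rewrite /= oH IH //; apply: subseq_uniq U; rewrite cat_subseq // cat_subseq //.
exact: suffix_subseq.
Qed.

Lemma inc_rest_inters v L : perm_eq (inters (incD v L) ++ inters (restD v L)) (inters L).
Proof.
elim: L => //= H L IH; rewrite /inters /=.
case: eqP => [E|_]; first by rewrite orbT /= -catA perm_cat2l.
case: eqP => [E|_] /=; first by rewrite -catA perm_cat2l.
by rewrite perm_catCA perm_cat2l.
Qed.

Lemma inc_rest_edges v L : alledges (incD v L) ++ alledges (restD v L) =i alledges L.
Proof.
move=> e; elim: L => //= H L; rewrite /alledges /= !mem_cat => <-.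
case: eqP => [E|_]; first by rewrite orbT /= !mem_cat orbA.
case: eqP => [E|_] /=; first by rewrite !mem_cat orbA.
by rewrite !mem_cat orbCA.
Qed.

Lemma rest_subseq v L : subseq (map key (restD v L)) (map key L).
Proof.
elim: L => // H L IH; rewrite /=; case: ifP => _; last by rewrite /= eqxx.
exact: subseq_trans IH (subseq_cons _ _).
Qed.

Lemma inc_over A v L : all (dterm_over A) L ->
  all (fun D => dterm_over A D && ((ends D).2 == v)) (incD v L).
Proof.
elim: L => //= H L IH /andP[oH /IH oL].
case: eqP => [E|_]; first by rewrite /= oH E eqxx.
case: eqP => [E|_] //; rewrite /= oL E eqxx !andbT.
by case/and3P: oH => *; apply/and3P.
Qed.

Lemma rest_over A v L : all (dterm_over A) L -> all (dterm_over (rem v A)) (restD v L).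
Proof.
elim: L => //= H L IH /andP[oH /IH oL]; case: ifP => //= /norP[n1 n2].
by rewrite oL andbT; case/and3P: oH => wH H1 H2; rewrite /dterm_over wH !rem_mem.
Qed.

Lemma rel_of_sym L : symmetric (rel_of L).
Proof. by move=> x y; rewrite /rel_of setUC. Qed.

Lemma rel_of_irr A L : all (dterm_over A) L -> irreflexive (rel_of L).
Proof.
move=> oL x; rewrite /rel_of; elim: L oL => //= H L IH /andP[/and3P[wH _ _] /IH].
rewrite inE => ->; rewrite orbF; apply/negP=> /eqP E.
by have := wf_neq wH; case: (set2_eq E) => -[<- <-]; rewrite eqxx.
Qed.

Lemma nbrs_inc A v L : all (dterm_over A) L ->
  nbrs (rel_of L) v =i map (fun D => (ends D).1) (incD v L).
Proof.
move=> oL x; rewrite inE /rel_of; elim: L oL => //= H L IH /andP[/and3P[wH _ _] /IH {}IH].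
have nH := wf_neq wH; rewrite inE IH.
have -> : ([set v; x] == key H) =
    ((ends H).2 == v) && (x == (ends H).1) || ((ends H).1 == v) && (x == (ends H).2).
  apply/eqP/orP => [/set2_eq[[-> ->]|[-> ->]]|[]/andP[/eqP<- /eqP->]].
  - by right; rewrite !eqxx.
  - by left; rewrite !eqxx.
  - by rewrite /key setUC.
  - by [].
case: eqP => [E|_]; first by rewrite -E (negbTE nH) /= orbF inE.
by case: (eqVneq (ends H).1 v) => [E|_] //=; rewrite in_cons.
Qed.

(** No two items share both ends, so counting the items at [v] counts its neighbours, and the test
    for two items is a degree test. *)
Lemma inc_size A v L : all (dterm_over A) L -> uniq (map key L) ->
  size (incD v L) = #|nbrs (rel_of L) v|.
Proof.
move=> oL uL; rewrite (eq_card (nbrs_inc v oL)).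
rewrite -(size_map (fun D => (ends D).1)); apply/esym/card_uniqP.
elim: L oL uL => //= H L IH /andP[/and3P[wH _ _] oL] /andP[nH uL].
have Hnot x : key H = [set v; x] -> x \notin map (fun D => (ends D).1) (incD v L).
  by move=> kH; rewrite -(nbrs_inc v oL) inE /rel_of -kH.
case: eqP => [E|_].
  by rewrite /= IH // andbT Hnot // /key E setUC.
case: eqP => [E|_]; last exact: IH.
by rewrite /= IH // andbT Hnot // /key E.
Qed.

Lemma rest_rel A v L x y : all (dterm_over A) L ->
  rel_of (restD v L) x y = [&& x != v, y != v & rel_of L x y].
Proof.
rewrite /rel_of; elim: L => [|H L IH] /=; first by rewrite !andbF.
case/andP=> /and3P[wH _ _] /IH {}IH.
have kv : [set x; y] = key H -> ((ends H).1 == v) || ((ends H).2 == v) =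
    ~~ ((x != v) && (y != v)).
  by rewrite negb_and !negbK; case/set2_eq=> -[-> ->] //; rewrite orbC.
case: ifP => vH; rewrite ?inE IH; have [/kv|] /= := eqVneq [set x; y] (key H); rewrite ?vH.
- by move/esym; rewrite negb_and !negbK => /orP[]/eqP->; rewrite eqxx ?andbF.
- by [].
- by move/esym/negbFE/andP=> [-> ->].
- by [].
Qed.

(** Series composition at [v] followed by merging is vertex elimination in the graph of items. *)
Lemma elim_rel A v L D1 D2 : all (dterm_over A) L -> uniq (map key L) ->
    incD v L = [:: D1; D2] ->
  rel_of (insertD (DSer D1 (DRev D2)) (restD v L)) =2 elimr v (rel_of L).
Proof.
move=> oL uL E x y.
have nb z : rel_of L v z = (z == (ends D1).1) || (z == (ends D2).1).
  by have := nbrs_inc v oL z; rewrite E /= !inE.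
have card := inc_size v oL uL; rewrite E /= in card.
have neq : (ends D1).1 != (ends D2).1.
  apply/negP=> /eqP E12; have : #|nbrs (rel_of L) v| <= #|[set (ends D1).1]|.
    by apply: subset_leq_card; apply/subsetP=> z; rewrite !inE nb E12 orbb.
  by rewrite -card cards1.
have irr := rel_of_irr oL.
have n1 : (ends D1).1 != v.
  by apply/negP=> /eqP E1; have := nb v; rewrite E1 eqxx irr.
have n2 : (ends D2).1 != v.
  by apply/negP=> /eqP E2; have := nb v; rewrite E2 eqxx irr orbT.
rewrite {1}/rel_of insert_key inE -/(rel_of _ x y) (rest_rel _ _ _ oL) /elimr.
rewrite (rel_of_sym L x v) !nb /key /=.
have -> : ([set x; y] == [set (ends D1).1; (ends D2).1]) =
    (x == (ends D1).1) && (y == (ends D2).1) ||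
    (x == (ends D2).1) && (y == (ends D1).1).
  apply/eqP/orP => [/set2_eq[[-> ->]|[-> ->]]|[]/andP[/eqP-> /eqP->]] //.
  - by left; rewrite !eqxx.
  - by right; rewrite !eqxx.
  - by rewrite setUC.
have [->|xy] := eqVneq x y.
  rewrite irr !andbF orbF; apply/negP=> /orP[]/andP[/eqP E1 /eqP E2];
  by move: neq; rewrite -E1 -E2 eqxx.
have [xE|nx1] := eqVneq x (ends D1).1.
  rewrite xE (negbTE neq) n1 /= orbF; move: xy; rewrite xE eq_sym => /negbTE->.
  by have [->|] := eqVneq y (ends D2).1; rewrite /= ?n2 ?orbT ?orbF.
have [xE|nx2] := eqVneq x (ends D2).1.
  move: xy; rewrite xE n2 [_ == y]eq_sym => /negbTE->; rewrite /= orbF.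
  by have [->|] := eqVneq y (ends D1).1; rewrite /= ?n1 ?orbT ?orbF.
by rewrite /= orbF.
Qed.

(* us lists the vertices that remain besides the terminals s and t, in an
   order in which each of them has at most two neighbours when its turn comes. *)
Definition reduction_state s t us L : Prop :=
  [/\ all (dterm_over [:: s, t & us]) L, uniq ([:: s, t & us] ++ inters L),
      forall x, x \in [:: s, t & us] ++ inters L, uniq (map key L) &
      good (rel_of L) us /\ nosep (rel_of L) us].

(** [v] passes from the remaining vertices to the interior of the new item, so the concatenation of
    the two lists is only permuted; the graph conditions are those of the elimination lemmas. *)
Lemma state_elim s t us L v D1 D2 : reduction_state s t us L -> v \in us ->
    incD v L = [:: D1; D2] ->
  reduction_state s t (rem v us) (insertD (DSer D1 (DRev D2)) (restD v L)).
Proof.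
case=> oL uA cA uK [gL nL] vus E; set D := DSer _ _.
have vs : v != s.
  by apply: contraTneq vus => ->; move: uA; rewrite /= inE mem_cat; case/andP=> /norP[_ /norP[]].
have vt : v != t.
  by apply: contraTneq vus => ->; move: uA; rewrite /= mem_cat; case/and3P=> _ /norP[].
have remE : rem v [:: s, t & us] = [:: s, t & rem v us].
  by rewrite /= (eq_sym s) (eq_sym t) (negbTE vs) (negbTE vt).
have irr := rel_of_irr oL; have sym := rel_of_sym L.
have relE := elim_rel oL uK E.
have [o1 o2 e1 e2] : [/\ dterm_over [:: s, t & us] D1, dterm_over [:: s, t & us] D2,
    (ends D1).2 = v & (ends D2).2 = v].
  have := inc_over v oL; rewrite E /= andbT.
  by case/andP=> /andP[-> /eqP->] /andP[-> /eqP->].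
have neq : (ends D1).1 != (ends D2).1.
  have := inc_size v oL uK; rewrite (eq_card (nbrs_inc v oL)) E /= => /esym/eqP.
  apply: contraTneq => ->; rewrite (eq_card (_ : _ =i [:: (ends D2).1])) ?card1 //.
    by rewrite (eq_card (_ : _ =i pred1 (ends D2).1)) ?card1 // => z; rewrite !inE.
  by move=> z; rewrite !inE orbb.
have permI : perm_eq (v :: inters (insertD D (restD v L)))
    (v :: v :: (inters (incD v L) ++ inters (restD v L))).
  rewrite perm_cons (permPl (insert_inters _ _)) E /inters /= cats0 -!catA.
  by rewrite e1 perm_cons.
have us_perm : perm_eq us (v :: rem v us) by exact: perm_to_rem.
have perm_all : perm_eq ([:: s, t & rem v us] ++ inters (insertD D (restD v L)))
                        ([:: s, t & us] ++ inters L).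
  move: permI; rewrite perm_cons => permI.
  rewrite /= !perm_cons (permPr (perm_cat us_perm (perm_refl _))) /=.
  rewrite (permPl (perm_cat (perm_refl _) permI)).
  rewrite -cat1s perm_catCA /= perm_cons perm_cat2l.
  exact: inc_rest_inters.
split.
- apply: insert_over.
  + rewrite (perm_uniq (_ : perm_eq _ ([:: s, t & us] ++ inters L))) //.
    apply: perm_trans perm_all; rewrite perm_cat2l perm_sym.
    exact: insert_inters.
  + case/and3P: o1 => w1 o11 _; case/and3P: o2 => w2 o21 _.
    have n1 := wf_neq w1; have n2 := wf_neq w2; rewrite e1 in n1; rewrite e2 in n2.
    rewrite /dterm_over /= w1 w2 e1 e2 eqxx /= -remE !rem_mem // !andbT.
    rewrite !inE !negb_or neq n1 n2 /=.
    have : uniq ([:: s, t & us] ++ (inter D1 ++ inter D2)).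
      have <- : inters (incD v L) = inter D1 ++ inter D2 by rewrite E /inters /= cats0.
      have := uA; rewrite -(perm_uniq (perm_cat (perm_refl _) (inc_rest_inters v L))).
      by rewrite catA cat_uniq => /andP[].
    rewrite cat_uniq => /and3P[_ /hasPn dis ->]; rewrite andbT.
    have vA : v \in [:: s, t & us] by rewrite !inE vus !orbT.
    by apply/and3P; split; apply/negP=> /dis/negP[].
  + by rewrite -remE; apply: rest_over.
- by rewrite (perm_uniq perm_all).
- by move=> x; rewrite (perm_mem perm_all).
- exact/insert_uniq_key/(subseq_uniq (rest_subseq _ _)).
have uus : uniq us by move: uA; rewrite /= cat_uniq => /and4P[_ _ ->].
have dv : #|nbrs (rel_of L) v| <= 2 by rewrite -(inc_size v oL uK) E.
split; first by rewrite (good_ext _ relE); apply: good_elim.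
move=> U a sU nU; have [u [y [? ? ? e]]] := nosep_elim sym vus uus nL a sU nU.
by exists u, y; rewrite relE.
Qed.

Lemma state_inc_eliminated s t us L v : reduction_state s t us L ->
  v \notin [:: s, t & us] -> incD v L = [::].
Proof.
case=> oL _ _ _ _ vA; apply: size0nil.
elim: L oL => //= H L IH /andP[/and3P[_ H1 H2] /IH IH'].
have -> : ((ends H).2 == v) = false by apply: contraNF vA => /eqP<-.
by have -> : ((ends H).1 == v) = false by apply: contraNF vA => /eqP<-.
Qed.

(** The head of the order has at most 2 neighbours by [good] and at least 2 by [nosep], so a
    candidate exists; the search may take another, which [good_elim] permits. The predecessor covers
    the case of no remaining vertex. *)
Lemma state_search s t us L vs : reduction_state s t us L ->
    (forall v, v \in vs) ->
  exists2 us', size us' = (size us).-1 & reduction_state s t us' (searchD s t vs L).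
Proof.
move=> S allvs; have [oL uA _ uK [gL nL]] := S.
have irr := rel_of_irr oL.
have step ws : (exists v, [/\ v \in us, v \in ws & size (incD v L) = 2]) ->
    exists2 us', size us' = (size us).-1 & reduction_state s t us' (searchD s t ws L).
  elim: ws => [[v []//]|v ws IH [x [xus xws sx]]] /=.
  case: ifP => vst.
    apply: IH; exists x; split=> //; move: xws; rewrite inE => /orP[/eqP xv|//].
    move: uA; rewrite /= inE !mem_cat -xv in vst *.
    by case/orP: vst => /eqP <-; rewrite xus ?orbT ?andbF.
  case E: (incD v L) => [|D1 [|D2 [|D3 M]]].
  - by apply: IH; exists x; split=> //; move: xws; rewrite inE => /orP[/eqP xv|//];
      rewrite xv E in sx.
  - by apply: IH; exists x; split=> //; move: xws; rewrite inE => /orP[/eqP xv|//];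
      rewrite xv E in sx.
  - have vus : v \in us.
      apply/negPn/negP=> nv; have : v \notin [:: s, t & us].
        by rewrite !inE orbA vst.
      by move/(state_inc_eliminated S); rewrite E.
    by exists (rem v us); [rewrite size_rem | apply: state_elim].
  - by apply: IH; exists x; split=> //; move: xws; rewrite inE => /orP[/eqP xv|//];
      rewrite xv E in sx.
case Eus : us => [|u us'].
  exists [::] => //; rewrite -Eus.
  suff -> : searchD s t vs L = L by [].
  elim: (vs) => //= v ws IH; case: ifP => // vst.
  rewrite (state_inc_eliminated S) //.
  by rewrite Eus !inE vst.
rewrite -Eus; apply: step; exists u; rewrite Eus mem_head; split=> //.
apply/eqP; rewrite (inc_size u oL uK) eqn_leq (nosep_deg nL) ?Eus ?mem_head // andbT.
by move: gL; rewrite Eus => /andP[].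
Qed.

Lemma state_iter s t us L vs n : reduction_state s t us L ->
    (forall v, v \in vs) -> size us <= n ->
  reduction_state s t [::] (iter n (searchD s t vs) L).
Proof.
elim: n us L => [|n IH] us L S allvs; first by rewrite leqn0 => /nilP us0; rewrite -us0.
move=> le; have [us' sz S'] := state_search S allvs.
rewrite iterSr; apply: IH S' allvs _; rewrite sz; lia.
Qed.

(** Every item now joins [s] and [t], and distinct keys leave room for one. Its orientation is not
    determined. *)
Lemma state_final s t L : reduction_state s t [::] L -> 0 < size L ->
  exists D, [/\ L = [:: D], wf D & verts D = setT].
Proof.
case=> oL uA cA uK _.
have k D : dterm_over [:: s; t] D -> key D = [set s; t].
  case/and3P=> /wf_neq n; rewrite /key !inE => /orP[]/eqP h1 /orP[]/eqP h2;
    by move: n; rewrite h1 h2 ?eqxx // => _; rewrite setUC.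
case: L oL uA cA uK => // D [|D' L] /=.
  rewrite andbT => oD _ cA _ _; exists D; have /and3P[wD _ _] := oD; split=> //.
  apply/setP=> x; have := cA x; rewrite /verts setUA -/(key D) (k D oD) !inE /inters /=.
  by rewrite cats0 orbA.
by case/and3P=> /k-> /k->; rewrite !inE eqxx.
Qed.

Lemma search_edges s t vs L : alledges (searchD s t vs L) =i alledges L.
Proof.
move=> e; elim: vs => //= v vs IH; case: ifP => // _.
case E: (incD v L) => [|D1 [|D2 [|D3 M]]] //.
rewrite insert_edges -(inc_rest_edges v) E /alledges /= cats0 !mem_cat.
by [].
Qed.

Lemma build_edges es : alledges (buildD es) =i es.
Proof.
move=> e; elim: es => //= -[x y] es IH; rewrite insert_edges mem_cat IH !inE.
by [].
Qed.

Lemma build_rel es x y :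
  rel_of (buildD es) x y = ([set x; y] \in [seq endpoints e | e <- es]).
Proof.
by rewrite /rel_of; elim: es => //= -[a b] es IH; rewrite insert_key !inE IH.
Qed.

Lemma build_over A es : uniq A -> all (fun e => [&& e.1 != e.2, e.1 \in A & e.2 \in A]) es ->
  all (dterm_over A) (buildD es) /\ inters (buildD es) = [::].
Proof.
move=> uA; elim: es => //= -[x y] es IH /= /andP[oe /IH[oL nL]].
split; last first.
  by apply/nilP; rewrite /nilp (perm_size (insert_inters _ _)) /= nL.
by apply: insert_over; rewrite ?nL ?cats0.
Qed.

Lemma build_uniq_key es : uniq (map key (buildD es)).
Proof. by elim: es => //= e es IH; apply: insert_uniq_key. Qed.

Lemma inc_sink v L : all (fun D => (ends D).2 == v) (incD v L).
Proof.
elim: L => //= H L IH; case: eqP => [E|_]; first by rewrite /= E eqxx.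
by case: eqP => [E|_] //=; rewrite E eqxx.
Qed.

Lemma size_insertD D L : size (insertD D L) <= (size L).+1.
Proof. by elim: L => //= H L IH; do 2 (case: ifP => //= _). Qed.

Lemma size_buildD (es : seq (T * T)) : size (buildD es) <= size es.
Proof. by elim: es => //= e es IH; apply: leq_trans (size_insertD _ _) _. Qed.

Lemma size_restD v L : size (restD v L) + size (incD v L) = size L.
Proof.
elim: L => //= H L <-; case: (eqVneq (ends H).2 v) => _; first by rewrite orbT addnS.
by rewrite orbF; case: eqP => _; rewrite ?addnS ?addSn.
Qed.

Lemma size_searchD s t vs L : size (searchD s t vs L) <= size L.
Proof.
elim: vs => //= v vs IH; case: ifP => // _; have := size_restD v L.
case: (incD v L) => [|D1 [|D2 [|D3 M]]] //= sz.
have := size_insertD (DSer D1 (DRev D2)) (restD v L); lia.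
Qed.

End Reduction.

(** * The program and its running time *)

(* MathComp reuses the names Cons and Sub. *)
Notation ECons := Defs.Cons.
Notation ESub := Defs.Sub.

(** * Bit lengths *)

Lemma bitlen_le m n : m <= n -> bitlen m <= bitlen n.
Proof. by move=> le; rewrite ltnS leq_trunc_log. Qed.

Lemma bitlen_leP k n : n < 2 ^ k -> 0 < k -> bitlen n <= k.
Proof.
move=> lt k0; have [->|n0] := posnP n; first by rewrite /bitlen trunc_log0.
by rewrite /bitlen -(@ltn_exp2l 2) // (leq_ltn_trans _ lt) // trunc_logP.
Qed.

Lemma bitlenP n : n < 2 ^ bitlen n.
Proof. exact: trunc_log_ltn. Qed.

Lemma bitlen_mul m n a b : bitlen m <= a -> bitlen n <= b -> bitlen (m * n) <= a + b.
Proof.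
move=> ma nb; apply: (@leq_trans (bitlen m + bitlen n)); last exact: leq_add.
by apply: bitlen_leP; rewrite ?expnD // ltn_mul // bitlenP.
Qed.

(** Deliberately coarse: additive bounds for sums as well as products let one tactic bound any
    arithmetic expression. *)
Lemma bitlen_add m n a b : bitlen m <= a -> bitlen n <= b -> bitlen (m + n) <= a + b.
Proof.
move=> ma nb; apply: (@leq_trans (bitlen m + bitlen n)); last exact: leq_add.
apply: bitlen_leP => //; rewrite expnD.
have := bitlenP m; have := bitlenP n.
have : 2 <= 2 ^ bitlen m by rewrite -{1}(expn1 2) leq_exp2l.
have : 2 <= 2 ^ bitlen n by rewrite -{1}(expn1 2) leq_exp2l.
by nia.
Qed.

Lemma bitlen_sub m n a : bitlen m <= a -> bitlen (m - n) <= a.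
Proof. by apply: leq_trans; apply: bitlen_le; apply: leq_subr. Qed.

Lemma bitlen_self n : bitlen n <= n.+1.
Proof. by apply: bitlen_leP => //; apply: leq_trans (ltn_expl n.+1 _). Qed.

(* Accessors for the fields of an item, in the order of encode_item below. *)
Definition fsnk e := Car (Cdr e).
Definition fA e := Car (Cdr (Cdr e)).
Definition fB e := Car (Cdr (Cdr (Cdr e))).
Definition fC e := Car (Cdr (Cdr (Cdr (Cdr e)))).
Definition fD e := Car (Cdr (Cdr (Cdr (Cdr (Cdr e))))).
Definition fE e := Cdr (Cdr (Cdr (Cdr (Cdr (Cdr e))))).
Definition mk x y a b c d e := ECons x (ECons y (ECons a (ECons b (ECons c (ECons d e))))).
(** The language has no equality test; the two truncated differences vanish together only for equal
    numbers. *)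
Definition Neq a b := Add (ESub a b) (ESub b a).
Definition Pred a := ESub a (Const 1).
(* Nonzero iff b <= a. *)
Definition Geq a b := ESub (Add a (Const 1)) b.

(** One multiplication per unit of the exponent. The exponents used are [n + 1], vertex weights,
    [w(G)] and [w(G) + 1], whose values may enter the cost. *)
Definition pow_body :=
  If (Cdr (Var 0))
     (Mul (Car (Var 0)) (Call 1 (ECons (Car (Var 0)) (Pred (Cdr (Var 0))))))
     (Const 1).

Definition nth_body :=
  If (Car (Var 0))
     (Call 2 (ECons (Pred (Car (Var 0))) (Cdr (Cdr (Var 0)))))
     (Car (Cdr (Var 0))).

Definition down_body :=
  If (Var 0) (ECons (Pred (Var 0)) (Call 3 (Pred (Var 0)))) (Const 0).

Definition sum_body :=
  If (IsPair (Var 0)) (Add (Car (Var 0)) (Call 4 (Cdr (Var 0)))) (Const 0).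

(** Division by doubling: quotient and remainder by [2M] give those by [M] after one comparison, and
    the depth is logarithmic in the quotient. *)
Definition divmod_body :=
  let N := Car (Var 0) in let M := Cdr (Var 0) in
  If (Geq N M)
     (Let (Call 5 (ECons N (Add M M)))
        (let M := Cdr (Var 1) in let q := Car (Var 0) in let r := Cdr (Var 0) in
         If (Geq r M) (ECons (Add (Add q q) (Const 1)) (ESub r M))
                      (ECons (Add q q) r)))
     (ECons (Const 0) N).

Definition rev_body :=
  let d := Var 0 in mk (fsnk d) (Car d) (fB d) (fA d) (fC d) (fD d) (fE d).

Definition par_body :=
  let h := Car (Var 0) in let d := Cdr (Var 0) in
  mk (Car h) (fsnk h) (Mul (fA h) (fA d)) (Mul (fB h) (fB d))
     (Add (fD h) (fD d)) (Add (fD h) (fD d)) (Mul (fE h) (fE d)).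

Definition ser_body :=
  let z := Car (Var 0) in
  let h := Car (Cdr (Var 0)) in let d := Cdr (Cdr (Var 0)) in
  mk (Car h) (fsnk d)
     (Add (fA h) (Mul (Mul (fE h) z) (fA d)))
     (Add (fB d) (Mul (Mul (fE d) z) (fB h)))
     (Add (fC h) (fC d))
     (Add (Add (fD h) (fD d)) (Mul (Mul (fB h) z) (fA d)))
     (Mul (Mul (fE h) z) (fE d)).

Definition insert_body :=
  If (IsPair (Cdr (Var 0)))
     (Let (Car (Cdr (Var 0)))
        (let h := Var 0 in let d := Car (Var 1) in let tl := Cdr (Cdr (Var 1)) in
         If (Add (Neq (Car h) (Car d)) (Neq (fsnk h) (fsnk d)))
            (If (Add (Neq (Car h) (fsnk d)) (Neq (fsnk h) (Car d)))
                (ECons h (Call 9 (ECons d tl)))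
                (ECons (Call 7 (ECons h (Call 6 d))) tl))
            (ECons (Call 7 (ECons h d)) tl)))
     (ECons (Car (Var 0)) (Const 0)).

Definition build_body :=
  If (IsPair (Var 0))
     (Call 9 (ECons (mk (Car (Car (Var 0))) (Cdr (Car (Var 0)))
                       (Const 1) (Const 1) (Const 0) (Const 0) (Const 1))
                   (Call 10 (Cdr (Var 0)))))
     (Const 0).

Definition inc_body :=
  If (IsPair (Cdr (Var 0)))
     (Let (Car (Cdr (Var 0)))
        (let h := Var 0 in let v := Car (Var 1) in
         let rec := Call 11 (ECons v (Cdr (Cdr (Var 1)))) in
         If (Neq (fsnk h) v)
            (If (Neq (Car h) v) rec (ECons (Call 6 h) rec))
            (ECons h rec)))
     (Const 0).

Definition rest_body :=
  If (IsPair (Cdr (Var 0)))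
     (Let (Car (Cdr (Var 0)))
        (let h := Var 0 in let v := Car (Var 1) in
         let rec := Call 12 (ECons v (Cdr (Cdr (Var 1)))) in
         If (Neq (Car h) v) (If (Neq (fsnk h) v) (ECons h rec) rec) rec))
     (Const 0).

Definition has_two e :=
  If (IsPair e)
     (If (IsPair (Cdr e)) (If (IsPair (Cdr (Cdr e))) (Const 0) (Const 1)) (Const 0))
     (Const 0).

(** The argument is [(ctx, (vs, L))] with [ctx = (s, (t, (Z, ws)))]; the power of [Z] for the
    eliminated vertex is computed on demand. *)
Definition search_body :=
  If (IsPair (Car (Cdr (Var 0))))
     (Let (Car (Car (Cdr (Var 0))))
        (let v := Var 0 in let ctx := Car (Var 1) in
         let L := Cdr (Cdr (Var 1)) in
         let next := Call 13 (ECons ctx (ECons (Cdr (Car (Cdr (Var 1)))) L)) in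
         If (Neq v (Car ctx))
            (If (Neq v (Car (Cdr ctx)))
                (Let (Call 11 (ECons v L))
                   (let inc := Var 0 in let v := Var 1 in let ctx := Car (Var 2) in
                    let L := Cdr (Cdr (Var 2)) in
                    If (has_two inc)
                       (Call 9
                          (ECons
                             (Call 8
                                (ECons (Call 1 (ECons (Car (Cdr (Cdr ctx)))
                                         (Call 2 (ECons v (Cdr (Cdr (Cdr ctx)))))))
                                   (ECons (Car inc) (Call 6 (Car (Cdr inc))))))
                             (Call 12 (ECons v L))))
                       (Call 13 (ECons ctx (ECons (Cdr (Car (Cdr (Var 2)))) L)))))
                next)
            next))
     (Cdr (Cdr (Var 0))).

Definition iter_body :=
  let k := Car (Var 0) in let ctx := Car (Cdr (Var 0)) in
  let vs := Car (Cdr (Cdr (Var 0))) in let L := Cdr (Cdr (Cdr (Var 0))) in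
  If k
     (Call 14 (ECons (Pred k) (ECons ctx (ECons vs (Call 13 (ECons ctx (ECons vs L)))))))
     L.

(** The bound values are, from the outside in, [X], [Z], the last remaining item, [w(G)], the sum
    [N] over bipartitions, and [N] modulo [X ^ (w(G) + 1)]; a final division extracts the digit. The
    number of vertices serves as the number of rounds, each of which eliminates a vertex while one
    is left. *)
Definition main_body :=
  let n e := Car e in
  let es e := Car (Cdr e) in
  let s e := Car (Cdr (Cdr e)) in
  let t e := Car (Cdr (Cdr (Cdr e))) in
  let ws e := Car (Cdr (Cdr (Cdr (Cdr e)))) in
  Let (Call 1 (ECons (Const 2) (Add (n (Var 0)) (Const 1))))
  (Let (Mul (Var 0) (Var 0))
  (let i := Var 2 in
   Let (Car (Call 14 (ECons (n i)
          (ECons (ECons (s i) (ECons (t i) (ECons (Var 0) (ws i))))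
                (ECons (Call 3 (n i)) (Call 10 (es i)))))))
  (Let (Call 4 (ws (Var 3)))
  (Let (Add (Mul (fB (Var 1)) (Call 1 (ECons (Var 2) (Call 2 (ECons (fsnk (Var 1)) (ws (Var 4)))))))
            (fC (Var 1)))
  (Let (Cdr (Call 5 (ECons (Var 0) (Call 1 (ECons (Var 4) (Add (Var 1) (Const 1)))))))
  (Car (Call 5 (ECons (Var 0) (Call 1 (ECons (Var 5) (Var 2))))))))))).

Definition prog : program :=
  [:: main_body; pow_body; nth_body; down_body; sum_body; divmod_body; rev_body;
      par_body; ser_body; insert_body; build_body; inc_body; rest_body;
      search_body; iter_body].

(** Costs are only bounded from above, so that branches can share a bound and exact running times
    are never named. *)
Definition ev env e v T := exists2 t, eval prog env e v t & t <= T.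
Definition call f u v T := ev [:: u] (nth (Const 0) prog f) v T.

Lemma ev_le env e v T T' : ev env e v T -> T <= T' -> ev env e v T'.
Proof. by case=> t et le le'; exists t => //; apply: leq_trans le'. Qed.

Lemma ev_var env i v : i < size env -> nth (Atom 0) env i = v -> ev env (Var i) v 1.
Proof. by move=> lt <-; exists 1 => //; apply: EvVar. Qed.

Lemma ev_const env n : ev env (Const n) (Atom n) 1.
Proof. by exists 1 => //; apply: EvConst. Qed.

Lemma ev_add env a b m n T1 T2 k1 k2 :
  ev env a (Atom m) T1 -> ev env b (Atom n) T2 -> bitlen m <= k1 -> bitlen n <= k2 ->
  ev env (Add a b) (Atom (m + n)) (T1 + T2 + k1 + k2).+1.
Proof.
case=> t1 e1 l1 [t2 e2 l2] h1 h2; exists (t1 + t2 + bitlen m + bitlen n).+1.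
  exact: EvAdd.
by rewrite ltnS !leq_add.
Qed.

Lemma ev_sub env a b m n T1 T2 k1 k2 :
  ev env a (Atom m) T1 -> ev env b (Atom n) T2 -> bitlen m <= k1 -> bitlen n <= k2 ->
  ev env (ESub a b) (Atom (m - n)) (T1 + T2 + k1 + k2).+1.
Proof.
case=> t1 e1 l1 [t2 e2 l2] h1 h2; exists (t1 + t2 + bitlen m + bitlen n).+1.
  exact: EvSub.
by rewrite ltnS !leq_add.
Qed.

Lemma ev_mul env a b m n T1 T2 k1 k2 :
  ev env a (Atom m) T1 -> ev env b (Atom n) T2 -> bitlen m <= k1 -> bitlen n <= k2 ->
  ev env (Mul a b) (Atom (m * n)) (T1 + T2 + k1 + k2).+1.
Proof.
case=> t1 e1 l1 [t2 e2 l2] h1 h2; exists (t1 + t2 + bitlen m + bitlen n).+1.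
  exact: EvMul.
by rewrite ltnS !leq_add.
Qed.

Lemma ev_cons env a b u v T1 T2 : ev env a u T1 -> ev env b v T2 ->
  ev env (ECons a b) (Pair u v) (T1 + T2).+1.
Proof.
case=> t1 e1 l1 [t2 e2 l2]; exists (t1 + t2).+1; first exact: EvCons.
by rewrite ltnS leq_add.
Qed.

Lemma ev_car env a u v T : ev env a (Pair u v) T -> ev env (Car a) u T.+1.
Proof. by case=> t e l; exists t.+1 => //; apply: EvCar e. Qed.

Lemma ev_cdr env a u v T : ev env a (Pair u v) T -> ev env (Cdr a) v T.+1.
Proof. by case=> t e l; exists t.+1 => //; apply: EvCdr e. Qed.

Lemma ev_if_pair env c a b u1 u2 v T1 T2 : ev env c (Pair u1 u2) T1 -> ev env a v T2 ->
  ev env (If (IsPair c) a b) v (T1 + T2).+2.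
Proof.
case=> t1 e1 l1 [t2 e2 l2]; exists (t1.+1 + t2).+1; last by rewrite !ltnS leq_add.
by apply: EvIfTrue e2; [|apply: EvIsPairTrue e1].
Qed.

Lemma ev_if_npair env c a b n v T1 T2 : ev env c (Atom n) T1 -> ev env b v T2 ->
  ev env (If (IsPair c) a b) v (T1 + T2).+2.
Proof.
case=> t1 e1 l1 [t2 e2 l2]; exists (t1.+1 + t2).+1; last by rewrite !ltnS leq_add.
by apply: EvIfFalse e2; apply: EvIsPairFalse e1.
Qed.

Lemma ev_if_true env c a b n v T1 T2 : ev env c (Atom n) T1 -> n != 0 -> ev env a v T2 ->
  ev env (If c a b) v (T1 + T2).+1.
Proof.
case=> t1 e1 l1 /eqP n0 [t2 e2 l2]; exists (t1 + t2).+1; last by rewrite !ltnS leq_add.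
by apply: EvIfTrue e1 e2 => -[].
Qed.

Lemma ev_if_false env c a b n v T1 T2 : ev env c (Atom n) T1 -> n = 0 -> ev env b v T2 ->
  ev env (If c a b) v (T1 + T2).+1.
Proof.
case=> t1 e1 l1 n0 [t2 e2 l2]; exists (t1 + t2).+1; last by rewrite !ltnS leq_add.
by rewrite n0 in e1; apply: EvIfFalse e1 e2.
Qed.

Lemma ev_let env a b u v T1 T2 : ev env a u T1 -> ev (u :: env) b v T2 ->
  ev env (Let a b) v (T1 + T2).+1.
Proof.
case=> t1 e1 l1 [t2 e2 l2]; exists (t1 + t2).+1; first exact: EvLet e1 e2.
by rewrite ltnS leq_add.
Qed.

Lemma ev_call env f a u v T1 T2 : f < size prog -> ev env a u T1 -> call f u v T2 ->
  ev env (Call f a) v (T1 + T2).+1.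
Proof.
move=> lt [t1 e1 l1] [t2 e2 l2]; exists (t1 + t2).+1; first exact: EvCall e1 e2.
by rewrite ltnS leq_add.
Qed.

Lemma ev_pred env a n T k : ev env a (Atom n.+1) T -> bitlen n.+1 <= k ->
  ev env (Pred a) (Atom n) (T + k).+3.
Proof.
move=> e le; have H := ev_sub e (ev_const env 1) le (leqnn _).
rewrite subn1 in H; apply: ev_le H _; have -> : bitlen 1 = 1 by []; lia.
Qed.

Ltac bits :=
  first [ eapply bitlen_mul; [bits | bits] | eapply bitlen_add; [bits | bits]
        | eapply bitlen_sub; bits | exact: leqnn ].

(** Symbolic execution directed by the syntax, with the cost left as an existential variable; [tac]
    closes the calls. Conditionals on numbers are branched by hand, since their outcome has to be
    proved. *)
Ltac run tac :=
  lazymatch goal with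
  | |- ev _ (Var _) _ _ => eapply ev_var; [reflexivity | reflexivity]
  | |- ev _ (Const _) _ _ => eapply ev_const
  | |- ev _ (Pred _) _ _ => eapply ev_pred; [run tac | bits]
  | |- ev _ (Add _ _) _ _ => eapply ev_add; [run tac | run tac | bits | bits]
  | |- ev _ (Defs.Sub _ _) _ _ => eapply ev_sub; [run tac | run tac | bits | bits]
  | |- ev _ (Mul _ _) _ _ => eapply ev_mul; [run tac | run tac | bits | bits]
  | |- ev _ (Defs.Cons _ _) _ _ => eapply ev_cons; [run tac | run tac]
  | |- ev _ (Car _) _ _ => eapply ev_car; run tac
  | |- ev _ (Cdr _) _ _ => eapply ev_cdr; run tac
  | |- ev _ (Let _ _) _ _ => eapply ev_let; [run tac | run tac]
  | |- ev _ (If (IsPair _) _ _) _ _ =>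
      first [ eapply ev_if_pair; [solve [run tac] | run tac]
            | eapply ev_if_npair; [solve [run tac] | run tac] ]
  | |- ev _ (Call _ _) _ _ => eapply ev_call; [reflexivity | run tac | tac]
  | |- ev _ ?e _ _ => let e' := eval hnf in e in progress change_no_check e with e'; run tac
  | |- _ => idtac
  end.

Lemma bitlen0 : bitlen 0 = 1. Proof. by []. Qed.
Lemma bitlen1 : bitlen 1 = 1. Proof. by []. Qed.

Ltac cost := have := bitlen0; have := bitlen1; lia.

Lemma call_pow X k K : 0 < X -> bitlen (X ^ k) <= K -> bitlen k <= K -> bitlen X <= K ->
  call 1 (Pair (Atom X) (Atom k)) (Atom (X ^ k)) (k.+1 * (20 + 3 * K)).
Proof.
move=> X0; elim: k => [|k IH] bX bk b1.
  rewrite /call; eapply ev_le.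
    eapply ev_if_false; [run idtac | reflexivity | run idtac].
  by cost.
(* The last power is the largest, so its bit length bounds all intermediate ones. *)
have bX' : bitlen (X ^ k) <= K.
  by apply: leq_trans bX; apply: bitlen_le; rewrite leq_pexp2l.
have bk' : bitlen k <= K by apply: leq_trans bk; apply: bitlen_le.
rewrite /call (expnS X k); eapply ev_le.
  eapply ev_if_true; [run idtac | by [] | run ltac:(apply: IH => //)].
by cost.
Qed.

Lemma call_nth (l : seq nat) k K : bitlen k <= K -> k < size l ->
  call 2 (Pair (Atom k) (encode_seq (map Atom l))) (Atom (nth 0 l k)) (k.+1 * (20 + K)).
Proof.
elim: l k => //= m l IH [|k] bk lt.
  rewrite /call; eapply ev_le.
    eapply ev_if_false; [run idtac | reflexivity | run idtac].
  by cost.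
have bk' : bitlen k <= K by apply: leq_trans bk; apply: bitlen_le.
rewrite /call; eapply ev_le.
  eapply ev_if_true; [run idtac | by [] | run ltac:(apply: IH => //)].
by cost.
Qed.

Lemma call_down k K : bitlen k <= K ->
  call 3 (Atom k) (encode_seq (map Atom (rev (iota 0 k)))) (k.+1 * (20 + 2 * K)).
Proof.
elim: k => [|k IH] bk.
  rewrite /call; eapply ev_le.
    eapply ev_if_false; [run idtac | reflexivity | run idtac].
  by cost.
have bk' : bitlen k <= K by apply: leq_trans bk; apply: bitlen_le.
rewrite /call -[in iota _ _](addn1 k) iotaD add0n rev_cat; eapply ev_le.
  eapply ev_if_true; [run idtac | by [] | run ltac:(apply: IH => //)].
by cost.
Qed.

Lemma call_sum l K : bitlen (sumn l) <= K ->
  call 4 (encode_seq (map Atom l)) (Atom (sumn l)) ((size l).+1 * (20 + 2 * K)).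
Proof.
elim: l => [|m l IH] /= bK.
  by rewrite /call; eapply ev_le; [run idtac | cost].
have b1 : bitlen (sumn l) <= K by apply: leq_trans bK; apply/bitlen_le/leq_addl.
have b2 : bitlen m <= K by apply: leq_trans bK; apply/bitlen_le/leq_addr.
rewrite /call; eapply ev_le; first by run ltac:(apply: IH => //).
by cost.
Qed.

Lemma geqP N M : (N + 1 - M != 0) = (M <= N).
Proof. by rewrite subn_eq0 addn1 -ltnNge. Qed.

(** [j] bounds the number of doublings. The divisor may have one bit more than [N], since it is
    doubled only while it does not exceed [N]. *)
Lemma call_divmod j N M K : 0 < M -> N < 2 ^ j * M -> bitlen N <= K -> bitlen M <= K.+1 ->
  call 5 (Pair (Atom N) (Atom M)) (Pair (Atom (N %/ M)) (Atom (N %% M)))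
    (j.+1 * (100 + 20 * K)).
Proof.
elim: j M => [|j IH] M M0 lt bN bM.
  rewrite mul1n in lt.
  have E : N + 1 - M = 0 by apply/eqP; rewrite subn_eq0 addn1.
  rewrite divn_small // modn_small // /call; eapply ev_le.
    by eapply ev_if_false; [run idtac | exact: E | run idtac].
  by cost.
case: (leqP M N) => [le|lt']; last first.
  have E : N + 1 - M = 0 by apply/eqP; rewrite subn_eq0 addn1.
  rewrite divn_small // modn_small // /call; eapply ev_le.
    by eapply ev_if_false; [run idtac | exact: E | run idtac].
  by cost.
have ge : N + 1 - M != 0 by rewrite geqP.
have M20 : 0 < M + M by rewrite addn_gt0 M0.
have lt2 : N < 2 ^ j * (M + M) by move: lt; rewrite expnS addnn -mul2n mulnCA mulnA.
have bMN : bitlen M <= K by apply: leq_trans bN; apply: bitlen_le.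
have bMM : bitlen (M + M) <= K.+1.
  rewrite addnn -mul2n; have Mb := bitlenP M.
  apply: bitlen_leP => //; rewrite expnS ltn_mul2l /=.
  by apply: leq_trans Mb _; rewrite leq_exp2l.
have dE := divn_eq N (M + M); have rlt : N %% (M + M) < M + M by rewrite ltn_mod.
have bq : bitlen (N %/ (M + M)) <= K.
  by apply: leq_trans bN; apply: bitlen_le; apply: leq_div.
have br : bitlen (N %% (M + M)) <= K.
  by apply: leq_trans bN; apply: bitlen_le; apply: leq_mod.
move: (N %/ (M + M)) (N %% (M + M)) (IH _ M20 lt2 bN bMM) dE rlt bq br => q r H dE rlt bq br.
case: (leqP M r) => [ler|ltr].
  have E1 : N %/ M = q + q + 1.
    rewrite dE (_ : _ + r = (q + q + 1) * M + (r - M)); last by nia.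
    by rewrite divnMDl // divn_small ?addn0 // ltn_subLR.
  have E2 : N %% M = r - M.
    rewrite dE (_ : _ + r = (q + q + 1) * M + (r - M)); last by nia.
    by rewrite modnMDl // modn_small // ltn_subLR.
  have ge2 : r + 1 - M != 0 by rewrite geqP.
  rewrite E1 E2 /call; eapply ev_le.
    eapply ev_if_true; [run idtac | exact: ge | eapply ev_let; [run ltac:(exact: H)|]].
    by eapply ev_if_true; [run idtac | exact: ge2 | run idtac].
  by cost.
have E1 : N %/ M = q + q.
  rewrite dE (_ : _ + r = (q + q) * M + r); last by nia.
  by rewrite divnMDl // divn_small ?addn0.
have E2 : N %% M = r.
  rewrite dE (_ : _ + r = (q + q) * M + r); last by nia.
  by rewrite modnMDl // modn_small.
have ge2 : r + 1 - M = 0 by apply/eqP; rewrite subn_eq0 addn1.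
rewrite E1 E2 /call; eapply ev_le.
  eapply ev_if_true; [run idtac | exact: ge | eapply ev_let; [run ltac:(exact: H)|]].
  by eapply ev_if_false; [run idtac | exact: ge2 | run idtac].
by cost.
Qed.

Definition encode_item (x y : nat) (l : label) : Defs.val :=
  Pair (Atom x) (Pair (Atom y) (Pair (Atom (lsrc l)) (Pair (Atom (lsnk l))
    (Pair (Atom (lclosed l)) (Pair (Atom (lopen l)) (Atom (ltotal l))))))).

Definition label_bits K l : Prop :=
  [/\ bitlen (lsrc l) <= K, bitlen (lsnk l) <= K, bitlen (lclosed l) <= K,
      bitlen (lopen l) <= K & bitlen (ltotal l) <= K].

Lemma label_bits_le K K' l : K <= K' -> label_bits K l -> label_bits K' l.
Proof. by move=> le [? ? ? ? ?]; split; lia. Qed.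

Lemma rev_label_bits K l : label_bits K l -> label_bits K (rev_label l).
Proof. by case. Qed.

(** The factor 5 comes from the open component: two summands and a product of three factors, of [K]
    bits each. *)
Lemma ser_label_bits K z l1 l2 : bitlen z <= K -> label_bits K l1 -> label_bits K l2 ->
  label_bits (5 * K) (ser_label z l1 l2).
Proof.
move=> bz [a1 a2 a3 a4 a5] [b1 b2 b3 b4 b5]; split=> /=.
all: by eapply leq_trans; [bits | lia].
Qed.

Lemma call_rev x y l : call 6 (encode_item x y l) (encode_item y x (rev_label l)) 100.
Proof. by rewrite /call; eapply ev_le; [run idtac | cost]. Qed.

Lemma call_par K x y x' y' l1 l2 : label_bits K l1 -> label_bits K l2 ->
  call 7 (Pair (encode_item x y l1) (encode_item x' y' l2))
         (encode_item x y (par_label l1 l2)) (200 + 20 * K).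
Proof.
move=> [a1 a2 a3 a4 a5] [b1 b2 b3 b4 b5].
by rewrite /call; eapply ev_le; [run idtac | cost].
Qed.

Lemma call_ser K z x y x' y' l1 l2 : bitlen z <= K ->
  label_bits K l1 -> label_bits K l2 ->
  call 8 (Pair (Atom z) (Pair (encode_item x y l1) (encode_item x' y' l2)))
         (encode_item x y' (ser_label z l1 l2)) (300 + 60 * K).
Proof.
move=> bz [a1 a2 a3 a4 a5] [b1 b2 b3 b4 b5].
by rewrite /call; eapply ev_le; [run idtac | cost].
Qed.

(** * Running times on lists of items *)

Section Items.
Variables (n : nat) (z : 'I_n -> nat) (K : nat).
Implicit Types (D H : dterm 'I_n) (L : seq (dterm 'I_n)) (v : 'I_n).

Definition encode_term D : Defs.val := encode_item (ends D).1 (ends D).2 (dlabel z D).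
Definition encode_terms L : Defs.val := encode_seq (map encode_term L).
Definition term_bits D := label_bits K (dlabel z D).

Lemma neq_sub (i j : nat) : ((i - j) + (j - i) == 0) = (i == j).
Proof. by rewrite addn_eq0 !subn_eq0 eqn_leq. Qed.

Lemma neq_sub2 (p q : 'I_n * 'I_n) :
  ((p.1 - q.1) + (q.1 - p.1) + ((p.2 - q.2) + (q.2 - p.2)) == 0) = (p == q).
Proof. by rewrite addn_eq0 !neq_sub -pair_eqE. Qed.

Hypothesis nK : n <= K.

Let ordK (i : 'I_n) : bitlen i <= K.
Proof. by apply: leq_trans (bitlen_self _) _; apply: leq_trans nK. Qed.

Fixpoint all_bits L : Prop := if L is D :: L' then term_bits D /\ all_bits L' else True.

Lemma call_insert D L : term_bits D -> all_bits L ->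
  call 9 (Pair (encode_term D) (encode_terms L)) (encode_terms (insertD D L))
    ((size L).+1 * (600 + 60 * K)).
Proof.
move=> bD; elim: L => [|H L IH] /= bL.
  by rewrite /call; eapply ev_le; [run idtac | cost].
case: bL => bH bL.
have d1 := ordK (ends D).1; have d2 := ordK (ends D).2.
have h1 := ordK (ends H).1; have h2 := ordK (ends H).2.
rewrite /call; case: ifP => [/eqP E|N1].
  eapply ev_le.
    eapply ev_if_pair; [run idtac | eapply ev_let; [run idtac|]].
    eapply ev_if_false; [run idtac | | ].
      by apply/eqP; rewrite neq_sub2 E.
    by run ltac:(apply: call_par bH bD).
  by cost.
case: ifP => [/eqP E|N2].
  eapply ev_le.
    eapply ev_if_pair; [run idtac | eapply ev_let; [run idtac|]].
    eapply ev_if_true; [run idtac | by rewrite neq_sub2 N1 | ].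
    eapply ev_if_false; [run idtac | | ].
      by apply/eqP; rewrite (neq_sub2 (ends H) (ends (DRev D))) E.
    by run ltac:(first [apply: call_rev
                       | apply: call_par bH (rev_label_bits bD)]).
  by cost.
eapply ev_le.
  eapply ev_if_pair; [run idtac | eapply ev_let; [run idtac|]].
  eapply ev_if_true; [run idtac | by rewrite neq_sub2 N1 | ].
  eapply ev_if_true; [run idtac | by rewrite (neq_sub2 (ends H) (ends (DRev D))) N2 | ].
  by run ltac:(apply: IH).
by cost.
Qed.

Definition encode_edges (es : seq ('I_n * 'I_n)) : Defs.val :=
  encode_seq [seq Pair (Atom (nat_of_ord e.1)) (Atom (nat_of_ord e.2)) | e <- es].

(** Bit lengths are assumed for every intermediate list, because composition rules alone would let
    them grow with each insertion. The assumption is met later through the meaning of the labels. *)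
Lemma call_build (es : seq ('I_n * 'I_n)) : 0 < K ->
    (forall es', {subset es' <= es} -> all_bits (buildD es')) ->
  call 10 (encode_edges es) (encode_terms (buildD es))
    ((size es).+1 * ((size es).+1 * (1000 + 60 * K))).
Proof.
move=> K0; elim: es => [|e es IH] B.
  by rewrite /call; eapply ev_le; [run idtac | cost].
have sub : {subset es <= e :: es} by move=> x; rewrite inE orbC => ->.
have {}IH := IH (fun es' s => B es' (fun x xs => sub x (s x xs))).
have bE : term_bits (DEdge e.1 e.2) by split.
have bL := B es sub; have sz := size_buildD es.
rewrite /call; eapply ev_le.
  by run ltac:(first [exact: IH | apply: call_insert bE bL]).
rewrite /=; set m := size (buildD es) in sz *; set p := size es in sz *.
have : m.+1 * (600 + 60 * K) <= p.+1 * (600 + 60 * K) by rewrite leq_mul2r ltnS sz orbT.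
by nia.
Qed.

Lemma call_inc v L :
  call 11 (Pair (Atom v) (encode_terms L)) (encode_terms (incD v L))
    ((size L).+1 * (300 + 20 * K)).
Proof.
elim: L => [|H L IH] /=.
  by rewrite /call; eapply ev_le; [run idtac | cost].
have bv := ordK v; have h1 := ordK (ends H).1; have h2 := ordK (ends H).2.
rewrite /call; case: eqP => [E|/eqP N1].
  eapply ev_le.
    eapply ev_if_pair; [run idtac | eapply ev_let; [run idtac|]].
    eapply ev_if_false; [run idtac | | ].
      by apply/eqP; rewrite neq_sub E.
    by run ltac:(exact: IH).
  by cost.
case: eqP => [E|/eqP N2].
  eapply ev_le.
    eapply ev_if_pair; [run idtac | eapply ev_let; [run idtac|]].
    eapply ev_if_true; [run idtac | by rewrite neq_sub | ].
    eapply ev_if_false; [run idtac | | ].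
      by apply/eqP; rewrite neq_sub E.
    by run ltac:(first [exact: IH | apply: call_rev]).
  by cost.
eapply ev_le.
  eapply ev_if_pair; [run idtac | eapply ev_let; [run idtac|]].
  eapply ev_if_true; [run idtac | by rewrite neq_sub | ].
  eapply ev_if_true; [run idtac | by rewrite neq_sub | ].
  by run ltac:(exact: IH).
by cost.
Qed.

Lemma call_rest v L :
  call 12 (Pair (Atom v) (encode_terms L)) (encode_terms (restD v L))
    ((size L).+1 * (300 + 20 * K)).
Proof.
elim: L => [|H L IH] /=.
  by rewrite /call; eapply ev_le; [run idtac | cost].
have bv := ordK v; have h1 := ordK (ends H).1; have h2 := ordK (ends H).2.
rewrite /call; case: eqP => [E|/eqP N1] /=.
  eapply ev_le.
    eapply ev_if_pair; [run idtac | eapply ev_let; [run idtac|]].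
    eapply ev_if_false; [run idtac | | ].
      by apply/eqP; rewrite neq_sub E.
    by run ltac:(exact: IH).
  by cost.
case: eqP => [E|/eqP N2].
  eapply ev_le.
    eapply ev_if_pair; [run idtac | eapply ev_let; [run idtac|]].
    eapply ev_if_true; [run idtac | by rewrite neq_sub | ].
    eapply ev_if_false; [run idtac | | ].
      by apply/eqP; rewrite neq_sub E.
    by run ltac:(exact: IH).
  by cost.
eapply ev_le.
  eapply ev_if_pair; [run idtac | eapply ev_let; [run idtac|]].
  eapply ev_if_true; [run idtac | by rewrite neq_sub | ].
  eapply ev_if_true; [run idtac | by rewrite neq_sub | ].
  by run ltac:(exact: IH).
by cost.
Qed.

Lemma all_bits_inc v L : all_bits L -> all_bits (incD v L).
Proof.
elim: L => //= H L IH [bH /IH bL]; case: eqP => // _; case: eqP => // _; split=> //.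
exact: rev_label_bits bH.
Qed.

Lemma all_bits_rest v L : all_bits L -> all_bits (restD v L).
Proof. by elim: L => //= H L IH [bH /IH bL]; case: ifP. Qed.

End Items.

Lemma all_bits_le n (z : 'I_n -> nat) K K' L : K <= K' -> all_bits z K L -> all_bits z K' L.
Proof. by move=> le; elim: L => //= D L IH [/(label_bits_le le) ? /IH]. Qed.

Section Search.
Variables (n K Z : nat) (w : 'I_n -> nat) (s t : 'I_n).
Let z v := Z ^ w v.
Let ws := [seq w i | i <- enum 'I_n].
Hypotheses (nK : n <= K) (Z0 : 0 < Z) (bZ : bitlen Z <= K).
Hypotheses (wK : forall v, w v <= K) (bw : forall v, bitlen (w v) <= K)
  (bz : forall v, bitlen (z v) <= K).
Implicit Types (v : 'I_n) (vs : seq 'I_n) (L : seq (dterm 'I_n)).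

Definition encode_ctx : Defs.val :=
  Pair (Atom s) (Pair (Atom t) (Pair (Atom Z) (encode_seq (map Atom ws)))).

Definition encode_vs vs : Defs.val := encode_seq (map Atom (map (@nat_of_ord n) vs)).

Let ordK (i : 'I_n) : bitlen i <= K.
Proof. by apply: leq_trans (bitlen_self _) _; apply: leq_trans nK. Qed.

Lemma call_weight v :
  call 2 (Pair (Atom v) (encode_seq (map Atom ws))) (Atom (w v)) (K.+1 * (20 + K)).
Proof.
have <- : nth 0 ws v = w v.
  by rewrite (nth_map v) ?size_enum_ord // nth_ord_enum.
apply: ev_le (call_nth (ordK v) _) _; first by rewrite size_map size_enum_ord.
rewrite leq_mul2r ltnS; apply/orP; right; apply: leq_trans nK; exact: ltnW.
Qed.

Lemma call_zpow v :
  call 1 (Pair (Atom Z) (Atom (w v))) (Atom (z v)) (K.+1 * (20 + 3 * K)).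
Proof.
apply: ev_le (call_pow Z0 (bz v) (bw v) bZ) _.
by rewrite leq_mul2r ltnS wK orbT.
Qed.

(** The first summand pays for scanning the items, the second for looking up a weight and raising
    [Z] to it. *)
Definition step_cost m := m.+1 * (2000 + 400 * K) + K.+1 * (100 + 100 * K).

Lemma call_search vs L : all_bits z K L ->
  call 13 (Pair encode_ctx (Pair (encode_vs vs) (encode_terms z L)))
    (encode_terms z (searchD s t vs L)) ((size vs).+1 * step_cost (size L)).
Proof.
move=> bL; have bs := ordK s; have bt := ordK t.
elim: vs => [|v vs IH] /=.
  by rewrite /call; eapply ev_le; [run idtac | rewrite /step_cost; cost].
have bv := ordK v.
rewrite /call; case: (eqVneq v s) => [E|N1] /=.
  eapply ev_le.
    eapply ev_if_pair; [run idtac | eapply ev_let; [run idtac|]].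
    eapply ev_if_false; [run idtac | | ].
      by apply/eqP; rewrite neq_sub E.
    by run ltac:(exact: IH).
  by rewrite [(size vs).+2 * _]mulSn; move: ((size vs).+1 * step_cost _) => c; rewrite /step_cost; cost.
case: (eqVneq v t) => [E|N2].
  eapply ev_le.
    eapply ev_if_pair; [run idtac | eapply ev_let; [run idtac|]].
    eapply ev_if_true; [run idtac | by rewrite neq_sub | ].
    eapply ev_if_false; [run idtac | | ].
      by apply/eqP; rewrite neq_sub E.
    by run ltac:(exact: IH).
  by rewrite [(size vs).+2 * _]mulSn; move: ((size vs).+1 * step_cost _) => c; rewrite /step_cost; cost.
have Hinc := call_inc z nK v L.
have bI := all_bits_inc v bL; have bR := all_bits_rest v bL.
have szR := size_restD v L.
case E: (incD v L) Hinc bI => [|D1 [|D2 [|D3 M]]] Hinc bI.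
- eapply ev_le.
    eapply ev_if_pair; [run idtac | eapply ev_let; [run idtac|]].
    eapply ev_if_true; [run idtac | by rewrite neq_sub | ].
    eapply ev_if_true; [run idtac | by rewrite neq_sub | ].
    eapply ev_let; [run ltac:(exact: Hinc)|].
    eapply ev_if_false; [run idtac | reflexivity | ].
    by run ltac:(exact: IH).
  by rewrite [(size vs).+2 * _]mulSn; move: ((size vs).+1 * step_cost _) => c; rewrite /step_cost; cost.
- eapply ev_le.
    eapply ev_if_pair; [run idtac | eapply ev_let; [run idtac|]].
    eapply ev_if_true; [run idtac | by rewrite neq_sub | ].
    eapply ev_if_true; [run idtac | by rewrite neq_sub | ].
    eapply ev_let; [run ltac:(exact: Hinc)|].
    eapply ev_if_false; [run idtac | reflexivity | ].
    by run ltac:(exact: IH).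
  by rewrite [(size vs).+2 * _]mulSn; move: ((size vs).+1 * step_cost _) => c; rewrite /step_cost; cost.
- case: bI => b1 [b2 _].
  (* This coarse bound only serves to cost the insertion and is not passed on to the next round. *)
  have b5 : term_bits z (5 * K) (DSer D1 (DRev D2)).
    exact: ser_label_bits (bz _) b1 (rev_label_bits b2).
  have le5 : K <= 5 * K by lia.
  have bR5 := all_bits_le le5 bR.
  have nK5 := leq_trans nK le5.
  have Hins := call_insert nK5 b5 bR5.
  have Hser : call 8 (Pair (Atom (z v)) (Pair (encode_term z D1) (encode_term z (DRev D2))))
      (encode_term z (DSer D1 (DRev D2))) (300 + 60 * K).
    have := inc_sink v L; rewrite E /= => /and3P[/eqP v1 _ _].
    have := call_ser (ends D1).1 (ends D1).2 (ends D2).2 (ends D2).1 (bz v) b1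
      (rev_label_bits b2).
    by rewrite /encode_term /= v1.
  eapply ev_le.
    eapply ev_if_pair; [run idtac | eapply ev_let; [run idtac|]].
    eapply ev_if_true; [run idtac | by rewrite neq_sub | ].
    eapply ev_if_true; [run idtac | by rewrite neq_sub | ].
    eapply ev_let; [run ltac:(exact: Hinc)|].
    eapply ev_if_true; [run idtac | by [] | ].
    by run ltac:(first [exact: Hins | exact: Hser | exact: call_weight | exact: call_zpow
       | apply: call_rev | exact: (call_rest z nK)]).
  rewrite E /= in szR.
  rewrite [(size vs).+2 * _]mulSn; move: ((size vs).+1 * step_cost _) => c; rewrite /step_cost -szR; move: (size (restD v L)) => r; cost.
- eapply ev_le.
    eapply ev_if_pair; [run idtac | eapply ev_let; [run idtac|]].
    eapply ev_if_true; [run idtac | by rewrite neq_sub | ].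
    eapply ev_if_true; [run idtac | by rewrite neq_sub | ].
    eapply ev_let; [run ltac:(exact: Hinc)|].
    eapply ev_if_false; [run idtac | reflexivity | ].
    by run ltac:(exact: IH).
  by rewrite [(size vs).+2 * _]mulSn; move: ((size vs).+1 * step_cost _) => c; rewrite /step_cost; cost.
Qed.
End Search.

(** * Polynomial bounds in two variables *)

Definition polynomial2 (f : nat -> nat -> nat) : Prop :=
  exists q : {poly {poly nat}}, forall g W, f g W = (q.[g%:P].[W])%R.

Lemma polynomial2_const c : polynomial2 (fun _ _ => c).
Proof. by exists (c%:P%:P)%R => g W; rewrite !hornerC. Qed.

Lemma polynomial2_fst : polynomial2 (fun g _ => g).
Proof. by exists 'X%R => g W; rewrite hornerX hornerC. Qed.

Lemma polynomial2_snd : polynomial2 (fun _ W => W).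
Proof. by exists ('X%:P)%R => g W; rewrite hornerC hornerX. Qed.

Lemma polynomial2_add f h : polynomial2 f -> polynomial2 h ->
  polynomial2 (fun g W => f g W + h g W).
Proof. by case=> p fp [q hq]; exists (p + q)%R => g W; rewrite !hornerD -fp -hq. Qed.

Lemma polynomial2_mul f h : polynomial2 f -> polynomial2 h ->
  polynomial2 (fun g W => f g W * h g W).
Proof. by case=> p fp [q hq]; exists (p * q)%R => g W; rewrite !hornerM -fp -hq. Qed.

Lemma polynomial2_succ f : polynomial2 f -> polynomial2 (fun g W => (f g W).+1).
Proof.
case: (polynomial2_const 1) => q1 h1 [q hq].
by exists (q1 + q)%R => g W; rewrite !hornerD -h1 -hq.
Qed.

Section Iterate.
Variables (n K Z : nat) (w : 'I_n -> nat) (s t : 'I_n).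
Let z v := Z ^ w v.
Hypotheses (nK : n <= K) (Z0 : 0 < Z) (bZ : bitlen Z <= K).
Hypotheses (wK : forall v, w v <= K) (bw : forall v, bitlen (w v) <= K)
  (bz : forall v, bitlen (z v) <= K).

(** The bit bound is required of all iterates at once, so no growth accumulates; the list never gets
    longer, so one cost bound fits every round. *)
Lemma call_iter k vs L m : bitlen k <= K -> size L <= m ->
    (forall j, all_bits z K (iter j (searchD s t vs) L)) ->
  call 14 (Pair (Atom k) (Pair (encode_ctx Z w s t)
            (Pair (encode_vs vs) (encode_terms z L))))
    (encode_terms z (iter k (searchD s t vs) L))
    (k.+1 * ((size vs).+1 * step_cost K m + (100 + 20 * K))).
Proof.
elim: k L => [|k IH] L bk sL B.
  rewrite /call; eapply ev_le.
    eapply ev_if_false; [run idtac | reflexivity | run idtac].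
  by cost.
have bk' : bitlen k <= K by apply: leq_trans bk; apply: bitlen_le.
have B' j : all_bits z K (iter j (searchD s t vs) (searchD s t vs L)).
  by rewrite -iterSr; apply: B.
have S := call_search s t nK Z0 bZ wK bw bz vs (B 0).
have le : (size vs).+1 * step_cost K (size L) <= (size vs).+1 * step_cost K m.
  by rewrite leq_mul2l /= /step_cost leq_add2r leq_mul2r ltnS sL orbT.
rewrite /call iterSr; eapply ev_le.
  eapply ev_if_true; [run idtac | by [] | ].
  by run ltac:(first [exact: S | apply: (IH _ bk' (leq_trans (size_searchD _ _ _ _) sL) B')]).
rewrite [k.+2 * _]mulSn; move: le.
move: ((size vs).+1 * step_cost K (size L)) ((size vs).+1 * step_cost K m) => c2 c3.
by move: (k.+1 * (c3 + _)) => c1; cost.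
Qed.
End Iterate.

(** [K] dominates the numbers of vertices and edges, the weights and the bit lengths. The factor 10
    leaves room for the sum [N] of [main_body], bounded through its parts by [2n + 6(n + 1)W + 3]
    bits. Most summands are the bounds for the calls made by [main_body]. *)
Definition total_cost g W :=
  let K := 10 * g.+1 * W.+1 in
  1000 + 100 * K + 10 * (K.+1 * (20 + 3 * K)) + K.+1 * (20 + 2 * K) + K.+1 * (20 + 2 * K)
  + K.+1 * (K.+1 * (1000 + 60 * K))
  + K.+1 * (K.+1 * step_cost K K + (100 + 20 * K)) + K.+1 * (20 + K)
  + 2 * (K.+1 * (100 + 20 * K)).

Lemma total_cost_polynomial : polynomial2 total_cost.
Proof.
rewrite /total_cost /step_cost.
do ! first [ apply: polynomial2_add | apply: polynomial2_mul | apply: polynomial2_fst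
  | apply: polynomial2_snd | apply: polynomial2_const | apply: polynomial2_succ].
Qed.

(** * The run on a given series-parallel graph *)

Section Main.
Variables (G : ttgraph) (w : 'I_(nv G) -> nat).
Hypothesis spG : series_parallel G.
Let n := nv G.
Let W := weight w [set: 'I_n].
Let X := 2 ^ (n + 1).
Let Z := X * X.
Let z (v : 'I_n) := Z ^ w v.
Let K := 10 * (gsize G).+1 * W.+1.
Let s : 'I_n := source G.
Let t : 'I_n := sink G.
Let vs := rev (enum 'I_n).
Let L j := iter j (searchD s t vs) (buildD (edges G)).

Let ZE k : Z ^ k = X ^ (2 * k).
Proof. by rewrite /Z mulnn expnM. Qed.

Let Z0 : 0 < Z. Proof. by rewrite muln_gt0 expn_gt0. Qed.

Let bitlen_pow2 k : bitlen (2 ^ k) <= k.+1.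
Proof. by apply: bitlen_leP => //; rewrite ltn_exp2l. Qed.

Let wW v : w v <= W.
Proof. by rewrite /W /weight (bigD1 v) ?inE //= leq_addr. Qed.

Let nG : n <= gsize G. Proof. exact: leq_addr. Qed.

Let nK : n <= K.
Proof. by rewrite /K; nia. Qed.

Let pow2_bits e : e <= 2 * (n + 1) * W.+1 -> bitlen (2 ^ e) <= K.
Proof. by move=> le; apply: leq_trans (bitlen_pow2 _) _; rewrite /K; nia. Qed.

Let zE v : z v = 2 ^ (2 * (n + 1) * w v).
Proof. by rewrite /z ZE /X -expnM; congr (_ ^ _); lia. Qed.

Let bz v : bitlen (z v) <= K.
Proof. by rewrite zE; apply: pow2_bits; have := wW v; nia. Qed.

Let bound_bits l : l <= 2 ^ n * Z ^ W -> bitlen l <= n + 2 * (n + 1) * W + 1.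
Proof.
move=> le; apply: leq_trans (bitlen_le le) _.
have -> : 2 ^ n * Z ^ W = 2 ^ (n + 2 * (n + 1) * W).
  by rewrite ZE /X -expnM -expnD; congr (_ ^ _); lia.
by rewrite (addn1 (n + _)); apply: bitlen_pow2.
Qed.

Let bits_wf D : wf D -> label_bits (n + 2 * (n + 1) * W + 1) (dlabel z D).
Proof.
move=> /(label_bounds w Z0) /=; rewrite card_ord.
have -> : \sum_i w i = W by rewrite /W /weight; apply: eq_bigl => i; rewrite inE.
by case=> *; split; apply: bound_bits.
Qed.

Let all_bits_over A M : all (dterm_over A) M -> all_bits z K M.
Proof.
elim: M => //= D M IH /andP[/and3P[/bits_wf b _ _] /IH]; split=> //.
by apply: label_bits_le b; rewrite /K; nia.
Qed.

Let edges_ok (A : seq 'I_n) es : (forall x, x \in A) -> {subset es <= edges G} ->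
  all (fun e => [&& e.1 != e.2, e.1 \in A & e.2 \in A]) es.
Proof.
move=> mA sub; have [_ irr _ _] := sp_reducible spG.
apply/allP=> -[x y] /sub e; rewrite /= !mA !andbT; apply/eqP=> xy.
by have := irr x; rewrite /adj /= {2}xy e.
Qed.

Let init : exists us, reduction_state s t us (L 0) /\ size us <= n.
Proof.
have [st irr cross [us [uus usE ns gd]]] := sp_reducible spG.
have relE : rel_of (buildD (edges G)) =2 @adj G.
  by move=> x y; rewrite build_rel adjE.
have uA : uniq [:: s, t & us].
  by rewrite /= inE negb_or st uus !usE !eqxx /= andbF.
have mA x : x \in [:: s, t & us].
  by rewrite !inE usE; case: (x == s); case: (x == t).
have [//|oL nL] := build_over uA (edges_ok mA (es := edges G) _).
exists us; split; last first.
  by have := uniq_leq_size uus (s2 := enum 'I_n); rewrite size_enum_ord;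
    apply=> x _; rewrite mem_enum.
split=> //; rewrite ?nL ?cats0 //.
  exact: build_uniq_key.
split; first by rewrite (good_ext _ relE).
move=> U a sU nU; have [u [y [? ? ? e]]] := ns U a sU nU.
by exists u, y; rewrite relE.
Qed.

Let allvs v : v \in vs. Proof. by rewrite mem_rev mem_enum. Qed.

(** Every round preserves [reduction_state], whose items are well formed, and labels of well-formed
    terms are bounded uniformly. *)
Let bitsL j : all_bits z K (L j).
Proof.
have [us [S _]] := init.
suff [us' [oL _ _ _ _]] : exists us', reduction_state s t us' (L j).
  exact: all_bits_over oL.
elim: j => [|j [us' S']]; first by exists us.
have [us2 _ S2] := state_search S' allvs.
by exists us2.
Qed.

Let edges_nonempty : 0 < size (edges G).
Proof.
have [st irr cross _] := sp_reducible spG.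
have [||u [y [_ _]]] := cross [set s]; rewrite ?inE //.
  by rewrite eq_sym.
by rewrite adjE; case: (edges G).
Qed.

Let final : exists D, [/\ L n = [:: D], wf D, verts D = setT & dedges D =i edges G].
Proof.
have [us [S sz]] := init.
have Sn := state_iter S allvs sz.
have Ledges : alledges (L n) =i edges G.
  suff H k : alledges (L k) =i edges G by exact: H.
  by elim: k => [|k IH] e; [apply: build_edges | rewrite [LHS]search_edges IH].
have Lpos : 0 < size (L n).
  case: (L n) Ledges => [|D M] // H; case: (edges G) edges_nonempty H => // e es _.
  by move=> /(_ e); rewrite mem_head.
have [D [E wD vD]] := state_final Sn Lpos.
exists D; split=> // e.
have : (e \in alledges (L n)) = (e \in dedges D).
  by rewrite [L n]E /alledges /= cats0.
by rewrite Ledges.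
Qed.

Let ws := [seq w i | i <- enum 'I_n].

Let sumn_ws : sumn ws = W.
Proof.
rewrite sumnE big_map big_enum /W /weight; apply: eq_bigl => i.
by rewrite !inE.
Qed.

Let encodeE : encode w = Pair (Atom n) (Pair (encode_edges (edges G))
  (Pair (Atom s) (Pair (Atom t) (Pair (encode_seq (map Atom ws)) (Atom 0))))).
Proof. by rewrite /encode /ws -map_comp. Qed.

(** The last item may run from sink to source, so the counted blocks are those avoiding
    [(ends D).1], whichever terminal this is; [card_P20] holds for any base vertex. *)
Let decode_count D : wf D -> verts D = setT -> dedges D =i edges G ->
  let l := dlabel z D in
  (lsnk l * z (ends D).2 + lclosed l) %% X ^ (W + 1) %/ X ^ W = #|P20 w|.
Proof.
move=> wD vD eD /=; have -> := label_total w Z wD vD.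
rewrite (eq_bigr (fun B : {set 'I_n} => X ^ (2 * weight w B))); last first.
  by move=> B _; rewrite ZE.
rewrite addn1 digit_sum; last first.
  apply: leq_ltn_trans (card_bipartitions D) _.
  by rewrite card_ord /X ltn_exp2l // addn1.
rewrite (card_P20 w (ends D).1); apply: eq_card => B; rewrite !inE.
by rewrite !(conn_eq_mem _ eD).
Qed.

Lemma main_computes :
  exists2 T, computes_in prog (encode w) (Atom #|P20 w|) T & T <= total_cost (gsize G) W.
Proof.
have [D [LE wD vD eD]] := final.
rewrite -(decode_count wD vD eD) /computes_in encodeE.
have bn1 : bitlen (n + 1) <= K.
  by apply: leq_trans (bitlen_self _) _; rewrite /K; nia.
have bn : bitlen n <= K by apply: leq_trans bn1; apply: bitlen_le; rewrite leq_addr.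
have WK : W <= K by rewrite /K; nia.
have bW1 : bitlen (W + 1) <= K.
  by apply: leq_trans (bitlen_self _) _; rewrite /K; nia.
have bW : bitlen W <= K by apply: leq_trans bW1; apply: bitlen_le; rewrite leq_addr.
have bX : bitlen X <= K by apply: pow2_bits; nia.
have bZ : bitlen Z <= K.
  by rewrite /Z /X -expnD; apply: leq_trans (bitlen_pow2 _) _; rewrite /K; nia.
have b2 : bitlen 2 <= K by apply: leq_trans (bitlen_self _) _; rewrite /K; nia.
have wK v : w v <= K by apply: leq_trans (wW v) WK.
have bw v : bitlen (w v) <= K by apply: leq_trans (bitlen_le (wW v)) bW.
have mG : size (edges G) <= K by rewrite /K /gsize; nia.
have bXW : bitlen (X ^ W) <= K by rewrite /X -expnM; apply: pow2_bits; nia.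
have bXW1 : bitlen (X ^ (W + 1)) <= K by rewrite /X -expnM; apply: pow2_bits; nia.
have X0 : 0 < X by rewrite expn_gt0.
have mono a b c : a <= b -> a.+1 * c <= b.+1 * c by move=> le; rewrite leq_mul2r ltnS le orbT.
have cX : call 1 (Pair (Atom 2) (Atom (n + 1))) (Atom X) (K.+1 * (20 + 3 * K)).
  by apply: ev_le (call_pow _ bX bn1 b2) _; rewrite // mono // /K; nia.
have cvs : call 3 (Atom n) (encode_vs vs) (K.+1 * (20 + 2 * K)).
  rewrite /encode_vs /vs map_rev val_enum_ord.
  by apply: ev_le (call_down bn) _; rewrite mono.
have cb : call 10 (encode_edges (edges G)) (encode_terms z (L 0))
    (K.+1 * (K.+1 * (1000 + 60 * K))).
  apply: ev_le (call_build nK _ _) _; first by rewrite /K.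
    move=> es' sub; have mA (x : 'I_n) : x \in enum 'I_n by rewrite mem_enum.
    have [oL _] := build_over (enum_uniq _) (edges_ok mA sub).
    exact: all_bits_over oL.
  by apply: leq_mul; [rewrite ltnS | apply: mono].
have cit : call 14 (Pair (Atom n) (Pair (encode_ctx Z w s t)
            (Pair (encode_vs vs) (encode_terms z (L 0))))) (encode_terms z [:: D])
    (K.+1 * (K.+1 * step_cost K K + (100 + 20 * K))).
  rewrite -LE; have szL : size (L 0) <= K by apply: leq_trans mG; apply: size_buildD.
  apply: ev_le (call_iter nK Z0 bZ wK bw bz bn szL bitsL) _.
  apply: leq_mul; first by rewrite ltnS.
  by rewrite leq_add2r mono // /vs size_rev size_enum_ord.
have csum : call 4 (encode_seq (map Atom ws)) (Atom W) (K.+1 * (20 + 2 * K)).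
  rewrite -sumn_ws; apply: ev_le (call_sum (K := K) _) _; first by rewrite sumn_ws.
  by rewrite mono // size_map size_enum_ord.
have cw := call_weight w nK (ends D).2.
have cz := call_zpow Z0 bZ wK bw bz (ends D).2.
have cXW1 : call 1 (Pair (Atom X) (Atom (W + 1))) (Atom (X ^ (W + 1))) (K.+1 * (20 + 3 * K)).
  by apply: ev_le (call_pow X0 bXW1 bW1 bX) _; rewrite mono // /K; nia.
have cXW : call 1 (Pair (Atom X) (Atom W)) (Atom (X ^ W)) (K.+1 * (20 + 3 * K)).
  by apply: ev_le (call_pow X0 bXW bW bX) _; rewrite mono.
have [_ ba bb _ _] := bits_wf wD.
set N := lsnk (dlabel z D) * z (ends D).2 + lclosed (dlabel z D).
have bN : bitlen N <= K.
  have bzy : bitlen (z (ends D).2) <= 2 * (n + 1) * W + 1.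
    by rewrite zE; apply: leq_trans (bitlen_pow2 _) _; have := wW (ends D).2; nia.
  apply: leq_trans (bitlen_add (bitlen_mul ba bzy) bb) _.
  by rewrite /K; nia.
have bR : bitlen (N %% X ^ (W + 1)) <= K.
  by apply: leq_trans bN; apply: bitlen_le; apply: leq_mod.
(* [K] doublings of any positive divisor exceed a number of at most [K] bits. *)
have lt_pow m p : bitlen m <= K -> 0 < p -> m < 2 ^ K * p.
  move=> le p0; apply: leq_trans (bitlenP m) _.
  by apply: leq_trans (leq_pmulr _ p0); rewrite leq_exp2l.
have XW0 : 0 < X ^ W by rewrite expn_gt0 X0.
have XW10 : 0 < X ^ (W + 1) by rewrite expn_gt0 X0.
have cd1 := call_divmod XW10 (lt_pow _ _ bN XW10) bN (leqW bXW1).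
have cd2 := call_divmod XW0 (lt_pow _ _ bR XW0) bR (leqW bXW).
suff H : ev [:: Pair (Atom n) (Pair (encode_edges (edges G))
    (Pair (Atom s) (Pair (Atom t) (Pair (encode_seq (map Atom ws)) (Atom 0)))))]
    (Call 0 (Var 0)) (Atom (N %% X ^ (W + 1) %/ X ^ W)) (total_cost (gsize G) W).
  exact: H.
eapply ev_le.
  eapply ev_call; [reflexivity | run idtac | ].
  rewrite /call.
  run ltac:(first [exact: cX | exact: cvs | exact: cb | exact: cit | exact: csum
    | exact: cw | exact: cz | exact: cXW1 | exact: cXW | exact: cd1 | exact: cd2]).
rewrite /total_cost -/K.
have bA : bitlen (lsnk (dlabel z D)) <= K by apply: leq_trans ba _; rewrite /K; nia.
have bB : bitlen (lclosed (dlabel z D)) <= K by apply: leq_trans bb _; rewrite /K; nia.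
have bzy : bitlen (Z ^ w (ends D).2) <= K := bz _.
(* Bit lengths and the largest products become variables before the arithmetic is left to [lia]. *)
move: (bitlen n) (bitlen W) (bitlen X) (bitlen (lsnk _)) (bitlen (lclosed _))
  (bitlen (Z ^ _)) bn bW bX bA bB bzy => b1 b2' b3 b4 b5 b6 h1 h2 h3 h4 h5 h6.
move: (K.+1 * (K.+1 * step_cost K K + _)) (K.+1 * (K.+1 * (1000 + _))) => c1 c2.
by clear -h1 h2 h3 h4 h5 h6; move: K h1 h2 h3 h4 h5 h6 => k *; cost.
Qed.
End Main.

Theorem mainTheorem19 :
  exists (p : program) (q : {poly {poly nat}}),
    forall (G : ttgraph) (w : 'I_(nv G) -> nat), series_parallel G ->
      exists2 t : nat,
        computes_in p (encode w) (Atom #|P20 w|) t &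
        t <= (q.[(gsize G)%:P].[weight w [set: 'I_(nv G)]])%R.
Proof.
have [q qE] := total_cost_polynomial.
exists prog, q => G w spG; have [T run_T le_T] := main_computes w spG.
by exists T; rewrite // -qE.
Qed.
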